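(* Let $0<\alpha<1$, $\rho>0$, $t_0>0$ and $A\in\mathbb{R}^{d\times d}$ with $\sigma(A)\subset\{\lambda\in\mathbb{C}:\ |\arg(\lambda)|>\frac{\alpha\pi}{2}\}$. Let $f:\mathbb{R}^d\to\mathbb{R}^d$ be a locally Lipschitz continuous function with $f(0)=0$ and $\lim_{r\to 0}\ell_f(r)=0$, where $$\ell_f(r):=\sup_{x,y\in B_{\mathbb{R}^d}(0,r),\,x\neq y}\frac{\|f(x)-f(y)\|}{\|x-y\|}.$$ Then the zero solution of the system $$^{C}D_{t_0^{+}}^{\alpha,\rho}x(t)=Ax(t)+f(x(t)),\quad t\ge t_0,$$ is asymptotically stable.
   Context: For $0<\alpha<1$, $\rho>0$ and $a>0$, the Caputo-Katugampola fractional derivative of a function $u$ is $$^{C}D_{a^{+}}^{\alpha,\rho}u(t)=\frac{\rho^{\alpha}}{\Gamma(1-\alpha)}\,t^{1-\rho}\frac{d}{dt}\int_a^t\frac{s^{\rho-1}[u(s)-u(a)]}{(t^\rho-s^\rho)^{\alpha}}\,ds,$$ applied componentwise to vector-valued functions. Solutions of initial value problems with $x(t_0)=x_0$ exist and are unique; $x(t,x_0)$ denotes the solution on its maximal interval of existence $[t_0,t_{max}(x_0))$. The equilibrium $0$ is stable if for every $\varepsilon>0$ there is $\delta>0$ such that $\|x_0\|\le\delta$ implies $t_{max}(x_0)=\infty$ and $\|x(t,x_0)\|\le\varepsilon$ for all $t\ge t_0$; it is asymptotically stable if it is stable and there exists $c>0$ such that $\|x_0\|\le c$ implies $\lim_{t\to\infty}x(t,x_0)=0$.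 *)

(* Defs.v *)
From HB Require Import structures.
From mathcomp Require Import all_boot all_order all_algebra.
From mathcomp Require Import all_classical all_reals all_analysis.
From mathcomp Require Import complex.
Set Implicit Arguments. Unset Strict Implicit. Unset Printing Implicit Defensive.
Import Order.TTheory GRing.Theory Num.Theory.
Import numFieldNormedType.Exports.
Local Open Scope classical_set_scope.
Local Open Scope ring_scope.

Notation Cplx R := (complex.complex R).

(* Principal argument of a complex number, with values in (-pi, pi];
   convention arg 0 = 0 (so 0 never satisfies |arg| > alpha*pi/2). *)
Definition carg {R : realType} (z : Cplx R) : R :=
  let a := complex.Re z in let b := complex.Im z in
  if (a == 0) && (b == 0) then 0
  else if 0 <= b then acos (a / Num.sqrt (a ^+ 2 + b ^+ 2))
  else - acos (a / Num.sqrt (a ^+ 2 + b ^+ 2)).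

Definition spectrum {R : realType} (d : nat) (A : 'M[R]_d) : set (Cplx R) :=
  [set l | eigenvalue (map_mx (fun r : R => complex.Complex r 0) A) l].

Definition Gamma {R : realType} (z : R) : R :=
  Rintegral lebesgue_measure `]0, +oo[ (fun s : R => powR s (z - 1) * expR (- s)).

Definition CK_kernel {R : realType} (alpha rho a : R) (u : R -> R) (t : R) : R -> R :=
  fun s => powR s (rho - 1) * (u s - u a) / powR (powR t rho - powR s rho) alpha.

Definition CK_integral {R : realType} (alpha rho a : R) (u : R -> R) (t : R) : R :=
  Rintegral lebesgue_measure `[a, t] (CK_kernel alpha rho a u t).

Definition CK_exists {R : realType} (alpha rho a : R) (u : R -> R) (t : R) : Prop :=
  (\forall tau \near t,
     lebesgue_measure.-integrable `[a, tau] (EFin \o CK_kernel alpha rho a u tau))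
  /\ derivable (CK_integral alpha rho a u) t 1.

Definition CK_deriv {R : realType} (alpha rho a : R) (u : R -> R) (t : R) : R :=
  powR rho alpha / Gamma (1 - alpha) * powR t (1 - rho)
  * derive1 (CK_integral alpha rho a u) t.

Definition is_global_solution {R : realType} (d : nat) (alpha rho t0 : R)
    (A : 'M[R]_d) (f : 'cV[R]_d -> 'cV[R]_d) (x0 : 'cV[R]_d)
    (x : R -> 'cV[R]_d) : Prop :=
  x t0 = x0 /\
  {within `[t0, +oo[, continuous x} /\
  forall t, t0 < t -> forall i : 'I_d,
    CK_exists alpha rho t0 (fun s => x s i ord0) t /\
    CK_deriv alpha rho t0 (fun s => x s i ord0) t = (A *m x t + f (x t)) i ord0.

(* Stability of the zero solution. Solutions exist and are unique (standing
   fact); "t_max(x0) = oo" is expressed as existence of a global solution. *)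
Definition zero_stable {R : realType} (d : nat) (alpha rho t0 : R)
    (A : 'M[R]_d) (f : 'cV[R]_d -> 'cV[R]_d) : Prop :=
  forall eps : R, 0 < eps -> exists2 delta : R, 0 < delta &
    forall x0 : 'cV[R]_d, `|x0| <= delta ->
      (exists x, is_global_solution alpha rho t0 A f x0 x) /\
      (forall x, is_global_solution alpha rho t0 A f x0 x ->
         forall t, t0 <= t -> `|x t| <= eps).

Definition zero_asymptotically_stable {R : realType} (d : nat) (alpha rho t0 : R)
    (A : 'M[R]_d) (f : 'cV[R]_d -> 'cV[R]_d) : Prop :=
  zero_stable alpha rho t0 A f /\
  exists2 c : R, 0 < c &
    forall x0 : 'cV[R]_d, `|x0| <= c ->
      (exists x, is_global_solution alpha rho t0 A f x0 x) /\
      (forall x, is_global_solution alpha rho t0 A f x0 x ->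
         x t @[t --> +oo] --> (0 : 'cV[R]_d)).

Definition locally_lipschitz {R : realType} (d : nat) (f : 'cV[R]_d -> 'cV[R]_d) : Prop :=
  forall x : 'cV[R]_d, exists2 r : R, 0 < r & exists L : R,
    forall y z, ball x r y -> ball x r z -> `|f y - f z| <= L * `|y - z|.

Definition lip_const {R : realType} (d : nat) (f : 'cV[R]_d -> 'cV[R]_d) (r : R) : \bar R :=
  ereal_sup [set ((`|f xy.1 - f xy.2| / `|xy.1 - xy.2|)%:E) | xy in
     [set xy : 'cV[R]_d * 'cV[R]_d | ball 0 r xy.1 /\ ball 0 r xy.2 /\ xy.1 != xy.2]].

(* Main.v *)
(* The substitution [tau = t^rho - t0^rho] turns the Caputo-Katugampola system into the
   Volterra equation [z = z0 + c k * (A z + f(z))] with [k(s) = s^(alpha-1)] and [c > 0].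

   The kernel [k] is of positive type along the sector boundary: [k(u) e^(i(1-alpha)pi/2)]
   is a limit of series of characters with nonnegative coefficients.  Hence a solution of
   [y = g + A (k * y)] whose matrix has its spectrum in the sector satisfies
   [int_0^T |y|^2 <= C int_0^T |g|^2] uniformly in [T], first for scalars and then for
   matrices by Cayley-Hamilton.

   Applied to the resolvent [psi] of [A^T], to its primitive [S] and to [t psi(t)], after
   subtraction of an explicit profile, this shows that [S(t) -> 0], that [psi] is
   integrable on [0, +oo), and that [int_T^2T |psi| -> 0].  In the variation of constants
   formula [z = S z0 + psi * f(z)] a Lipschitz constant of [f] that is small near the
   origin then gives existence and boundedness by truncation and a first exit argument,
   and decay by iterating a contraction of [limsup |z|]. *)
Require Import Defs.
From HB Require Import structures.
From mathcomp Require Import all_boot all_order all_algebra.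
From mathcomp Require Import all_classical all_reals all_analysis measurable_realfun.
From mathcomp Require Import complex.
From mathcomp Require Import ring lra.
Import Order.TTheory GRing.Theory Num.Theory.
Import numFieldNormedType.Exports.
Local Open Scope classical_set_scope.
Local Open Scope ring_scope.

Set Implicit Arguments. Unset Strict Implicit. Unset Printing Implicit Defensive.

(* [lra] and [nra] are slow in contexts that contain unrelated hypotheses. *)
Ltac arith_clear := repeat match goal with
  | H : is_true (@Order.le _ _ _ _) |- _ => revert H
  | H : is_true (@Order.lt _ _ _ _) |- _ => revert H
  end; clear; intros.
Ltac lra_ := arith_clear; lra.
Ltac nra_ := arith_clear; nra.

(** Decay of the resolvent rests on a quadratic inequality, in place of contour integrals and
    Mittag-Leffler asymptotics, and such an inequality controls only averages over [0, T]. The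
    nonlinear step needs more: a finite gain in the sup norm, and a gain that forgets the past.
    Three devices bridge the gap. The equation of [S] is forced by a constant, whose energy grows
    like T; the profile cancels this constant up to a decaying error, so the remaining forcing has
    energy O(T^(1 - 2 kap)). Multiplication by t is a derivation for convolution, so t psi(t) solves
    an equation of the same type, forced by the integral of psi; dividing by t afterwards gives
    integrability of psi block by block. Finally the increments of [S] are integrals of psi, so on a
    dyadic block the value of [S] follows its mean. The transpose of [A] appears because one
    component of z pairs z0 and f(z) with one row of the resolvent matrix, and a row is handled as a
    column vector. *)

Lemma eq_le_num (K : numDomainType) (x y : K) : x = y -> x <= y.
Proof. by move->. Qed.

Lemma near_eq_continuous_at (T U : topologicalType) (f g : T -> U) (t : T) :
  {near t, f =1 g} -> {for t, continuous f} -> {for t, continuous g}.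
Proof.
move=> e cf; rewrite /prop_for/continuous_at -(nbhs_singleton e).
apply: cvg_trans cf; apply: near_eq_cvg.
by apply: filterS e.
Qed.

(** * Integrals of functions that may be singular at the endpoints of an interval *)

Section open_interval_calculus.
Context {R : realType}.
Notation mu := (@lebesgue_measure R).
Implicit Types (f g F G : R -> R) (a b c d x y : R).

(** Integrals run over the closed interval, as in [CK_integral], whereas most lemmas below ask for
    hypotheses in the interior only: endpoints are null sets, and the kernels take conventional
    values there. *)
Definition intble a b f := mu.-integrable `[a, b] (EFin \o f).
Definition rint a b f : R := \int[mu]_(x in `[a, b]) f x.
Definition contoo a b f := forall x, a < x -> x < b -> {for x, continuous f}.

Lemma contoo_measurable a b f : contoo a b f -> measurable_fun `]a, b[ f.
Proof.
move=> cf; apply: subspace_continuous_measurable_fun => //.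
apply: continuous_in_subspaceT => x; rewrite inE/= in_itv/= => /andP[ax xb].
exact: cf.
Qed.

Lemma measurable_oo_cc a b f :
  measurable_fun `]a, b[ f -> measurable_fun `[a, b] f.
Proof.
move=> mf; have /measurable_EFinP mf' := mf.
apply/measurable_EFinP.
have [ab|ba] := ltP a b; last first.
  move: ba; rewrite le_eqVlt => /predU1P[<-|ba].
    by rewrite set_itv1; exact: measurable_fun_set1.
  by rewrite set_itv_ge ?bnd_simp -?ltNge//; exact: measurable_fun_set0.
apply/emeasurable_fun_itv_bndo_bndcP/emeasurable_fun_itv_obnd_cbndP.
exact: mf'.
Qed.

Lemma intble_oo a b f : measurable_fun `]a, b[ f ->
  mu.-integrable `]a, b[ (EFin \o f) <-> intble a b f.
Proof.
move=> mf; split => [/integrableP[_ i]|]; last first.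
  by apply: integrableS => //; exact: subset_itv_oo_cc.
apply/integrableP; split; first by apply/measurable_EFinP; exact: measurable_oo_cc.
rewrite (@integral_itv_bndoo _ a b _ true false)//.
by apply: measurableT_comp => //; exact/measurable_EFinP.
Qed.

Lemma rint_oo a b f : measurable_fun `]a, b[ f ->
  rint a b f = \int[mu]_(x in `]a, b[) f x.
Proof.
move=> mf; rewrite /rint /Rintegral; congr fine.
by apply: (@integral_itv_bndoo _ a b _ true false); exact/measurable_EFinP.
Qed.

Lemma eq_rint a b f g : measurable_fun `]a, b[ f ->
  (forall x, a < x -> x < b -> f x = g x) -> rint a b f = rint a b g.
Proof.
move=> mf fg; rewrite rint_oo// rint_oo; last first.
  apply: eq_measurable_fun mf => x; rewrite inE/= in_itv/= => /andP[? ?].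
  exact: fg.
by apply: eq_Rintegral => x; rewrite inE/= in_itv/= => /andP[? ?]; exact: fg.
Qed.

Lemma intble_measurable a b f : intble a b f -> measurable_fun `[a, b] f.
Proof. by move=> /integrableP[/measurable_EFinP]. Qed.

Lemma intble_measurable_oo a b f : intble a b f -> measurable_fun `]a, b[ f.
Proof.
move=> /intble_measurable; apply: measurable_funS => //.
exact: subset_itv_oo_cc.
Qed.

Lemma eq_intble a b f g : (forall x, a < x -> x < b -> f x = g x) ->
  intble a b f -> intble a b g.
Proof.
move=> fg /[dup] /intble_measurable_oo mf /(intble_oo mf) fi.
have e : {in `]a, b[%classic, EFin \o f =1 EFin \o g}.
  by move=> x; rewrite inE/= in_itv/= => /andP[? ?]; rewrite /= fg.
apply/intble_oo; last by apply: eq_integrable fi => //; exact: e.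
apply: eq_measurable_fun mf => x; rewrite inE/= in_itv/= => /andP[? ?].
exact: fg.
Qed.

Lemma le_intble a b f g : measurable_fun `]a, b[ f ->
  (forall x, a < x -> x < b -> `|f x| <= g x) -> intble a b g ->
  intble a b f.
Proof.
move=> mf fg /[dup] /intble_measurable_oo mg /(intble_oo mg) gi.
apply/intble_oo => //; apply: le_integrable gi => //.
  exact/measurable_EFinP.
move=> x /=; rewrite in_itv/= => /andP[ax xb]; rewrite lee_fin.
by rewrite (le_trans (fg _ ax xb))// ler_norm.
Qed.

Lemma intbleZ a b k f : intble a b f -> intble a b (fun x => k * f x).
Proof. by move=> fi; have := @integrableZl _ _ _ _ _ _ k _ fi; exact. Qed.

Lemma intbleD a b f g : intble a b f -> intble a b g ->
  intble a b (fun x => f x + g x).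
Proof. by move=> fi gi; have := @integrableD _ _ _ _ _ _ _ _ fi gi; exact. Qed.

Lemma intbleB a b f g : intble a b f -> intble a b g ->
  intble a b (fun x => f x - g x).
Proof. by move=> fi gi; have := @integrableB _ _ _ _ _ _ _ _ fi gi; exact. Qed.

Lemma intble_norm a b f : intble a b f -> intble a b (fun x => `|f x|).
Proof. by move=> fi; have := integrable_norm fi. Qed.

Lemma intble_cst a b k : intble a b (fun=> k).
Proof.
apply: continuous_compact_integrable; first exact: segment_compact.
by apply: continuous_subspaceT => x; exact: cvg_cst.
Qed.

Lemma intbleS a b c d f : a <= c -> d <= b -> intble a b f -> intble c d f.
Proof.
move=> ac db; apply: integrableS => //.
by apply: subset_itv; rewrite bnd_simp.
Qed.

Lemma rintZ a b k f : intble a b f ->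
  rint a b (fun x => k * f x) = k * rint a b f.
Proof. by move=> fi; rewrite /rint RintegralZl. Qed.

Lemma rintD a b f g : intble a b f -> intble a b g ->
  rint a b (fun x => f x + g x) = rint a b f + rint a b g.
Proof. by move=> fi gi; rewrite /rint RintegralD. Qed.

Lemma rintB a b f g : intble a b f -> intble a b g ->
  rint a b (fun x => f x - g x) = rint a b f - rint a b g.
Proof. by move=> fi gi; rewrite /rint RintegralB. Qed.

Lemma le_rint a b f g : intble a b f -> intble a b g ->
  (forall x, a < x -> x < b -> f x <= g x) -> rint a b f <= rint a b g.
Proof.
move=> fi gi fg; rewrite !rint_oo; [|exact: intble_measurable_oo..].
apply: le_Rintegral => //.
- by apply/intble_oo => //; exact: intble_measurable_oo.
- by apply/intble_oo => //; exact: intble_measurable_oo.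
- by move=> x /=; rewrite in_itv/= => /andP[? ?]; exact: fg.
Qed.

Lemma rint_cst a b k : a <= b -> rint a b (fun=> k) = k * (b - a).
Proof.
move=> ab; rewrite /rint Rintegral_cst//= lebesgue_measure_itv/= lte_fin.
by move: ab; rewrite le_eqVlt => /predU1P[->|->//]; rewrite ltxx subrr.
Qed.

Lemma rint_ge0 a b f : intble a b f ->
  (forall x, a < x -> x < b -> 0 <= f x) -> 0 <= rint a b f.
Proof.
move=> fi f0; apply: le_trans (le_rint (intble_cst a b 0) fi f0).
by rewrite /rint Rintegral_ge0.
Qed.

Lemma le_norm_rint a b f : intble a b f ->
  `|rint a b f| <= rint a b (fun x => `|f x|).
Proof. by move=> fi; rewrite /rint le_normr_Rintegral. Qed.

Lemma norm_rint_le a b f g : measurable_fun `]a, b[ f -> intble a b g ->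
  (forall x, a < x -> x < b -> `|f x| <= g x) -> `|rint a b f| <= rint a b g.
Proof.
move=> mf gi fg; have fi := le_intble mf fg gi.
apply: (le_trans (le_norm_rint fi)); apply: le_rint => //.
exact: intble_norm.
Qed.

Lemma rint_chasles a b c f : a <= b -> b <= c -> intble a c f ->
  rint a c f = rint a b f + rint b c f.
Proof.
move=> ab bc fi; have := @Rintegral_itvB R f (BLeft a) (BRight c) b fi.
rewrite !bnd_simp => /(_ ab bc) h.
rewrite /rint -(@Rintegral_itv_obnd_cbnd _ b); last first.
  by apply: integrableS fi => //; apply: subset_itv; rewrite bnd_simp.
by rewrite -h subrKC.
Qed.

Lemma rint_sum a b (I : Type) (s : seq I) (f_ : I -> R -> R) :
  (forall i, intble a b (f_ i)) ->
  intble a b (fun x => \sum_(i <- s) f_ i x) /\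
  rint a b (fun x => \sum_(i <- s) f_ i x) = \sum_(i <- s) rint a b (f_ i).
Proof.
move=> fi; elim: s => [|i s [ih1 ih2]].
  split; first by under eq_fun do rewrite big_nil; exact: intble_cst.
  rewrite big_nil; under [X in rint _ _ X]eq_fun do rewrite big_nil.
  by rewrite /rint Rintegral_cst// mul0r.
split; first by under eq_fun do rewrite big_cons; exact: intbleD.
by rewrite big_cons -ih2 -rintD//; congr rint; apply/funext => x; rewrite big_cons.
Qed.

Lemma derive_contoo a b F f :
  (forall x, a < x -> x < b -> is_derive x 1 F (f x)) -> contoo a b F.
Proof.
move=> dF x ax xb; have [dx _] := dF x ax xb.
exact/differentiable_continuous/derivable1_diffP.
Qed.

Lemma derive0_oo_cst a b F :
  (forall x, a < x -> x < b -> is_derive x 1 F 0) ->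
  forall x y, a < x -> x < b -> a < y -> y < b -> F x = F y.
Proof.
move=> dF x y; wlog xy : x y / x <= y.
  by move=> h; case: (leP x y) => [/h//|/ltW/h h'] *; rewrite h'.
move=> ax xb ay yb; have h z : z \in `[x, y] -> a < z /\ z < b.
  rewrite in_itv/= => /andP[xz zy].
  by rewrite (lt_le_trans ax xz) (le_lt_trans zy yb).
have [||c _] := @MVT_segment R F (fun=> 0) x y xy.
- by move=> z zxy; have [] := h z (subset_itv_oo_cc zxy); exact: dF.
- apply: continuous_in_subspaceT => z; rewrite inE/= => /h[az zb].
  exact: (derive_contoo dF).
by rewrite mul0r => /eqP; rewrite subr_eq0 => /eqP.
Qed.

Lemma rint_derive a b f x : a < x -> x < b -> intble a b f ->
  {for x, continuous f} -> is_derive x 1 (fun z => rint a z f) (f x).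
Proof.
move=> ax xb fi cf.
have [dF F'] := @continuous_FTC1_closed R f a x b xb fi ax cf.
by apply: DeriveDef; [exact: dF|rewrite -derive1E; exact: F'].
Qed.

Lemma rint_cvg_right a b f : a < b -> intble a b f ->
  rint a x f @[x --> a^'+] --> 0.
Proof.
move=> ab fi; apply: cvg_at_right_filter.
exact: (parameterized_integral_cvg_left ab fi).
Qed.

Lemma rint_cvg_left a b f : a < b -> intble a b f ->
  rint a x f @[x --> b^'-] --> rint a b f.
Proof. by move=> ab fi; exact: (parameterized_integral_cvg_at_left ab fi). Qed.

(** [F] minus the indefinite integral of [f] has derivative zero inside, hence is constant there;
    comparing its limits at the two ends gives the formula. *)
Lemma FTC_open a b f F (l m : R) : a < b -> intble a b f -> contoo a b f ->
  (forall x, a < x -> x < b -> is_derive x 1 F (f x)) ->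
  F x @[x --> a^'+] --> l -> F x @[x --> b^'-] --> m ->
  rint a b f = m - l.
Proof.
move=> ab fi cf dF Fl Fm.
pose H x := F x - rint a x f.
have dH x : a < x -> x < b -> is_derive x 1 H 0.
  move=> ax xb; have d1 := dF x ax xb; have d2 := rint_derive ax xb fi (cf x ax xb).
  by apply: is_derive_eq; rewrite subrr.
have Hl : H x @[x --> a^'+] --> l - 0 by apply: cvgB => //; exact: rint_cvg_right fi.
have Hm : H x @[x --> b^'-] --> m - rint a b f.
  by apply: cvgB => //; exact: rint_cvg_left.
pose c := (a + b) / 2; have [ac cb] : a < c /\ c < b by rewrite /c; split; lra_.
have Hcl : H x @[x --> a^'+] --> H c.
  apply: cvg_trans (@cvg_cst _ (H c) _ (a^'+) _); apply: near_eq_cvg.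
  near=> x; apply: (derive0_oo_cst dH) => //.
have Hcm : H x @[x --> b^'-] --> H c.
  apply: cvg_trans (@cvg_cst _ (H c) _ (b^'-) _); apply: near_eq_cvg.
  near=> x; apply: (derive0_oo_cst dH) => //.
have e1 : l - 0 = H c by apply: (cvg_unique _ Hl Hcl).
have e2 : m - rint a b f = H c by apply: (cvg_unique _ Hm Hcm).
by apply/eqP; rewrite eq_sym subr_eq addrC -subr_eq e2 -e1 subr0.
Unshelve. all: by end_near. Qed.

(** Integrability is a conclusion here: [F] is nondecreasing, so the integrals over an exhausting
    sequence of segments stay below [m - l], and monotone convergence applies. *)
Lemma FTC_open_ge0 a b f F (l m : R) : a < b -> contoo a b f ->
  (forall x, a < x -> x < b -> 0 <= f x) ->
  (forall x, a < x -> x < b -> is_derive x 1 F (f x)) ->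
  F x @[x --> a^'+] --> l -> F x @[x --> b^'-] --> m ->
  intble a b f /\ rint a b f = m - l.
Proof.
move=> ab cf f0 dF Fl Fm.
suff fi : intble a b f by split=> //; exact: FTC_open fi cf dF Fl Fm.
have mf := contoo_measurable cf.
have cF := derive_contoo dF.
have nF x y : a < x -> x <= y -> y < b -> F x <= F y.
  move=> ax xy yb.
  have h z : z \in `[x, y] -> a < z /\ z < b.
    rewrite in_itv/= => /andP[xz zy].
    by rewrite (lt_le_trans ax xz) (le_lt_trans zy yb).
  have [||c cxy e] := @MVT_segment R F f x y xy.
  - by move=> z zxy; have [] := h z (subset_itv_oo_cc zxy); exact: dF.
  - apply: continuous_in_subspaceT => z; rewrite inE/= => /h[az zb].
    exact: cF.
  rewrite -subr_ge0 e mulr_ge0 ?subr_ge0//.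
  by have [] := h c cxy; exact: f0.
have lF x : a < x -> x < b -> l <= F x.
  move=> ax xb; apply: (closed_cvg (fun z => z <= F x)) Fl; [exact: closed_le|near=> y].
  by apply: nF => //; near: y; exact: nbhs_right_le.
have Fm' x : a < x -> x < b -> F x <= m.
  move=> ax xb; apply: (closed_cvg (fun z => F x <= z)) Fm; [exact: closed_ge|near=> y].
  by apply: nF => //; near: y; exact: nbhs_left_ge.
(* The shift by 3 keeps [e n] below a third of the length, so that every segment is
   nondegenerate. *)
pose e n := (b - a) / (n.+3%:R : R).
have e0 n : 0 < e n by rewrite divr_gt0// subr_gt0.
have e2 n : e n <= (b - a) / 3.
  by rewrite ler_pM2l ?subr_gt0// lef_pV2 ?posrE// ler_nat.
pose D (n : nat) : set (measurableTypeR R) := `[a + e n, b - e n]%classic.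
have nD : nondecreasing_seq D.
  apply/nondecreasing_seqP => n; rewrite /D subsetEset.
  apply: subset_itv; rewrite bnd_simp ?lerD2l ?lerN2;
    by rewrite ler_pM2l ?subr_gt0// lef_pV2 ?posrE// ler_nat.
have UD : \bigcup_n D n = `]a, b[%classic.
  apply/seteqP; split => x /=.
    move=> [n _]; rewrite /D/= !in_itv/= => /andP[h1 h2].
    by have := e0 n => ?; apply/andP; split; lra.
  rewrite in_itv/= => /andP[ax xb].
  pose h := Num.min (x - a) (b - x).
  have h0 : 0 < h by rewrite lt_min !subr_gt0 ax.
  pose n := Num.bound ((b - a) / h).
  have hn : (b - a) / h < n%:R.
    by apply: archi_boundP; rewrite divr_ge0 ?ltW// subr_gt0.
  have en : e n <= h.
    rewrite /e ler_pdivrMr// -ler_pdivrMl// mulrC (le_trans (ltW hn))// ler_nat.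
    by rewrite -addn3 leq_addr.
  exists n => //; rewrite /D/= in_itv/=.
  move: en; rewrite le_min => /andP[? ?]; apply/andP; split; lra_.
apply/intble_oo => //; apply/integrableP; split; first exact/measurable_EFinP.
under eq_integral.
  move=> x; rewrite inE/= in_itv/= => /andP[? ?].
  rewrite /= ger0_norm; last exact: f0.
  over.
rewrite -UD.
have hD n x : D n x -> a < x /\ x < b.
  rewrite /D/= in_itv/= => /andP[h1 h2]; have := e0 n => ?.
  by split; lra_.
have DS n : D n `<=` `]a, b[%classic.
  by move=> x /hD[? ?]; rewrite /= in_itv/=; apply/andP.
have := @ge0_nondecreasing_set_cvg_integral _ (measurableTypeR R) R D (EFin \o f) mu nD.
move=> /(_ _ _ _)/cvg_lim h.
have mfD n : measurable_fun (D n) (EFin \o f).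
  by apply/measurable_EFinP; apply: measurable_funS mf => //; exact: DS.
have fD0 n x : D n x -> (0 <= (EFin \o f) x)%E by move=> /hD[? ?]; rewrite lee_fin f0.
have mD n : measurable (D n) by exact: measurable_itv.
rewrite -h//.
  apply: (@le_lt_trans _ _ (m - l)%:E); last exact: ltry.
  apply: lime_le.
    apply: ereal_nondecreasing_is_cvgn.
    exact: ge0_nondecreasing_set_nondecreasing_integral.
  apply: nearW => n.
  have ebn : a + e n < b - e n by have := e2 n => ?; lra_.
  rewrite (@continuous_FTC2 R f F)//.
  - have [] : a < b - e n /\ b - e n < b by have := e0 n => ?; split; lra_.
    move=> ??; have [] : a < a + e n /\ a + e n < b by have := e0 n => ?; split; lra_.
    by move=> ??; rewrite -EFinB lee_fin lerB// ?lF ?Fm'.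
  - by apply: continuous_in_subspaceT => x; rewrite inE => /hD[]; exact: cf.
  - have hc x : D n x -> {for x, continuous F} by move=> /hD[]; exact: cF.
    split.
    + move=> x xD; have [? ?] := hD n x (subset_itv_oo_cc xD).
      by have [] := dF x.
    + apply: cvg_at_right_filter; apply: hc; rewrite /D/= in_itv/=.
      by rewrite lexx ltW.
    + apply: cvg_at_left_filter; apply: hc; rewrite /D/= in_itv/=.
      by rewrite lexx ltW.
  - move=> x xD; have [? ?] := hD n x (subset_itv_oo_cc xD).
    by rewrite derive1E; have [] := dF x.
Unshelve. all: by end_near. Qed.

Lemma cvg_comp_at_left (T : Type) (H : set_system T) {FH : Filter H} (phi : T -> R) (d : R) :
  (\forall x \near H, phi x < d) -> phi x @[x --> H] --> d ->
  phi x @[x --> H] --> d^'-.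
Proof.
move=> phid phic P; rewrite /at_left /within/= => Pd.
have {}phic := phic _ Pd.
by apply: filterS2 phid phic => x h; apply.
Qed.

(** The map [x |-> rint c (phi x) G] is an antiderivative of the new integrand. It is used first
    with the absolute value of [G], where nonnegativity yields integrability, then with [G]
    itself. *)
Lemma subst_inc a b c d (phi dphi G : R -> R) : a < b -> c < d ->
  (forall x, a < x -> x < b -> is_derive x 1 phi (dphi x)) ->
  contoo a b dphi -> (forall x, a < x -> x < b -> 0 <= dphi x) ->
  (forall x, a < x -> x < b -> c < phi x /\ phi x < d) ->
  phi x @[x --> a^'+] --> c -> phi x @[x --> b^'-] --> d ->
  contoo c d G -> intble c d G ->
  intble a b (fun x => G (phi x) * dphi x) /\
  rint a b (fun x => G (phi x) * dphi x) = rint c d G.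
Proof.
move=> ab cd dp cdp dp0 pcd pc pd cG Gi.
have cp := derive_contoo dp.
have cont H : contoo c d H -> contoo a b (fun x => H (phi x) * dphi x).
  move=> cH x ax xb; have [p1 p2] := pcd x ax xb.
  apply: cvgM; last exact: cdp.
  by apply: (@cvg_comp _ _ _ phi H _ (nbhs (phi x))); [exact: cp|exact: cH].
have lim1 H : intble c d H -> rint c (phi x) H @[x --> a^'+] --> 0.
  move=> Hi; apply: (@cvg_comp _ _ _ phi (fun y => rint c y H) _ (nbhs c)).
    exact: pc.
  exact: (parameterized_integral_cvg_left cd Hi).
have lim2 H : intble c d H -> rint c (phi x) H @[x --> b^'-] --> rint c d H.
  move=> Hi; apply: (@cvg_comp _ _ _ phi (fun y => rint c y H) _ (d^'-)).
    apply: cvg_comp_at_left => //; near=> x.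
    by apply: (pcd x _ _).2.
  exact: rint_cvg_left Hi.
have der H : intble c d H -> contoo c d H -> forall x, a < x -> x < b ->
    is_derive x 1 (fun x => rint c (phi x) H) (H (phi x) * dphi x).
  move=> Hi cH x ax xb; have [p1 p2] := pcd x ax xb.
  have d1 := rint_derive p1 p2 Hi (cH _ p1 p2).
  have d2 := dp x ax xb.
  have := @is_derive1_comp R (fun y => rint c y H) phi x _ _ d1 d2.
  by rewrite /comp.
have cN : contoo c d (fun y => `|G y|).
  by move=> y cy yd; apply: cvg_norm; exact: cG.
have [i1 _] : intble a b (fun x => `|G (phi x)| * dphi x) /\
    rint a b (fun x => `|G (phi x)| * dphi x) = rint c d (fun y => `|G y|) - 0.
  apply: (FTC_open_ge0 ab (cont _ cN) _ (der _ (intble_norm Gi) cN)).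
  - by move=> x ax xb; rewrite mulr_ge0// dp0.
  - by apply: lim1; exact: intble_norm.
  - by apply: lim2; exact: intble_norm.
have i2 : intble a b (fun x => G (phi x) * dphi x).
  apply: le_intble i1; first by apply: contoo_measurable; exact: cont.
  by move=> x ax xb; rewrite normrM (ger0_norm (dp0 _ ax xb)).
split=> //; rewrite -[RHS]subr0.
exact: (FTC_open ab i2 (cont _ cG) (der _ Gi cG) (lim1 _ Gi) (lim2 _ Gi)).
Unshelve. all: by end_near. Qed.

(** A reflection is decreasing, hence outside the scope of [subst_inc]; the antiderivative is now
    [- rint 0 (t - x) G], again taken with the absolute value first. *)
Lemma rint_reflect (t : R) G : 0 < t -> contoo 0 t G -> intble 0 t G ->
  intble 0 t (fun s => G (t - s)) /\ rint 0 t (fun s => G (t - s)) = rint 0 t G.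
Proof.
move=> t0 cG Gi.
have cont H : contoo 0 t H -> contoo 0 t (fun x => H (t - x)).
  move=> cH x ax xb.
  apply: (@cvg_comp _ _ _ (fun x => t - x) H _ (nbhs (t - x))).
    by apply: cvgB; [exact: cvg_cst|exact: cvg_id].
  by apply: cH; lra_.
have lim1 H : intble 0 t H -> - rint 0 (t - x) H @[x --> 0^'+] --> - rint 0 t H.
  move=> Hi; apply: cvgN.
  apply: (@cvg_comp _ _ _ (fun x => t - x) (fun y => rint 0 y H) _ (t^'-)).
    apply: cvg_comp_at_left.
      by near=> x; rewrite ltrBlDr ltrDl; near: x; exact: nbhs_right_gt.
    have h : t - x @[x --> 0^'+] --> t - 0.
      by apply: cvgB; [exact: cvg_cst|apply: cvg_at_right_filter; exact: cvg_id].
    by rewrite subr0 in h.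
  exact: rint_cvg_left Hi.
have lim2 H : intble 0 t H -> - rint 0 (t - x) H @[x --> t^'-] --> - 0.
  move=> Hi; apply: cvgN; apply: cvg_at_left_filter.
  apply: (@cvg_comp _ _ _ (fun x => t - x) (fun y => rint 0 y H) _ (nbhs 0)).
    have h : t - x @[x --> t] --> t - t by apply: cvgB; [exact: cvg_cst|exact: cvg_id].
    by rewrite subrr in h.
  exact: (parameterized_integral_cvg_left t0 Hi).
have der H : intble 0 t H -> contoo 0 t H -> forall x, 0 < x -> x < t ->
    is_derive x 1 (fun x => - rint 0 (t - x) H) (H (t - x)).
  move=> Hi cH x ax xb; have [p1 p2] : 0 < t - x /\ t - x < t by split; lra_.
  have d1 := rint_derive p1 p2 Hi (cH _ p1 p2).
  have d2 : is_derive x 1 (fun x => t - x) (0 - 1).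
    by apply: is_deriveB.
  have := @is_derive1_comp R (fun y => rint 0 y H) (fun x => t - x) x _ _ d1 d2.
  by move=> d3; apply: is_derive_eq; rewrite sub0r mulrN1 opprK.
have cN : contoo 0 t (fun y => `|G y|).
  by move=> y cy yd; apply: cvg_norm; exact: cG.
have [i1 _] : intble 0 t (fun x => `|G (t - x)|) /\
    rint 0 t (fun x => `|G (t - x)|) = - 0 - - rint 0 t (fun y => `|G y|).
  apply: (FTC_open_ge0 t0 (cont _ cN) _ (der _ (intble_norm Gi) cN)) => //.
  - by apply: lim1; exact: intble_norm.
  - by apply: lim2; exact: intble_norm.
have i2 : intble 0 t (fun x => G (t - x)).
  by apply: le_intble i1 => //; apply: contoo_measurable; exact: cont.
split=> //.
rewrite (FTC_open t0 i2 (cont _ cG) (der _ Gi cG) (lim1 _ Gi) (lim2 _ Gi)).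
by rewrite oppr0 sub0r opprK.
Unshelve. all: by end_near. Qed.

Lemma rint_dct a b (f_ : nat -> R -> R) f g :
  (forall n, measurable_fun `]a, b[ (f_ n)) ->
  (forall x, a < x -> x < b -> f_ n x @[n --> \oo] --> f x) ->
  (forall n x, a < x -> x < b -> `|f_ n x| <= g x) -> intble a b g ->
  rint a b (f_ n) @[n --> \oo] --> rint a b f.
Proof.
move=> mf ff fg gi.
have mfl : measurable_fun `]a, b[ f.
  apply: (measurable_fun_cvg mf) => x /=.
  by rewrite in_itv/= => /andP[? ?]; exact: ff.
have gi' : mu.-integrable `]a, b[ (EFin \o g).
  by apply/intble_oo => //; exact: intble_measurable_oo.
under eq_fun do rewrite rint_oo//.
rewrite rint_oo//.
apply: fine_cvg.
have fi : mu.-integrable `]a, b[ (EFin \o f).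
  apply: le_integrable gi' => //; first exact/measurable_EFinP.
  move=> x /=; rewrite in_itv/= => /andP[ax xb]; rewrite lee_fin.
  rewrite (le_trans _ (ler_norm _))//.
  have h : `|f_ n x| @[n --> \oo] --> `|f x| by apply: cvg_norm; exact: ff.
  apply: (closed_cvg (fun z => z <= g x)) h; first exact: closed_le.
  by apply: nearW => n; exact: fg.
rewrite fineK; last exact: integrable_fin_num.
apply: (@dominated_cvg _ _ _ mu _ _ (fun n x => (f_ n x)%:E) _ (EFin \o g)) => //.
- by move=> n; apply/measurable_EFinP; exact: mf.
- move=> x /=; rewrite in_itv/= => /andP[ax xb].
  by apply: cvg_EFin; [exact: nearW|exact: ff].
- by move=> n x /=; rewrite in_itv/= => /andP[ax xb]; rewrite lee_fin fg.
Qed.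

Lemma powR_contoo (b x : R) : 0 < x -> {for x, continuous (fun y : R => y `^ b)}.
Proof.
move=> x0; apply: differentiable_continuous; apply/derivable1_diffP.
by apply: derivable_powR; rewrite in_itv/= x0.
Qed.

Lemma rint_pow (b t : R) : 0 < b -> 0 < t ->
  intble 0 t (fun s => s `^ (b - 1)) /\
  rint 0 t (fun s => s `^ (b - 1)) = t `^ b / b.
Proof.
move=> b0 t0; rewrite mulrC -[X in _ /\ _ = X](subr0 (b^-1 * t `^ b)).
apply: (@FTC_open_ge0 _ _ _ (fun s => b^-1 * s `^ b)) => //.
- by move=> x x0 _; exact: powR_contoo.
- by move=> x *; exact: powR_ge0.
- move=> x x0 _; have d := is_derive1_powR b x0.
  have h := @is_deriveZ R R R _ b^-1 x 1 _ d.
  apply: (is_derive_eq h).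
  by rewrite /GRing.scale/= mulrA mulVf ?mul1r// gt_eqF.
- rewrite -[X in _ --> X](mulr0 b^-1); apply: cvgM; first exact: cvg_cst.
  exact: powR_cvg0.
- apply: cvgM; first exact: cvg_cst.
  by apply: cvg_at_left_filter; exact: powR_contoo.
Qed.

End open_interval_calculus.

Global Opaque rint.

(** * Convolution on (0, t) of functions with a power singularity at the origin *)

Section convolution.
Context {R : realType}.
Notation mu := (@lebesgue_measure R).
Implicit Types (f g h : R -> R) (a b c s t T : R).

Definition conv f g t : R := rint 0 t (fun s => f (t - s) * g s).

Definition contp f := forall t, 0 < t -> {for t, continuous f}.

(** The class in which the Volterra calculus takes place: a singularity of order [b - 1] at the
    origin, no control at infinity, no condition on the values at nonpositive times. [sing 1] is
    continuity on the open half-line with local boundedness up to 0. *)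
Definition sing b f := contp f /\ forall T, 0 < T ->
  exists2 C : R, 0 <= C & forall t, 0 < t -> t <= T -> `|f t| <= C * t `^ (b - 1).

Lemma powR_gtM (x y c : R) : 0 < x -> x <= y -> c <= 0 -> y `^ c <= x `^ c.
Proof.
move=> x0 xy c0; rewrite -[c]opprK !(powRN _ (- c)).
rewrite lef_pV2 ?posrE ?powR_gt0 ?(lt_le_trans x0)//.
by apply: ge0_ler_powR; rewrite ?nnegrE ?oppr_ge0 ?(ltW x0)// (le_trans (ltW x0)).
Qed.

Lemma powRDp (x c d : R) : 0 < x -> x `^ (c + d) = x `^ c * x `^ d.
Proof. by move=> x0; rewrite powRD// (gt_eqF x0) implybT. Qed.

Lemma contp_oo f t : contp f -> contoo 0 t f.
Proof. by move=> cf x x0 _; exact: cf. Qed.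

Lemma contoo_mul a b f g : contoo a b f -> contoo a b g ->
  contoo a b (fun x => f x * g x).
Proof. by move=> cf cg x ax xb; apply: cvgM; [exact: cf|exact: cg]. Qed.

Lemma contoo_reflect t f : contoo 0 t f -> contoo 0 t (fun x => f (t - x)).
Proof.
move=> cf x ax xb.
apply: (@cvg_comp _ _ _ (fun x => t - x) f _ (nbhs (t - x))).
  by apply: cvgB; [exact: cvg_cst|exact: cvg_id].
by apply: cf; lra_.
Qed.

Lemma contoo_conv t f g : contp f -> contp g ->
  contoo 0 t (fun s => f (t - s) * g s).
Proof.
move=> cf cg; apply: contoo_mul; last exact: contp_oo.
by apply: contoo_reflect; exact: contp_oo.
Qed.

Lemma contp_pow c : contp (fun s => s `^ c).
Proof. by move=> t t0; exact: powR_contoo. Qed.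

(** A majorant of the Euler beta function: on each half of the interval the factor that is not
    singular there is replaced by its value at the midpoint, and the other is integrated over the
    whole interval. *)
Definition beta_bound (a b : R) : R :=
  2^-1 `^ (a - 1) / b + 2^-1 `^ (b - 1) / a.

Lemma beta_bound_ge0 a b : 0 < a -> 0 < b -> 0 <= beta_bound a b.
Proof.
by move=> a0 b0; rewrite addr_ge0// divr_ge0 ?powR_ge0// ltW.
Qed.

Lemma beta_major a b t : 0 < a -> a <= 1 -> 0 < b -> b <= 1 -> 0 < t ->
  intble 0 t (fun s => (t - s) `^ (a - 1) * s `^ (b - 1)) /\
  rint 0 t (fun s => (t - s) `^ (a - 1) * s `^ (b - 1))
    <= beta_bound a b * t `^ (a + b - 1).
Proof.
move=> a0 a1 b0 b1 t0.
have [ia ea] := rint_pow a0 t0; have [ib eb] := rint_pow b0 t0.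
have cpow c : contoo 0 t (fun s => s `^ c) by apply: contp_oo; exact: contp_pow.
have [ia' ea'] := rint_reflect t0 (cpow (a - 1)) ia.
pose M s := (t / 2) `^ (a - 1) * s `^ (b - 1) + (t / 2) `^ (b - 1) * (t - s) `^ (a - 1).
have Mi : intble 0 t M by apply: intbleD; apply: intbleZ.
have mul_le s : 0 < s -> s < t -> (t - s) `^ (a - 1) * s `^ (b - 1) <= M s.
  move=> s0 st; have [h|h] := leP s (t / 2).
    rewrite /M -[leLHS]addr0 lerD ?mulr_ge0 ?powR_ge0// ler_wpM2r ?powR_ge0//.
    by apply: powR_gtM; lra_.
  rewrite /M -[leLHS]add0r lerD ?mulr_ge0 ?powR_ge0// mulrC ler_wpM2r ?powR_ge0//.
  by apply: powR_gtM; lra_.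
have ii : intble 0 t (fun s => (t - s) `^ (a - 1) * s `^ (b - 1)).
  apply: le_intble Mi.
    have cc := @contoo_conv t (fun s => s `^ (a - 1)) (fun s => s `^ (b - 1))
      (@contp_pow _) (@contp_pow _).
    exact: contoo_measurable cc.
  by move=> s s0 st; rewrite ger0_norm ?mulr_ge0 ?powR_ge0// mul_le.
split=> //; apply: (le_trans (le_rint ii Mi mul_le)).
rewrite /M rintD; [|exact: intbleZ..].
rewrite !rintZ// ea' ea eb !powRM ?(ltW t0)// /beta_bound.
have -> : t `^ (a + b - 1) = t `^ (a - 1) * t `^ b.
  by rewrite -powRDp//; congr (_ `^ _); ring.
have e : t `^ (a - 1) * t `^ b = t `^ (b - 1) * t `^ a.
  by rewrite -!powRDp//; congr (_ `^ _); ring.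
apply: eq_le_num; rewrite mulrDl .
move: (t `^ (a - 1)) (t `^ (b - 1)) (t `^ a) (t `^ b) (_ `^ (a - 1)) (_ `^ (b - 1)) e.
move=> p q r s x y e; congr (_ + _); first by ring.
by rewrite e; ring.
Qed.

Lemma conv_bound a b f g : 0 < a -> a <= 1 -> 0 < b -> b <= 1 ->
  sing a f -> sing b g -> forall T, 0 < T ->
  exists2 C : R, 0 <= C & forall t, 0 < t -> t <= T ->
    intble 0 t (fun s => f (t - s) * g s) /\
    rint 0 t (fun s => `|f (t - s) * g s|) <= C * t `^ (a + b - 1).
Proof.
move=> a0 a1 b0 b1 [cf bf] [cg bg] T T0.
have [C C0 fC] := bf T T0; have [D D0 gD] := bg T T0.
exists (C * D * beta_bound a b); first by rewrite mulr_ge0 ?beta_bound_ge0 ?mulr_ge0.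
move=> t t0 tT; have [bi be] := beta_major a0 a1 b0 b1 t0.
have le s : 0 < s -> s < t -> `|f (t - s) * g s| <=
    (C * D) * ((t - s) `^ (a - 1) * s `^ (b - 1)).
  move=> s0 st; rewrite normrM.
  rewrite (_ : _ * _ = (C * (t - s) `^ (a - 1)) * (D * s `^ (b - 1))); last by ring.
  by apply: ler_pM => //; [apply: fC; lra_|apply: gD; lra_].
have fi : intble 0 t (fun s => f (t - s) * g s).
  apply: le_intble le (intbleZ _ bi).
  by apply: contoo_measurable; exact: contoo_conv.
split => //.
apply: (le_trans (le_rint (intble_norm fi) (intbleZ _ bi) le)).
by rewrite rintZ// -[leRHS]mulrA; apply: ler_wpM2l => //; exact: mulr_ge0.
Qed.

Lemma conv_intble a b f g t : 0 < a -> a <= 1 -> 0 < b -> b <= 1 ->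
  sing a f -> sing b g -> 0 < t -> intble 0 t (fun s => f (t - s) * g s).
Proof.
move=> a0 a1 b0 b1 sf sg t0.
by have [C _ /(_ t t0 (lexx _))[]] := conv_bound a0 a1 b0 b1 sf sg t0.
Qed.

(** Moves the convolution to the fixed interval (0, 1), so that its dependence on [x] can be studied
    under the integral sign; it also gives the homogeneity of convolutions of powers. *)
Lemma conv_scale a b f g x : 0 < a -> a <= 1 -> 0 < b -> b <= 1 ->
  sing a f -> sing b g -> 0 < x ->
  intble 0 1 (fun u => f (x - x * u) * g (x * u) * x) /\
  rint 0 1 (fun u => f (x - x * u) * g (x * u) * x) = conv f g x.
Proof.
move=> a0 a1 b0 b1 sf sg x0.
apply: (@subst_inc R 0 1 0 x (fun u => x * u) (fun=> x) (fun s => f (x - s) * g s)) => //.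
- move=> u u0 u1; have h := @is_deriveZ R R R id x u 1 _ (is_derive_id _ _).
  by apply: (is_derive_eq h); rewrite /GRing.scale/= mulr1.
- by move=> u u0 u1; exact: cvg_cst.
- by move=> u u0 u1; rewrite ltW.
- by move=> u u0 u1; rewrite mulr_gt0// gtr_pMr.
- rewrite -[X in _ --> X](mulr0 x); apply: cvgM; first exact: cvg_cst.
  by apply: cvg_at_right_filter; exact: cvg_id.
- rewrite -[X in _ --> X](mulr1 x); apply: cvgM; first exact: cvg_cst.
  by apply: cvg_at_left_filter; exact: cvg_id.
- exact: contoo_conv sf.1 sg.1.
- exact: conv_intble sf sg x0.
Qed.

Lemma conv_cont a b f g : 0 < a -> a <= 1 -> 0 < b -> b <= 1 ->
  sing a f -> sing b g -> contp (conv f g).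
Proof.
move=> a0 a1 b0 b1 sf sg t t0.
have [cf bf] := sf; have [cg bg] := sg.
pose H (x u : R) := f (x - x * u) * g (x * u) * x.
have sub (x : R) : 0 < x -> intble 0 1 (H x) /\ rint 0 1 (H x) = conv f g x.
  exact: (conv_scale a0 a1 b0 b1 sf sg).
have T0 : 0 < 2 * t by lra_.
have [C C0 fC] := bf _ T0; have [D D0 gD] := bg _ T0.
(* A majorant for all [x] between t/2 and 2t: the exponents are nonpositive, so the singular factors
   are bounded by their values at x = t/2, and the Jacobian [x] is at most 2t. *)
pose G u := (2 * t * (C * D * (t / 2) `^ (a - 1) * (t / 2) `^ (b - 1))) *
  ((1 - u) `^ (a - 1) * u `^ (b - 1)).
have [bi _] := beta_major a0 a1 b0 b1 (@ltr01 R).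
have Gi : intble 0 1 G by apply: intbleZ.
have HG x u : t / 2 < x -> x < 2 * t -> 0 < u -> u < 1 -> `|H x u| <= G u.
  move=> x1 x2 u0 u1.
  have x0 : 0 < x by lra_.
  have h1 : `|f (x - x * u)| <= C * ((t / 2) `^ (a - 1) * (1 - u) `^ (a - 1)).
    rewrite -powRM; [|lra_..]; apply: le_trans (fC _ _ _) _; [nra_|nra_|].
    rewrite ler_wpM2l//; apply: powR_gtM; [nra_|nra_|lra_].
  have h2 : `|g (x * u)| <= D * ((t / 2) `^ (b - 1) * u `^ (b - 1)).
    rewrite -powRM; [|lra_..]; apply: le_trans (gD _ _ _) _; [nra_|nra_|].
    rewrite ler_wpM2l//; apply: powR_gtM; [nra_|nra_|lra_].
  rewrite /H !normrM (gtr0_norm x0).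
  apply: (@le_trans _ _ (C * ((t / 2) `^ (a - 1) * (1 - u) `^ (a - 1)) *
     (D * ((t / 2) `^ (b - 1) * u `^ (b - 1))) * (2 * t))).
    apply: ler_pM; [by rewrite mulr_ge0|exact: ltW| |exact: ltW].
    exact: ler_pM.
  by rewrite /G; apply: eq_le_num; ring.
have cH u : 0 < u -> u < 1 -> forall x, 0 < x -> {for x, continuous (H ^~ u)}.
  move=> u0 u1 x x0.
  have c1 : x * u @[x --> x] --> x * u by apply: cvgM; [exact: cvg_id|exact: cvg_cst].
  have c2 : x - x * u @[x --> x] --> x - x * u by apply: cvgB; [exact: cvg_id|].
  apply: cvgM; last exact: cvg_id.
  apply: cvgM.
    by apply: (@cvg_comp _ _ _ (fun x => x - x * u) f _ (nbhs (x - x * u))) => //;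
      apply: cf; nra_.
  by apply: (@cvg_comp _ _ _ (fun x => x * u) g _ (nbhs (x * u))) => //;
    apply: cg; nra_.
have Hi x : 0 < x -> mu.-integrable `]0, 1[ (EFin \o H x).
  move=> x0; have [Hi _] := sub x x0.
  by apply/intble_oo => //; exact: intble_measurable_oo.
have := @continuity_under_integral R _ _ mu H `]0, 1[%classic (measurable_itv _)
  (t / 2) (2 * t) _ _ G _ _.
have Gi' : mu.-integrable `]0, 1[ (EFin \o G).
  by apply/intble_oo => //; exact: intble_measurable_oo.
move=> /(_ _ _ Gi' _ t) cont.
have eqc : {near t, (fun x => \int[mu]_(u in `]0, 1[) H x u) =1 conv f g}.
  near=> x; have x0 : 0 < x by near: x; exact: lt_nbhsr.
  have [Hix <-] := sub x x0.
  by rewrite rint_oo//; exact: intble_measurable_oo.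
apply: (near_eq_continuous_at eqc).
apply: cont.
- move=> x /=; rewrite in_itv/= => /andP[x1 x2]; apply: Hi; lra_.
- apply: aeW => u /=; rewrite in_itv/= => /andP[u0 u1] x.
  rewrite inE/= in_itv/= => /andP[x1 x2]; apply: cH => //; lra_.
- move=> x /=; rewrite in_itv/= => /andP[x1 x2]; apply: aeW => u /=.
  by rewrite in_itv/= => /andP[u0 u1]; exact: HG.
- by rewrite inE/= in_itv/=; apply/andP; split; lra_.
Unshelve. all: by end_near. Qed.

Lemma conv_norm_le a b f g t : 0 < a -> a <= 1 -> 0 < b -> b <= 1 ->
  sing a f -> sing b g -> 0 < t ->
  `|conv f g t| <= rint 0 t (fun s => `|f (t - s) * g s|).
Proof.
by move=> a0 a1 b0 b1 sf sg t0; apply: le_norm_rint; exact: conv_intble sf sg t0.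
Qed.

Lemma conv_le_pow a b f g : 0 < a -> a <= 1 -> 0 < b -> b <= 1 ->
  sing a f -> sing b g -> forall T, 0 < T -> exists2 C : R, 0 <= C &
    forall t, 0 < t -> t <= T -> `|conv f g t| <= C * t `^ (a + b - 1).
Proof.
move=> a0 a1 b0 b1 sf sg T T0.
have [C C0 hC] := conv_bound a0 a1 b0 b1 sf sg T0; exists C => // t t0 tT.
have [_] := hC t t0 tT; apply: le_trans.
exact: (conv_norm_le a0 a1 b0 b1).
Qed.

Lemma sing_conv a b f g : 0 < a -> a <= 1 -> 0 < b -> b <= 1 ->
  sing a f -> sing b g -> sing b (conv f g).
Proof.
move=> a0 a1 b0 b1 sf sg; split; first exact: (conv_cont a0 a1 b0 b1).
move=> T T0; have [C C0 hC] := conv_le_pow a0 a1 b0 b1 sf sg T0.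
exists (C * T `^ a); first by rewrite mulr_ge0 ?powR_ge0.
move=> t t0 tT; apply: (le_trans (hC t t0 tT)).
have -> : t `^ (a + b - 1) = t `^ a * t `^ (b - 1) by rewrite -powRDp// addrA.
rewrite mulrA ler_wpM2r ?powR_ge0// ler_wpM2l//.
by apply: ge0_ler_powR; rewrite ?nnegrE ?(ltW a0) ?(ltW t0) ?(ltW T0).
Qed.

Lemma sing_mono a b f : a <= b -> sing b f -> sing a f.
Proof.
move=> ab [cf bf]; split=> // T T0; have [C C0 fC] := bf T T0.
exists (C * T `^ (b - a)); first by rewrite mulr_ge0 ?powR_ge0.
move=> t t0 tT; apply: (le_trans (fC _ t0 tT)).
rewrite (_ : b - 1 = (b - a) + (a - 1)); last by ring.
rewrite powRDp// mulrA ler_wpM2r ?powR_ge0// ler_wpM2l//.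
by apply: ge0_ler_powR; rewrite ?nnegrE ?subr_ge0// ltW.
Qed.

Lemma sing_pow b : sing b (fun s => s `^ (b - 1)).
Proof.
split; first exact: contp_pow.
by move=> T T0; exists 1 => // t t0 tT; rewrite mul1r ger0_norm ?powR_ge0.
Qed.

Lemma sing_cst k : sing 1 (fun=> k).
Proof.
split; first by move=> t t0; exact: cvg_cst.
by move=> T T0; exists `|k| => // t t0 tT; rewrite subrr powRr0 mulr1.
Qed.

Lemma singD b f g : sing b f -> sing b g -> sing b (fun t => f t + g t).
Proof.
move=> [cf bf] [cg bg]; split.
  by move=> t t0; apply: cvgD; [exact: cf|exact: cg].
move=> T T0; have [C C0 fC] := bf T T0; have [D D0 gD] := bg T T0.
exists (C + D); first exact: addr_ge0.
move=> t t0 tT; rewrite mulrDl (le_trans (ler_normD _ _))// lerD//; [exact: fC|exact: gD].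
Qed.

Lemma singZ b k f : sing b f -> sing b (fun t => k * f t).
Proof.
move=> [cf bf]; split.
  by move=> t t0; apply: cvgM; [exact: cvg_cst|exact: cf].
move=> T T0; have [C C0 fC] := bf T T0; exists (`|k| * C); first exact: mulr_ge0.
by move=> t t0 tT; rewrite normrM -mulrA ler_wpM2l// fC.
Qed.

Lemma sing_sum b (I : Type) (r : seq I) (f_ : I -> R -> R) :
  (forall i, sing b (f_ i)) -> 0 <= b -> b <= 1 ->
  sing b (fun t => \sum_(i <- r) f_ i t).
Proof.
move=> sf b0 b1; elim: r => [|i r ih].
  under eq_fun do rewrite big_nil.
  by apply: (@sing_mono b 1) => //; exact: sing_cst.
by under eq_fun do rewrite big_cons; exact: singD.
Qed.

Lemma eq_sing b f g : (forall t, 0 < t -> f t = g t) -> sing b f -> sing b g.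
Proof.
move=> fg [cf bf]; split.
  move=> t t0.
  have e : {near t, f =1 g}.
    by near=> x; apply: fg; near: x; exact: lt_nbhsr.
  exact: (near_eq_continuous_at e (cf t t0)).
move=> T T0; have [C C0 fC] := bf T T0; exists C => // t t0 tT.
by rewrite -fg// fC.
Unshelve. all: by end_near. Qed.

Lemma sing_norm b f : sing b f -> sing b (fun t => `|f t|).
Proof.
move=> [cf bf]; split; first by move=> t t0; apply: cvg_norm; exact: cf.
by move=> T /bf[C C0 fC]; exists C => // t t0 tT; rewrite normr_id fC.
Qed.

Lemma sing_intble b f t : 0 < b -> sing b f -> 0 < t -> intble 0 t f.
Proof.
move=> b0 [cf bf] t0; have [C C0 fC] := bf t t0.
have [pi _] := rint_pow b0 t0.
apply: le_intble (intbleZ C pi); first by apply: contoo_measurable; exact: contp_oo.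
by move=> x x0 xt; apply: fC => //; exact: ltW.
Qed.

Lemma eq_conv f f' g g' t : contp f -> contp g ->
  (forall s, 0 < s -> f s = f' s) -> (forall s, 0 < s -> g s = g' s) ->
  conv f g t = conv f' g' t.
Proof.
move=> cf cg ff gg; apply: eq_rint.
  by apply: contoo_measurable; exact: contoo_conv.
by move=> s s0 st; rewrite ff ?gg// subr_gt0.
Qed.

Lemma convC f g t : contp f -> contp g -> 0 < t ->
  intble 0 t (fun s => f (t - s) * g s) -> conv f g t = conv g f t.
Proof.
move=> cf cg t0 fi; have := rint_reflect t0 (contoo_conv cf cg) fi.
rewrite /conv; move=> [fi' <-]; apply: eq_rint.
  exact: intble_measurable_oo fi'.
by move=> s s0 st; rewrite subKr mulrC.
Qed.

Lemma convDr a b f g h t : 0 < a -> a <= 1 -> 0 < b -> b <= 1 ->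
  sing a f -> sing b g -> sing b h -> 0 < t ->
  conv f (fun s => g s + h s) t = conv f g t + conv f h t.
Proof.
move=> a0 a1 b0 b1 sf sg sh t0.
rewrite /conv -rintD; [|exact: conv_intble sf sg t0|exact: conv_intble sf sh t0].
by congr rint; apply/funext => s; rewrite mulrDr.
Qed.

Lemma convZr a b k f g t : 0 < a -> a <= 1 -> 0 < b -> b <= 1 ->
  sing a f -> sing b g -> 0 < t ->
  conv f (fun s => k * g s) t = k * conv f g t.
Proof.
move=> a0 a1 b0 b1 sf sg t0.
rewrite /conv -rintZ; last exact: conv_intble sf sg t0.
by congr rint; apply/funext => s; ring.
Qed.

Lemma convZl a b c f g t : 0 < a -> a <= 1 -> 0 < b -> b <= 1 ->
  sing a f -> sing b g -> 0 < t -> conv (fun s => c * f s) g t = c * conv f g t.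
Proof.
move=> a0 a1 b0 b1 sf sg t0; rewrite /conv -rintZ; last exact: conv_intble a0 a1 b0 b1 sf sg t0.
by congr rint; apply/funext => s; rewrite mulrA.
Qed.

Lemma conv_sumr a b (I : Type) (r : seq I) f (g_ : I -> R -> R) t :
  0 < a -> a <= 1 -> 0 < b -> b <= 1 ->
  sing a f -> (forall i, sing b (g_ i)) -> 0 < t ->
  conv f (fun s => \sum_(i <- r) g_ i s) t = \sum_(i <- r) conv f (g_ i) t.
Proof.
move=> a0 a1 b0 b1 sf sg t0.
rewrite /conv -(rint_sum r (fun i => conv_intble a0 a1 b0 b1 sf (sg i) t0)).2.
by congr rint; apply/funext => s; rewrite mulr_sumr.
Qed.

Lemma conv_mulid a b f g t : 0 < a -> a <= 1 -> 0 < b -> b <= 1 ->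
  sing a f -> sing b g -> sing a (fun s => s * f s) -> sing b (fun s => s * g s) ->
  0 < t ->
  t * conv f g t = conv (fun s => s * f s) g t + conv f (fun s => s * g s) t.
Proof.
move=> a0 a1 b0 b1 sf sg sf' sg' t0.
rewrite /conv -rintD; [|exact: conv_intble sf' sg t0|exact: conv_intble sf sg' t0].
rewrite -rintZ; last exact: conv_intble sf sg t0.
by congr rint; apply/funext => s; ring.
Qed.

Lemma conv1_derive b f t : 0 < b -> sing b f -> 0 < t ->
  is_derive t 1 (conv (fun=> 1) f) (f t).
Proof.
move=> b0 sf t0; have fi : intble 0 (t + 1) f by apply: sing_intble sf _; lra_.
have -> : conv (fun=> 1) f = fun z => rint 0 z f.
  by apply/funext => z; rewrite /conv; congr rint; apply/funext => s; rewrite mul1r.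
by apply: (rint_derive t0 _ fi (sf.1 t t0)); lra_.
Qed.

Lemma conv1_inj b f g : 0 < b -> sing b f -> sing b g ->
  (forall t, 0 < t -> conv (fun=> 1) f t = conv (fun=> 1) g t) ->
  forall t, 0 < t -> f t = g t.
Proof.
move=> b0 sf sg e t t0.
have [_ <-] := conv1_derive b0 sf t0; have [_ <-] := conv1_derive b0 sg t0.
apply: near_eq_derive.
by near=> x; apply: e; near: x; exact: lt_nbhsr.
Unshelve. all: by end_near. Qed.

(** Extension by zero makes the convolution an integral over the whole line, so that Fubini is
    applied on a full product instead of a triangle. *)
Let ext f := f \_ (`]0, +oo[%classic : set R).

Let ext_pos f x : 0 < x -> ext f x = f x.
Proof. by move=> x0; rewrite /ext patchE mem_set//= in_itv/= x0. Qed.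

Let ext_neg f x : x <= 0 -> ext f x = 0.
Proof. by move=> x0; rewrite /ext patchE memNset//= in_itv/= andbT ltNge x0. Qed.

Let ext_measurable f : contp f -> measurable_fun setT (ext f).
Proof.
move=> cf; apply/(measurable_restrictT f) => //.
apply: subspace_continuous_measurable_fun => //.
apply: continuous_in_subspaceT => x; rewrite inE/= in_itv/= andbT; exact: cf.
Qed.

Let ext_norm f x : ext (fun s => `|f s|) x = `|ext f x|.
Proof.
have [x0|x0] := leP x 0; first by rewrite !ext_neg// normr0.
by rewrite !ext_pos.
Qed.

Let ext_conv a b f g t u : 0 < a -> a <= 1 -> 0 < b -> b <= 1 ->
  sing a f -> sing b g ->
  mu.-integrable setT (fun s => (ext f (t - s) * ext g (s - u))%:E) /\
  (\int[mu]_s (ext f (t - s) * ext g (s - u))%:E = (ext (conv f g) (t - u))%:E)%E.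
Proof.
move=> a0 a1 b0 b1 sf sg.
have [ut|tu] := ltP u t; last first.
  have e s : (ext f (t - s) * ext g (s - u))%:E = 0%E.
    have [h|h] := leP s u; first by rewrite (@ext_neg g) ?mulr0// subr_le0.
    by rewrite (@ext_neg f) ?mul0r// subr_le0 (le_trans tu)// ltW.
  split; first by under eq_fun do rewrite e; exact: integrable0.
  by rewrite ext_neg ?subr_le0//; apply: integral0_eq => s _.
have cf := sf.1; have cg := sg.1.
have tu0 : 0 < t - u by rewrite subr_gt0.
have fi := conv_intble a0 a1 b0 b1 sf sg tu0.
rewrite ext_pos//.
have [fi' fe'] : intble u t (fun s => f ((t - u) - (s - u)) * g (s - u) * 1) /\
   rint u t (fun s => f ((t - u) - (s - u)) * g (s - u) * 1) = conv f g (t - u).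
  apply: (@subst_inc R u t 0 (t - u) (fun s => s - u) (fun=> 1)
     (fun s => f (t - u - s) * g s)) => //.
  - move=> x _ _.
    have h := @is_deriveB R R R id (cst u) x 1 _ _ (is_derive_id _ _) (is_derive_cst _ _ _).
    by apply: (is_derive_eq h); rewrite subr0.
  - by move=> x _ _; exact: cvg_cst.
  - by move=> x ux xt; split; lra_.
  - have h : x - u @[x --> u^'+] --> u - u.
      by apply: cvgB; [apply: cvg_at_right_filter; exact: cvg_id|exact: cvg_cst].
    by rewrite subrr in h.
  - by apply: cvgB; [apply: cvg_at_left_filter; exact: cvg_id|exact: cvg_cst].
  - exact: contoo_conv.
have mm := intble_measurable_oo fi'.
have ii : mu.-integrable `]u, t[ (EFin \o (fun s => f ((t - u) - (s - u)) * g (s - u) * 1)).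
  exact/intble_oo.
have ee : (fun s => (ext f (t - s) * ext g (s - u))%:E) =
   (EFin \o (fun s => f ((t - u) - (s - u)) * g (s - u) * 1)) \_ `]u, t[.
  apply/funext => s; rewrite patchE; case: ifPn; rewrite ?inE/= ?notin_setE/= in_itv/=.
    move=> /andP[us st]; rewrite !ext_pos ?subr_gt0// mulr1.
    by rewrite (_ : t - u - (s - u) = t - s)//; ring.
  move=> /negP; rewrite negb_and -!leNgt => /orP[|] h.
    by rewrite (@ext_neg g) ?mulr0// subr_le0.
  by rewrite (@ext_neg f) ?mul0r// subr_le0.
rewrite ee; split; first by rewrite -integrable_mkcond.
rewrite -integral_mkcond -fe' rint_oo// /Rintegral fineK//.
exact: integrable_fin_num.
Qed.

(** Fubini for the triple product. Its integrability follows from the same iterated integral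
    computed with absolute values, which is again a value of a convolution, hence finite. *)
Lemma conv_assoc a b c f g h t :
  0 < a -> a <= 1 -> 0 < b -> b <= 1 -> 0 < c -> c <= 1 ->
  sing a f -> sing b g -> sing c h -> 0 < t ->
  conv (conv f g) h t = conv f (conv g h) t.
Proof.
move=> a0 a1 b0 b1 c0 c1 sf sg sh t0.
pose P (f g h : R -> R) (z : R * R) : \bar R :=
  (ext f (t - z.2) * ext g (z.2 - z.1) * ext h (z.1 - 0))%:E.
have inner f' g' h' u : sing a f' -> sing b g' -> sing c h' ->
    (\int[mu]_s P f' g' h' (u, s) = (ext (conv f' g') (t - u) * ext h' (u - 0))%:E)%E.
  move=> sf' sg' sh'.
  have [i e] := ext_conv t u a0 a1 b0 b1 sf' sg'.
  under eq_integral do rewrite /P/= EFinM muleC.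
  by rewrite integralZl// e -EFinM mulrC.
have inner' s : (\int[mu]_u P f g h (u, s) =
    (ext f (t - s) * ext (conv g h) (s - 0))%:E)%E.
  have [i e] := ext_conv s 0 b0 b1 c0 c1 sg sh.
  under eq_integral do rewrite /P/= -mulrA EFinM.
  by rewrite integralZl// e -EFinM.
have mP : measurable_fun setT (P f g h).
  apply/measurable_EFinP; apply: measurable_funM; first apply: measurable_funM.
  - apply: (measurableT_comp (ext_measurable sf.1)).
    by apply: measurable_funB => //; exact: measurable_snd.
  - apply: (measurableT_comp (ext_measurable sg.1)).
    by apply: measurable_funB; [exact: measurable_snd|exact: measurable_fst].
  - apply: (measurableT_comp (ext_measurable sh.1)).
    by apply: measurable_funB => //; exact: measurable_fst.
have iP : (mu \x mu)%E.-integrable setT (P f g h).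
  apply/integrable12ltyP => //.
  have e : (\int[mu]_u \int[mu]_s `|P f g h (u, s)| =
    \int[mu]_u (ext (conv (fun x => `|f x|%R) (fun x => `|g x|%R)) (t - u) *
             ext (fun x => `|h x|%R) (u - 0))%:E)%E.
    apply: eq_integral => u _.
    rewrite -inner; [|exact: sing_norm..].
    by apply: eq_integral => s _; rewrite /P/= !ext_norm -!normrM.
  have sfg := sing_conv a0 a1 b0 b1 (sing_norm sf) (sing_norm sg).
  have [_ e2] := ext_conv t 0 b0 b1 c0 c1 sfg (sing_norm sh).
  by rewrite e e2 ltry.
have := Fubini iP.
under eq_integral do rewrite inner//.
under [in X in _ = X -> _]eq_integral do rewrite inner'//.
have [_ ->] := ext_conv t 0 b0 b1 c0 c1 (sing_conv a0 a1 b0 b1 sf sg) sh.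
have [_ ->] := ext_conv t 0 a0 a1 c0 c1 sf (sing_conv b0 b1 c0 c1 sg sh).
by rewrite !subr0 !ext_pos// => -[].
Qed.

Lemma sing_mulid b f : sing b f -> sing b (fun s => s * f s).
Proof.
move=> [cf bf]; split.
  by move=> t t0; apply: cvgM; [exact: cvg_id|exact: cf].
move=> T T0; have [C C0 fC] := bf T T0.
exists (T * C); first by rewrite mulr_ge0// ltW.
move=> t t0 tT; rewrite normrM (gtr0_norm t0) -mulrA.
apply: ler_pM => //; [exact: ltW|exact: fC].
Qed.

Lemma sing1_bound f : sing 1 f -> forall T, 0 < T ->
  exists2 C : R, 0 <= C & forall t, 0 < t -> t <= T -> `|f t| <= C.
Proof.
move=> [_ bf] T /bf[C C0 fC]; exists C => // t t0 tT.
by rewrite (le_trans (fC _ t0 tT))// subrr powRr0 mulr1.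
Qed.

Lemma sing1M f g : sing 1 f -> sing 1 g -> sing 1 (fun t => f t * g t).
Proof.
move=> sf sg; split.
  by move=> t t0; apply: cvgM; [exact: sf.1|exact: sg.1].
move=> T T0; have [C C0 fC] := sing1_bound sf T0.
have [D D0 gD] := sing1_bound sg T0.
exists (C * D); first exact: mulr_ge0.
move=> t t0 tT; rewrite subrr powRr0 mulr1 normrM.
by apply: ler_pM => //; [exact: fC|exact: gD].
Qed.

End convolution.

(** * The Riemann-Liouville kernel: beta integrals, Abel inversion, exponential weights *)

Section fractional_kernel.
Context {R : realType}.
Implicit Types (f g h u v : R -> R) (a b c s t T : R).

(** The normalisation 1 / Gamma(a) is left out, so beta constants appear where normalised kernels
    would form a semigroup. *)
Definition ker a (s : R) : R := s `^ (a - 1).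

Lemma sing_ker a : sing a (ker a).
Proof. exact: sing_pow. Qed.

(** The Euler beta function B(a, b). *)
Definition betaf a b : R := conv (ker a) (ker b) 1.

Lemma conv_ker a b t : 0 < a -> a <= 1 -> 0 < b -> b <= 1 -> 0 < t ->
  conv (ker a) (ker b) t = betaf a b * t `^ (a + b - 1).
Proof.
move=> a0 a1 b0 b1 t0.
have [i1 e1] := conv_scale a0 a1 b0 b1 (sing_ker a) (sing_ker b) t0.
have i2 := conv_intble a0 a1 b0 b1 (sing_ker a) (sing_ker b) (@ltr01 R).
rewrite -e1 mulrC /betaf /conv -rintZ//.
apply: eq_rint; first exact: intble_measurable_oo.
move=> x x0 x1; rewrite /ker (_ : t - t * x = t * (1 - x)); last by ring.
rewrite !powRM ?subr_ge0 ?ltW//.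
have -> : t `^ (a + b - 1) = t `^ (a - 1) * t `^ (b - 1) * t.
  rewrite -[X in _ * X](powRr1 (ltW t0)) -!powRDp//; congr (_ `^ _); ring.
by move: (t `^ (a - 1)) (t `^ (b - 1)) (_ `^ (a - 1)) (_ `^ (b - 1)) => p q r z; ring.
Qed.

Lemma betaf_ge1 a b : 0 < a -> a <= 1 -> 0 < b -> b <= 1 -> 1 <= betaf a b.
Proof.
move=> a0 a1 b0 b1.
have i2 := conv_intble a0 a1 b0 b1 (sing_ker a) (sing_ker b) (@ltr01 R).
have := @le_rint R 0 1 (fun=> 1) _ (intble_cst _ _ _) i2.
rewrite rint_cst// subr0 mulr1; apply => s s0 s1.
have h c x : 0 < x -> x <= 1 -> c <= 1 -> 1 <= x `^ (c - 1).
  move=> x0 x1 c1; rewrite -[leLHS](powRr0 x).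
  by apply: ger_powR; rewrite ?x0// subr_le0.
rewrite -[leLHS]mulr1 /ker ler_pM// ?h//; lra_.
Qed.

Lemma conv_cstl b k u t : 0 < b -> b <= 1 -> sing b u -> 0 < t ->
  conv (fun=> k) u t = k * conv (fun=> 1) u t.
Proof.
move=> b0 b1 su t0.
rewrite /conv -rintZ; last exact: (conv_intble _ _ b0 b1 (sing_cst 1) su t0).
by congr rint; apply/funext => s; rewrite mul1r.
Qed.

(** The orders [1 - a] and [a] are complementary: the convolution of the two kernels is constant,
    and associativity leaves an ordinary primitive. This is Abel's inversion. *)
Lemma conv_compl a b u t : 0 < a -> a < 1 -> 0 < b -> b <= 1 -> sing b u ->
  0 < t -> conv (ker (1 - a)) (conv (ker a) u) t =
    betaf (1 - a) a * conv (fun=> 1) u t.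
Proof.
move=> a0 a1 b0 b1 su t0.
have [c0 c1] : 0 < 1 - a /\ 1 - a <= 1 by split; lra_.
rewrite -(conv_assoc c0 c1 a0 (ltW a1) b0 b1 (sing_ker _) (sing_ker _) su t0).
rewrite -(conv_cstl (betaf (1 - a) a) b0 b1 su t0).
apply: eq_conv; [|exact: su.1| |by []].
  exact: (sing_conv c0 c1 a0 (ltW a1) (sing_ker _) (sing_ker _)).1.
move=> s s0; rewrite conv_ker ?(ltW a1)//.
by rewrite subrK subrr powRr0 mulr1.
Qed.

(** Uniqueness for Abel's equation: convolution with the complementary kernel reduces it to equality
    of primitives, which are then differentiated. *)
Lemma conv_ker_inj a b u v : 0 < a -> a < 1 -> 0 < b -> b <= 1 ->
  sing b u -> sing b v ->
  (forall t, 0 < t -> conv (ker a) u t = conv (ker a) v t) ->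
  forall t, 0 < t -> u t = v t.
Proof.
move=> a0 a1 b0 b1 su sv e.
have [c0 c1] : 0 < 1 - a /\ 1 - a <= 1 by split; lra_.
apply: (conv1_inj b0 su sv) => t t0.
have B0 : betaf (1 - a) a != 0.
  by rewrite gt_eqF// (lt_le_trans ltr01)// betaf_ge1// ltW.
apply: (mulfI B0).
rewrite -(conv_compl a0 a1 b0 b1 su t0) -(conv_compl a0 a1 b0 b1 sv t0).
apply: eq_conv => //; first exact: (sing_ker _).1.
exact: (sing_conv a0 (ltW a1) b0 b1 (sing_ker _) su).1.
Qed.

Lemma expR_powR_le (x c : R) : 0 < x -> 0 <= c -> c <= 1 ->
  expR (- x) <= x `^ (- c).
Proof.
move=> x0 c0 c1; rewrite expRN powRN lef_pV2 ?posrE ?expR_gt0 ?powR_gt0//.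
apply: (@le_trans _ _ (1 + x)); last exact: expR_ge1Dx.
have [h|h] := leP x 1.
  apply: (@le_trans _ _ 1); last by rewrite lerDl ltW.
  rewrite -[leRHS](powRr0 x); apply: ger_powR => //; first by rewrite x0.
apply: (@le_trans _ _ x); last by rewrite lerDr.
by rewrite -[leRHS](powRr1 (ltW x0)); apply: ler_powR => //; exact: ltW.
Qed.

(** A weight of Bielecki type. With an exponent linear in [t] the estimate [conv_wgt] would keep a
    growing factor t^(a/2); since t^2 - s^2 >= t (t - s), the square supplies the compensating
    t^(-a/2) and the contraction is uniform on the half-line. *)
Definition wgt b m t : R := t `^ (b - 1) * expR (m * t ^+ 2).

Lemma wgt_ge0 b m t : 0 <= wgt b m t.
Proof. by rewrite mulr_ge0 ?powR_ge0 ?expR_ge0. Qed.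

Lemma sing_wgt b m : 0 <= m -> sing b (wgt b m).
Proof.
move=> m0; split.
  move=> t t0; apply: cvgM; first exact: powR_contoo.
  apply: (@cvg_comp _ _ _ (fun t => m * t ^+ 2) (@expR R) _ (nbhs (m * t ^+ 2))).
    apply: cvgM; first exact: cvg_cst.
    by apply: cvgM; exact: cvg_id.
  exact: continuous_expR.
move=> T T0; exists (expR (m * T ^+ 2)); first exact: expR_ge0.
move=> t t0 tT; rewrite ger0_norm ?wgt_ge0// /wgt mulrC ler_wpM2r ?powR_ge0//.
by rewrite ler_expR ler_wpM2l// lerXn2r// ?nnegrE ltW// (lt_le_trans t0).
Qed.

(** The ratio of the exponentials at [s] and [t] is at most (m t (t - s))^(-a/2). Half of the order
    of the kernel pays for it, the other half keeps the integral finite, and the factor m^(-a/2) is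
    small for large [m]. *)
Lemma conv_wgt a b m t : 0 < a -> a <= 1 -> 0 < b -> b <= 1 -> 0 < m -> 0 < t ->
  conv (ker a) (wgt b m) t <= m `^ (- (a / 2)) * beta_bound (a / 2) b * wgt b m t.
Proof.
move=> a0 a1 b0 b1 m0 t0.
have [c0 c1] : 0 < a / 2 /\ a / 2 <= 1 by split; lra_.
have i1 := conv_intble a0 a1 b0 b1 (sing_ker a) (sing_wgt b (ltW m0)) t0.
have [i2 e2] := beta_major c0 c1 b0 b1 t0.
pose K := expR (m * t ^+ 2) * (m `^ (- (a / 2)) * t `^ (- (a / 2))).
have le s : 0 < s -> s < t -> ker a (t - s) * wgt b m s <=
    K * ((t - s) `^ (a / 2 - 1) * s `^ (b - 1)).
  move=> s0 st; have ts : 0 < t - s by rewrite subr_gt0.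
  have h : expR (m * s ^+ 2) <=
      expR (m * t ^+ 2) * (m `^ (- (a / 2)) * t `^ (- (a / 2)) * (t - s) `^ (- (a / 2))).
    rewrite -!powRM ?mulr_ge0 ?(ltW m0) ?(ltW t0) ?(ltW ts)//.
    apply: (@le_trans _ _ (expR (m * t ^+ 2) * expR (- (m * t * (t - s))))).
      rewrite -expRD ler_expR.
      rewrite (_ : _ + _ = m * (t * s)); last by ring.
      by rewrite ler_wpM2l ?(ltW m0)// expr2 ler_wpM2r ?ltW.
    by rewrite ler_wpM2l ?expR_ge0// expR_powR_le ?mulr_gt0// ltW.
  rewrite /ker /wgt.
  apply: (@le_trans _ _ ((t - s) `^ (a - 1) * (s `^ (b - 1) *
     (expR (m * t ^+ 2) * (m `^ (- (a / 2)) * t `^ (- (a / 2)) * (t - s) `^ (- (a / 2))))))).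
    by rewrite !ler_wpM2l ?powR_ge0.
  have -> : (t - s) `^ (a / 2 - 1) = (t - s) `^ (a - 1) * (t - s) `^ (- (a / 2)).
    by rewrite -powRDp//; congr (_ `^ _); field.
  by apply: eq_le_num; rewrite /K; ring.
rewrite /conv; apply: (le_trans (le_rint i1 (intbleZ K i2) le)).
rewrite rintZ//.
apply: (@le_trans _ _ (K * (beta_bound (a / 2) b * t `^ (a / 2 + b - 1)))).
  by rewrite ler_wpM2l// /K !mulr_ge0 ?expR_ge0 ?powR_ge0.
rewrite /K /wgt; apply: eq_le_num.
have -> : t `^ (a / 2 + b - 1) = t `^ (a / 2) * t `^ (b - 1).
  by rewrite -powRDp// addrA.
have tt : t `^ (- (a / 2)) * t `^ (a / 2) = 1.
  by rewrite -powRDp// addNr powRr0.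
transitivity (m `^ (- (a / 2)) * beta_bound (a / 2) b *
  (t `^ (b - 1) * expR (m * t ^+ 2)) * (t `^ (- (a / 2)) * t `^ (a / 2))); first by ring.
by rewrite tt mulr1.
Qed.

Lemma geometric_cvg (x : nat -> R) (c : R) :
  (forall n, `|x n.+1 - x n| <= c / 2 ^+ n.+1) ->
  exists l : R, forall n, `|l - x n| <= c / 2 ^+ n.
Proof.
move=> hx.
have c0 : 0 <= c.
  by have := le_trans (normr_ge0 _) (hx 0%N); rewrite pmulr_lge0 ?invr_gt0.
have h n m : `|x (n + m)%N - x n| <= c / 2 ^+ n - c / 2 ^+ (n + m).
  elim: m => [|m ih]; first by rewrite addn0 !subrr normr0.
  rewrite addnS (_ : x _ - x n = (x (n + m).+1 - x (n + m)%N) + (x (n + m)%N - x n)); last by ring.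
  rewrite (le_trans (ler_normD _ _))// (le_trans (lerD (hx _) ih))//.
  rewrite exprS invfM; apply: eq_le_num.
  by move: (2 ^+ (n + m))^-1 (2 ^+ n)^-1 => z p; field.
have hn n m : `|x (n + m)%N - x n| <= c / 2 ^+ n.
  by rewrite (le_trans (h n m))// gerBl divr_ge0// exprn_ge0.
have c2 : c / 2 ^+ n @[n --> \oo] --> (0 : R).
  rewrite -(mulr0 c); apply: cvgM; first exact: cvg_cst.
  under eq_fun do rewrite -exprVn.
  by apply: cvg_expr; rewrite ger0_norm ?invr_ge0// invf_lt1// ltr1n.
have cx : cvgn x.
  apply/cauchy_cvgP/cauchyP => e e0.
  have [N _ hN] : \forall n \near \oo, c / 2 ^+ n < e.
    by apply: (cvgr_lt _ c2).
  exists (x N); exists N => // n /= Nn.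
  rewrite -ball_normE/= distrC -(subnKC Nn) (le_lt_trans (hn _ _))//.
  by apply: hN => /=.
exists (limn x) => n.
have h2 : `|x m - x n| @[m --> \oo] --> `|limn x - x n|.
  by apply: cvg_norm; apply: cvgB => //; exact: cvg_cst.
apply: (closed_cvg (fun z => z <= c / 2 ^+ n)) h2; first exact: closed_le.
by exists n => // m /= nm; rewrite -(subnKC nm).
Qed.

Lemma half_pow_small (c e : R) : 0 < e -> exists n : nat, c / 2 ^+ n < e.
Proof.
move=> e0.
have c2 : c / 2 ^+ n @[n --> \oo] --> (0 : R).
  rewrite -(mulr0 c); apply: cvgM; first exact: cvg_cst.
  under eq_fun do rewrite -exprVn.
  by apply: cvg_expr; rewrite ger0_norm ?invr_ge0// invf_lt1// ltr1n.
have [N _ hN] : \forall n \near \oo, c / 2 ^+ n < e by apply: (cvgr_lt _ c2).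
by exists N; apply: hN => /=.
Qed.

End fractional_kernel.

(** * The binomial series of (1 - z)^(-be) inside the unit disc, in real and imaginary parts *)

Section binomial_kernel.
Context {R : realType}.
Implicit Types (q th be : R) (n N : nat).

(** Taylor coefficients of (1 - z)^(-be): rising factorials of [be] divided by n!. Their
    nonnegativity for nonnegative [be] is the source of all the positivity below. *)
Fixpoint binc be n : R :=
  if n is m.+1 then binc be m * (be + m%:R) / m.+1%:R else 1.

Lemma binc_ge0 be n : 0 <= be -> 0 <= binc be n.
Proof.
by move=> be0; elim: n => [|n ih] //=; rewrite divr_ge0// mulr_ge0// addr_ge0.
Qed.

Lemma binc_le1 be n : 0 <= be -> be <= 1 -> binc be n <= 1.
Proof.
move=> be0 be1; elim: n => [|n ih] //=.
rewrite ler_pdivrMr// mul1r -[leRHS]mul1r.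
apply: ler_pM => //; [exact: binc_ge0|exact: addr_ge0|].
by rewrite -[leRHS]natr1 addrC lerD2l.
Qed.

Definition bsumc be th N q : R := \sum_(n < N.+1) binc be n * cos (n%:R * th) * q ^+ n.
Definition bsums be th N q : R := \sum_(n < N.+1) binc be n * sin (n%:R * th) * q ^+ n.
(** Term by term derivative in [q] of the real part of the partial sum at z = q e^(i th). At n = 0
    the factor [n%:R] vanishes, so the truncated predecessor is harmless. *)
Definition dbsumc be th N q : R :=
  \sum_(n < N.+1) binc be n * cos (n%:R * th) * (n%:R * q ^+ n.-1).
Definition dbsums be th N q : R :=
  \sum_(n < N.+1) binc be n * sin (n%:R * th) * (n%:R * q ^+ n.-1).

Lemma is_derive_monomial (k q : R) n :
  is_derive q 1 (fun q => k * q ^+ n) (k * (n%:R * q ^+ n.-1)).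
Proof.
have h1 : is_derive q 1 (fun q : R => q ^+ n) (n%:R * q ^+ n.-1).
  elim: n => [|n ih].
    rewrite mul0r (_ : (fun _ => _) = cst 1); first exact: is_derive_cst.
    by apply/funext => x; rewrite expr0.
  have h := @is_deriveM R R _ _ q 1 _ _ (is_derive_id q 1) ih.
  rewrite (_ : (fun q => _) = id * (fun q : R => q ^+ n)).
    apply: (is_derive_eq h); rewrite /GRing.scale/= mulr1 -natr1.
    case: n {ih h} => [|n]; first by rewrite !expr0; ring.
    by rewrite /= [in RHS]exprS exprS; ring.
  by apply/funext => x; rewrite exprS.
exact: (@is_deriveZ R R R _ k q 1 _ h1).
Qed.

Lemma is_derive_bsum (f : nat -> R) N q :
  is_derive q 1 (fun q => \sum_(n < N.+1) f n * q ^+ n)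
    (\sum_(n < N.+1) f n * (n%:R * q ^+ n.-1)).
Proof.
elim: N => [|N ih].
  rewrite (_ : (fun _ => _) = fun q => f 0%N * q ^+ 0); last first.
    by apply/funext => x; rewrite big_ord_recr big_ord0/= add0r.
  by rewrite big_ord_recr big_ord0/= add0r; exact: is_derive_monomial.
rewrite (_ : (fun _ => _) = fun q => (\sum_(n < N.+1) f n * q ^+ n) + f N.+1 * q ^+ N.+1); last first.
  by apply/funext => x; rewrite big_ord_recr.
rewrite big_ord_recr/=.
exact: is_deriveD ih (is_derive_monomial _ _ _).
Qed.

(* The partial sums f of (1 - z)^(-be), z = q e^(i th), satisfy
   (1 - z) df/dq = e^(i th) (be f - (be + N) c_N z^N). *)
Lemma bsum_recurrence be th N q :
  let C := cos th in let S := sin th in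
  let x := be * bsumc be th N q - (be + N%:R) * binc be N * cos (N%:R * th) * q ^+ N in
  let y := be * bsums be th N q - (be + N%:R) * binc be N * sin (N%:R * th) * q ^+ N in
  (1 - q * C) * dbsumc be th N q + q * S * dbsums be th N q = C * x - S * y /\
  (1 - q * C) * dbsums be th N q - q * S * dbsumc be th N q = S * x + C * y.
Proof.
elim: N => [|N] /=.
  rewrite /bsumc /bsums /dbsumc /dbsums !big_ord_recr !big_ord0/= !mul0r.
  by rewrite cos0 sin0; split; ring.
rewrite /bsumc /bsums /dbsumc /dbsums => -[ih1 ih2].
rewrite !(big_ord_recr N.+1)/=.
move: ih1 ih2.
set dp := \sum_(i < N.+1) _; set ds := \sum_(i < N.+1) _.
set p := \sum_(i < N.+1) _; set s := \sum_(i < N.+1) _.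
have e : binc be N * (be + N%:R) / N.+1%:R * N.+1%:R = binc be N * (be + N%:R).
  by rewrite divfK.
set c' := binc be N * (be + N%:R) / N.+1%:R in e *.
have -> : N.+1%:R * th = N%:R * th + th by rewrite -natr1 mulrDl mul1r.
rewrite cosD sinD exprS.
have -> : be + N.+1%:R = (be + N%:R) + 1 by rewrite -natr1 addrA.
move: e; rewrite -[N.+1%:R]natr1 => e.
move: (cos (N%:R * th)) (sin (N%:R * th)) (cos th) (sin th) (q ^+ N) => CN SN C S Q.
move: c' (binc be N) (N%:R : R) e p s dp ds => c' c m e p s dp ds ih1 ih2.
have e' : (be + m) * c = c' * (m + 1) by rewrite mulrC.
rewrite e' in ih1 ih2; split.
  transitivity ((1 - q * C) * dp + q * S * ds + c' * (m + 1) * Q *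
    ((1 - q * C) * (CN * C - SN * S) + q * S * (SN * C + CN * S))); first by ring.
  by rewrite ih1; ring.
transitivity ((1 - q * C) * ds - q * S * dp + c' * (m + 1) * Q *
    ((1 - q * C) * (SN * C + CN * S) - q * S * (CN * C - SN * S))); first by ring.
by rewrite ih2; ring.
Qed.

(* [1 - q e^(i th) = bre - i bim] has modulus [sqrt bmod], argument [- barg], and
   power [bpowc - i bpows] of exponent [be]. *)
Definition bre q th : R := 1 - q * cos th.
Definition bim q th : R := q * sin th.
Definition bmod q th : R := bre q th ^+ 2 + bim q th ^+ 2.
Definition barg q th : R := atan (bim q th / bre q th).
Definition bpowc be q th : R := bmod q th `^ (be / 2) * cos (be * barg q th).
Definition bpows be q th : R := bmod q th `^ (be / 2) * sin (be * barg q th).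

Lemma bre_ge q th : 0 <= q -> 1 - q <= bre q th.
Proof.
move=> q0; rewrite lerB// -[leRHS]mulr1 ler_wpM2l// cos_le1.
Qed.

Lemma bre_gt0 q th : 0 <= q -> q < 1 -> 0 < bre q th.
Proof. by move=> q0 q1; rewrite (lt_le_trans _ (bre_ge _ q0))// subr_gt0. Qed.

Lemma bmod_ge q th : 0 <= q -> q < 1 -> (1 - q) ^+ 2 <= bmod q th.
Proof.
move=> q0 q1; rewrite /bmod -[leLHS]addr0 lerD ?sqr_ge0//.
rewrite lerXn2r ?bre_ge ?nnegrE ?subr_ge0 ?(ltW q1)//.
by rewrite -subr_ge0; exact: (ltW (bre_gt0 th q0 q1)).
Qed.

Lemma bmod_gt0 q th : 0 <= q -> q < 1 -> 0 < bmod q th.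
Proof.
by move=> q0 q1; rewrite (lt_le_trans _ (bmod_ge _ q0 q1))// exprn_gt0// subr_gt0.
Qed.

Lemma cos2Dsin2' th : cos th * cos th + sin th * sin th = 1.
Proof. by rewrite -!expr2 cos2Dsin2. Qed.

Lemma is_derive_bre q th : is_derive q 1 (fun q => bre q th) (- cos th).
Proof.
have h := @is_deriveB R R R (cst 1) (fun q => cos th * q ^+ 1) q 1 _ _
   (is_derive_cst _ _ _) (is_derive_monomial _ _ _).
rewrite (_ : (fun q => _) = cst 1 - (fun q => cos th * q ^+ 1)).
  by apply: (is_derive_eq h); rewrite /= expr0 sub0r !mulr1.
by apply/funext => x; rewrite /bre mulrC.
Qed.

Lemma is_derive_bim q th : is_derive q 1 (fun q => bim q th) (sin th).
Proof.
have h := is_derive_monomial (sin th) q 1.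
rewrite (_ : (fun q => _) = (fun q => sin th * q ^+ 1)).
  by apply: (is_derive_eq h); rewrite /= expr0 !mulr1.
by apply/funext => x; rewrite /bim mulrC.
Qed.

Lemma is_derive_bmod q th :
  is_derive q 1 (fun q => bmod q th) (- 2 * (cos th - q)).
Proof.
have h1 := is_derive_bre q th.
have h2 := is_derive_bim q th.
have h3 := @is_deriveX R R _ 2 q 1 _ h1.
have h4 := @is_deriveX R R _ 2 q 1 _ h2.
have h5 := @is_deriveD R R R _ _ q 1 _ _ h3 h4.
apply: (is_derive_eq h5); rewrite /GRing.scale/= !expr1 /bre /bim.
transitivity (- 2 * (cos th - q * (cos th * cos th + sin th * sin th))); first by ring.
by rewrite cos2Dsin2' mulr1.
Qed.

Lemma is_derive_barg q th : 0 <= q -> q < 1 ->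
  is_derive q 1 (fun q => barg q th) (sin th / bmod q th).
Proof.
move=> q0 q1.
have p0 := bre_gt0 th q0 q1; have r0 := bmod_gt0 th q0 q1.
have h1 := is_derive_bre q th.
have h2 := is_derive_bim q th.
have h3 := @is_deriveV R _ q _ 1 (lt0r_neq0 p0) h1.
have h4 := @is_deriveM R R _ _ q 1 _ _ h2 h3.
have h5 := @is_derive1_atan R (bim q th / bre q th).
have h6 := @is_derive1_comp R (@atan R) (fun q => bim q th / bre q th) q _ _ h5 h4.
apply: (is_derive_eq h6); rewrite /GRing.scale/=.
move: r0; rewrite /bmod => r0.
have e : bre q th * sin th + bim q th * cos th = sin th by rewrite /bre /bim; ring.
rewrite -[in RHS]e; field.
by rewrite gt_eqF// gt_eqF.
Qed.

Lemma is_derive_bpow be q th : 0 <= q -> q < 1 ->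
  is_derive q 1 (fun q => bpowc be q th)
    (- be * ((cos th - q) / bmod q th * bpowc be q th + sin th / bmod q th * bpows be q th)) /\
  is_derive q 1 (fun q => bpows be q th)
    (be * (sin th / bmod q th * bpowc be q th - (cos th - q) / bmod q th * bpows be q th)).
Proof.
move=> q0 q1; have r0 := bmod_gt0 th q0 q1.
have h1 := is_derive_bmod q th.
have h2 := is_derive_barg th q0 q1.
have h3 := @is_derive1_comp R (fun x => x `^ (be / 2)) (fun q => bmod q th) q _ _
  (is_derive1_powR (be / 2) r0) h1.
have h4 := @is_deriveZ R R R _ be q 1 _ h2.
have h5 := @is_derive1_comp R (@cos R) (fun q => be * barg q th) q _ _ (is_derive_cos _) h4.
have h6 := @is_derive1_comp R (@sin R) (fun q => be * barg q th) q _ _ (is_derive_sin _) h4.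
have e : bmod q th `^ (be / 2 - 1) = bmod q th `^ (be / 2) / bmod q th.
  by rewrite powRDp// powR_inv1// ltW.
split.
  have h7 := @is_deriveM R R _ _ q 1 _ _ h3 h5.
  apply: (is_derive_eq h7); rewrite /GRing.scale/= e /bpowc /bpows.
  by field; rewrite gt_eqF.
have h7 := @is_deriveM R R _ _ q 1 _ _ h3 h6.
apply: (is_derive_eq h7); rewrite /GRing.scale/= e /bpowc /bpows.
by field; rewrite gt_eqF.
Qed.

(** Real and imaginary parts of f_N(z) (1 - z)^be, where f_N is the partial sum. This product is 1
    at q = 0, and its derivative in [q] reduces to one boundary term of size N q^N; it therefore
    tends to 1, which is the binomial theorem. *)
Definition berrc be th N q : R :=
  bsumc be th N q * bpowc be q th + bsums be th N q * bpows be q th.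
Definition berrs be th N q : R :=
  bsums be th N q * bpowc be q th - bsumc be th N q * bpows be q th.

(** Here [m + i n] is e^(i th) / (1 - z) and [x + i y] is the boundary term of [bsum_recurrence];
    the contributions containing [be] times the partial sum cancel against the derivative of (1 -
    z)^be. *)
Lemma is_derive_berr be th N q : 0 <= q -> q < 1 ->
  let m := (cos th - q) / bmod q th in let n := sin th / bmod q th in
  let x := (be + N%:R) * binc be N * cos (N%:R * th) * q ^+ N in
  let y := (be + N%:R) * binc be N * sin (N%:R * th) * q ^+ N in
  is_derive q 1 (berrc be th N)
    (- ((m * x - n * y) * bpowc be q th + (n * x + m * y) * bpows be q th)) /\
  is_derive q 1 (berrs be th N)
    (- ((n * x + m * y) * bpowc be q th - (m * x - n * y) * bpows be q th)).
Proof.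
move=> q0 q1 m n x y; have r0 := bmod_gt0 th q0 q1.
have [dU dV] := is_derive_bpow be th q0 q1.
have dP : is_derive q 1 (bsumc be th N) (dbsumc be th N q).
  exact: (is_derive_bsum (fun n => binc be n * cos (n%:R * th))).
have dS : is_derive q 1 (bsums be th N) (dbsums be th N q).
  exact: (is_derive_bsum (fun n => binc be n * sin (n%:R * th))).
have [i1 i2] := bsum_recurrence be th N q.
have [gP gS] : dbsumc be th N q = m * (be * bsumc be th N q - x) - n * (be * bsums be th N q - y) /\
     dbsums be th N q = n * (be * bsumc be th N q - x) + m * (be * bsums be th N q - y).
  move: i1 i2; rewrite -/x -/y.
  move: (be * bsumc be th N q - x) (be * bsums be th N q - y) => X Y.
  move: (dbsumc be th N q) (dbsums be th N q) => gP gS.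
  have cs := cos2Dsin2' th.
  have rE : bmod q th = (1 - q * cos th) ^+ 2 + (q * sin th) ^+ 2 by [].
  rewrite /m /n.
  have re1 : (1 - q * cos th) * cos th - q * sin th * sin th = cos th - q.
    transitivity (cos th - q * (cos th * cos th + sin th * sin th)); first by ring.
    by rewrite cs mulr1.
  have re2 : (1 - q * cos th) * sin th + q * sin th * cos th = sin th by ring.
  move: (cos th) (sin th) (bmod q th) r0 rE re1 re2 => C S r r0 rE re1 re2 i1 i2.
  have rn0 : r != 0 by rewrite gt_eqF.
  split; apply: (mulfI rn0).
    transitivity ((1 - q * C) * ((1 - q * C) * gP + q * S * gS) - q * S * ((1 - q * C) * gS - q * S * gP)).
      by rewrite rE; ring.
    rewrite i1 i2.
    transitivity (((1 - q * C) * C - q * S * S) * X - ((1 - q * C) * S + q * S * C) * Y); first by ring.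
    by rewrite re1 re2; field.
  transitivity ((1 - q * C) * ((1 - q * C) * gS - q * S * gP) + q * S * ((1 - q * C) * gP + q * S * gS)).
    by rewrite rE; ring.
  rewrite i1 i2.
  transitivity (((1 - q * C) * S + q * S * C) * X + ((1 - q * C) * C - q * S * S) * Y); first by ring.
  by rewrite re1 re2; field.
rewrite -/m -/n in dU dV.
rewrite gP in dP; rewrite gS in dS.
split.
  have h1 := @is_deriveM R R _ _ q 1 _ _ dP dU.
  have h2 := @is_deriveM R R _ _ q 1 _ _ dS dV.
  have h3 := @is_deriveD R R R _ _ q 1 _ _ h1 h2.
  apply: (is_derive_eq h3); rewrite /GRing.scale/=; ring.
have h1 := @is_deriveM R R _ _ q 1 _ _ dS dU.
have h2 := @is_deriveM R R _ _ q 1 _ _ dP dV.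
have h3 := @is_deriveB R R R _ _ q 1 _ _ h1 h2.
apply: (is_derive_eq h3); rewrite /GRing.scale/=; ring.
Qed.

Lemma mulSn_expr_bounded (r : R) : 0 < r -> r < 1 ->
  exists2 M : R, 0 <= M & forall n, n.+1%:R * r ^+ n <= M.
Proof.
move=> r0 r1; pose d := r^-1 - 1.
have d0 : 0 < d by rewrite subr_gt0 invf_gt1.
exists (1 + d^-1); first by rewrite addr_ge0// invr_ge0 ltW.
move=> n; rewrite -(invrK (r ^+ n)) ler_pdivrMr ?invr_gt0 ?exprn_gt0//.
have -> : (r ^+ n)^-1 = (1 + d) ^+ n by rewrite /d addrC subrK exprVn.
have h : 1 + n%:R * d <= (1 + d) ^+ n.
  elim: n => [|n ih]; first by rewrite mul0r addr0.
  rewrite exprS; apply: (@le_trans _ _ ((1 + d) * (1 + n%:R * d))); last first.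
    by rewrite ler_wpM2l// addr_ge0// ltW.
  rewrite -natr1 -subr_ge0 (_ : _ - _ = n%:R * d * d); last by ring.
  by rewrite !mulr_ge0// ltW.
apply: (@le_trans _ _ ((1 + d^-1) * (1 + n%:R * d))); last first.
  by rewrite ler_wpM2l// addr_ge0// invr_ge0 ltW.
rewrite -natr1 -subr_ge0 (_ : _ - _ = n%:R * d + d^-1).
  by rewrite addr_ge0 ?mulr_ge0 ?invr_ge0// ltW.
by field; rewrite gt_eqF.
Qed.

Lemma mulSn_expr_cvg0 q : 0 < q -> q < 1 -> n.+1%:R * q ^+ n @[n --> \oo] --> (0 : R).
Proof.
move=> q0 q1; pose r := Num.sqrt q.
(* One factor r^n absorbs n + 1, the other tends to zero. *)
have r0 : 0 < r by rewrite sqrtr_gt0.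
have rr : q = r * r by rewrite -expr2 sqr_sqrtr// ltW.
have r1 : r < 1 by rewrite -sqrtr1 ltr_sqrt.
have [M M0 hM] := mulSn_expr_bounded r0 r1.
have c : M * r ^+ n @[n --> \oo] --> (0 : R).
  rewrite -(mulr0 M); apply: cvgM; first exact: cvg_cst.
  by apply: cvg_expr; rewrite gtr0_norm.
apply: (squeeze_cvgr _ (@cvg_cst _ (0 : R) _ _ _) c).
near=> n; rewrite mulr_ge0// ?exprn_ge0 ?(ltW q0)//=.
have -> : q ^+ n = r ^+ n * r ^+ n by rewrite [in LHS]rr exprMn.
by rewrite mulrA ler_wpM2r ?exprn_ge0 ?(ltW r0).
Unshelve. all: by end_near. Qed.

(** The constant is crude: both parts of 1 - z are at most 2 in modulus, so [bmod] is at most 8, and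
    the exponent [be / 2] does not exceed 1. *)
Lemma bpowc_le be q th : 0 <= be -> be <= 1 -> 0 <= q -> q < 1 ->
  `|bpowc be q th| <= 8 /\ `|bpows be q th| <= 8.
Proof.
move=> be0 be1 q0 q1.
have r0 := bmod_gt0 th q0 q1.
have h1 : bmod q th <= 8.
  rewrite /bmod (_ : (8 : R) = 2 ^+ 2 + 2 ^+ 2); last by ring.
  have hc := cos_max th; have hs := sin_max th.
  rewrite -[bre q th ^+ 2]real_normK ?num_real// -[bim q th ^+ 2]real_normK ?num_real//.
  apply: lerD; rewrite lerXn2r ?nnegrE//.
    rewrite /bre (le_trans (ler_normB _ _))// normr1 normrM (ger0_norm q0).
    by rewrite (_ : (2 : R) = 1 + 1 * 1) ?lerD2l ?ler_pM// ?ltW//; ring.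
  rewrite /bim normrM (ger0_norm q0) (_ : (2 : R) = 1 * 2) ?ler_pM// ?(ltW q1)//; last by ring.
  by rewrite (le_trans hs)// ler1n.
have h2 : bmod q th `^ (be / 2) <= 8.
  have [h|h] := leP (bmod q th) 1.
    apply: (@le_trans _ _ 1); last by rewrite ler1n.
    rewrite -[leRHS](powRr0 (bmod q th)); apply: ger_powR; rewrite ?r0//.
    by rewrite divr_ge0.
  apply: le_trans h1; rewrite -[leRHS](powRr1 (ltW r0)).
  by apply: ler_powR; [exact: ltW|lra_].
split; rewrite normrM (ger0_norm (powR_ge0 _ _)) -[leRHS]mulr1;
  by rewrite ler_pM ?powR_ge0 ?cos_max ?sin_max.
Qed.

Lemma is_derive_le_diff (f df : R -> R) (q M : R) : 0 <= q ->
  (forall x, 0 <= x -> x <= q -> is_derive x 1 f (df x)) ->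
  (forall x, 0 <= x -> x <= q -> `|df x| <= M) -> `|f q - f 0| <= M * q.
Proof.
move=> q0 d bd.
have [||c /itvP cq ->] := @MVT_segment R f df 0 q q0.
- by move=> x /itvP xq; apply: d; rewrite xq.
- apply: continuous_in_subspaceT => x; rewrite inE/= in_itv/= => /andP[x0 xq].
  have [dx _] := d x x0 xq.
  exact/differentiable_continuous/derivable1_diffP.
by rewrite subr0 normrM (ger0_norm q0) ler_wpM2r// bd ?cq.
Qed.

Lemma berr_cvg be th q : 0 <= be -> be <= 1 -> 0 < q -> q < 1 ->
  berrc be th N q @[N --> \oo] --> (1 : R) /\ berrs be th N q @[N --> \oo] --> (0 : R).
Proof.
move=> be0 be1 q0 q1.
(* With [m] and [n] at most 2 / (1 - q)^2, each combination of two products costs a factor 4, each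
   power of 1 - z a factor 8, and there are two such terms. *)
pose K : R := 64 / (1 - q) ^+ 2.
have K0 : 0 <= K by rewrite divr_ge0// sqr_ge0.
have e0 N : berrc be th N 0 = 1 /\ berrs be th N 0 = 0.
  have hr : bre 0 th = 1 by rewrite /bre mul0r subr0.
  have hi : bim 0 th = 0 by rewrite /bim mul0r.
  have hm : bmod 0 th = 1 by rewrite /bmod hr hi expr1n expr0n addr0.
  rewrite /berrc /berrs /bpowc /bpows hm powR1 /barg hr hi mul0r atan0 mulr0 cos0 sin0.
  rewrite !mulr1 !mulr0 addr0 subr0 /bsumc /bsums !big_ord_recl/= !big1//.
    by rewrite !mul0r cos0 sin0 !expr0 !mulr1 addr0 mulr0 addr0.
    by move=> i _; rewrite /= /bump/= add1n exprS mul0r mulr0.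
  by move=> i _; rewrite /= /bump/= add1n exprS mul0r mulr0.
have bd N x : 0 <= x -> x <= q ->
  let m := (cos th - x) / bmod x th in let n := sin th / bmod x th in
  let a := (be + N%:R) * binc be N * cos (N%:R * th) * x ^+ N in
  let b := (be + N%:R) * binc be N * sin (N%:R * th) * x ^+ N in
  `|- ((m * a - n * b) * bpowc be x th + (n * a + m * b) * bpows be x th)| <=
    K * (N.+1%:R * q ^+ N) /\
  `|- ((n * a + m * b) * bpowc be x th - (m * a - n * b) * bpows be x th)| <=
    K * (N.+1%:R * q ^+ N).
  move=> x0 xq m n a b.
  have x1 : x < 1 by exact: le_lt_trans q1.
  have [hU hV] := bpowc_le th be0 be1 x0 x1.
  have r0 := bmod_gt0 th x0 x1.
  pose J := (1 - q) ^- 2.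
  have rJ : (bmod x th)^-1 <= J.
    rewrite /J lef_pV2 ?posrE ?exprn_gt0 ?subr_gt0//.
    apply: le_trans (bmod_ge th x0 x1).
    by rewrite lerXn2r ?nnegrE ?subr_ge0 ?(ltW x1) ?(ltW q1)// lerB.
  have hm : `|m| <= 2 * J.
    rewrite normrM (@ger0_norm _ (_^-1)) ?invr_ge0 ?(ltW r0)//.
    apply: ler_pM; rewrite ?invr_ge0 ?(ltW r0)//.
    rewrite (le_trans (ler_normB _ _))// (ger0_norm x0) (_ : (2 : R) = 1 + 1); last by ring.
    by apply: lerD; [exact: cos_max|exact: ltW].
  have hn : `|n| <= 2 * J.
    rewrite normrM (@ger0_norm _ (_^-1)) ?invr_ge0 ?(ltW r0)//.
    apply: ler_pM; rewrite ?invr_ge0 ?(ltW r0)//.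
    by rewrite (le_trans (sin_max _))// ler1n.
  pose Y := N.+1%:R * q ^+ N.
  have hc (z : R) : `|z| <= 1 -> `|(be + N%:R) * binc be N * z * x ^+ N| <= Y.
    move=> z1; rewrite !normrM.
    rewrite (ger0_norm (addr_ge0 be0 (ler0n _ _))) (ger0_norm (binc_ge0 _ be0)).
    rewrite (ger0_norm (exprn_ge0 _ x0)).
    rewrite /Y (_ : N.+1%:R = N.+1%:R * 1 * 1 :> R); last by rewrite !mulr1.
    apply: ler_pM; rewrite ?mulr_ge0 ?addr_ge0 ?binc_ge0 ?exprn_ge0//.
      apply: ler_pM; rewrite ?mulr_ge0 ?addr_ge0 ?binc_ge0//.
      apply: ler_pM; rewrite ?addr_ge0 ?binc_ge0 ?binc_le1//.
      by rewrite -natr1 addrC lerD2l.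
    by rewrite lerXn2r ?nnegrE// ltW.
  have ha : `|a| <= Y by apply: hc; exact: cos_max.
  have hb : `|b| <= Y by apply: hc; exact: sin_max.
  have four (a1 b1 a2 b2 : R) : `|a1| <= 2 * J -> `|b1| <= 2 * J ->
      `|a2| <= Y -> `|b2| <= Y -> `|a1 * a2| + `|b1 * b2| <= 4 * (J * Y).
    move=> *; rewrite !normrM (_ : 4 * (J * Y) = 2 * J * Y + 2 * J * Y); last by ring.
    by apply: lerD; apply: ler_pM.
  have JY : 0 <= J * Y by rewrite mulr_ge0 ?invr_ge0 ?sqr_ge0// mulr_ge0// exprn_ge0// ltW.
  have KE : K * (N.+1%:R * q ^+ N) = 4 * (J * Y) * 8 + 4 * (J * Y) * 8.
    by rewrite /K /J /Y; ring.
  have two (x1' x2' u v : R) : `|x1'| <= 4 * (J * Y) -> `|x2'| <= 4 * (J * Y) ->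
      `|u| <= 8 -> `|v| <= 8 -> `|x1' * u| + `|x2' * v| <= 4 * (J * Y) * 8 + 4 * (J * Y) * 8.
    by move=> *; rewrite !normrM; apply: lerD; apply: ler_pM.
  have hd : `|m * a - n * b| <= 4 * (J * Y).
    by apply: (le_trans (ler_normB _ _)); exact: four.
  have hs : `|n * a + m * b| <= 4 * (J * Y).
    by apply: (le_trans (ler_normD _ _)); exact: four.
  rewrite !normrN KE; split.
    by apply: (le_trans (ler_normD _ _)); exact: two.
  by apply: (le_trans (ler_normB _ _)); exact: two.
have lim0 : K * (N.+1%:R * q ^+ N) * q @[N --> \oo] --> (0 : R).
  have h : K * (N.+1%:R * q ^+ N) * q @[N --> \oo] --> K * 0 * q.
    by apply: cvgM; [apply: cvgM; [exact: cvg_cst|exact: mulSn_expr_cvg0]|exact: cvg_cst].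
  by rewrite mulr0 mul0r in h.
have fin (g : nat -> R) (l : R) : (forall N, `|g N - l| <= K * (N.+1%:R * q ^+ N) * q) ->
    g N @[N --> \oo] --> l.
  move=> hg; apply/cvgrPdist_le => e ep.
  have [N0 _ hN] : \forall N \near \oo, K * (N.+1%:R * q ^+ N) * q < e.
    by apply: (cvgr_lt _ lim0).
  by exists N0 => // N /= NN0; rewrite distrC (le_trans (hg N))// ltW// hN.
split; apply: fin => N.
  rewrite -{1}(e0 N).1; apply: is_derive_le_diff (ltW q0) _ _.
    by move=> x x0 xq; apply: (is_derive_berr _ _ _ x0 (le_lt_trans xq q1)).1.
  by move=> x x0 xq; apply: (bd N x x0 xq).1.
rewrite -{1}(e0 N).2; apply: is_derive_le_diff (ltW q0) _ _.
  by move=> x x0 xq; apply: (is_derive_berr _ _ _ x0 (le_lt_trans xq q1)).2.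
by move=> x x0 xq; apply: (bd N x x0 xq).2.
Qed.

(** Real part of (1 - z)^(-be), the sum of the series; since [barg] is minus the argument of 1 - z,
    the imaginary part [bkers] carries a plus sign. *)
Definition bkerc be q th : R := bmod q th `^ (- (be / 2)) * cos (be * barg q th).
Definition bkers be q th : R := bmod q th `^ (- (be / 2)) * sin (be * barg q th).

Lemma bsum_cvg be th q : 0 <= be -> be <= 1 -> 0 < q -> q < 1 ->
  bsumc be th N q @[N --> \oo] --> bkerc be q th /\
  bsums be th N q @[N --> \oo] --> bkers be q th.
Proof.
move=> be0 be1 q0 q1.
have [c1 c2] := berr_cvg th be0 be1 q0 q1.
have r0 := bmod_gt0 th (ltW q0) q1.
pose M := bmod q th `^ (be / 2); have M0 : 0 < M by rewrite powR_gt0.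
have cs := cos2Dsin2' (be * barg q th).
have [U1 V1] : bkerc be q th = bpowc be q th / M ^+ 2 /\ bkers be q th = bpows be q th / M ^+ 2.
  rewrite /bkerc /bkers /bpowc /bpows powRN -/M.
  by split; field; rewrite gt_eqF.
have UV : bpowc be q th ^+ 2 + bpows be q th ^+ 2 = M ^+ 2.
  rewrite /bpowc /bpows -/M.
  transitivity (M ^+ 2 * (cos (be * barg q th) * cos (be * barg q th) +
     sin (be * barg q th) * sin (be * barg q th))); first by ring.
  by rewrite cs mulr1.
have Mn0 : M ^+ 2 != 0 by rewrite expf_neq0// gt_eqF.
split.
  have -> : (fun N => bsumc be th N q) = fun N =>
     (berrc be th N q * bpowc be q th - berrs be th N q * bpows be q th) / M ^+ 2.
    apply/funext => N; rewrite /berrc /berrs -UV; field; by rewrite UV.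
  have h : (berrc be th N q * bpowc be q th - berrs be th N q * bpows be q th) / M ^+ 2
    @[N --> \oo] --> (1 * bpowc be q th - 0 * bpows be q th) / M ^+ 2.
    apply: cvgM; last exact: cvg_cst.
    by apply: cvgB; apply: cvgM => //; exact: cvg_cst.
  by rewrite mul1r mul0r subr0 -U1 in h.
have -> : (fun N => bsums be th N q) = fun N =>
   (berrc be th N q * bpows be q th + berrs be th N q * bpowc be q th) / M ^+ 2.
  apply/funext => N; rewrite /berrc /berrs -UV; field; by rewrite UV.
have h : (berrc be th N q * bpows be q th + berrs be th N q * bpowc be q th) / M ^+ 2
  @[N --> \oo] --> (1 * bpows be q th + 0 * bpowc be q th) / M ^+ 2.
  apply: cvgM; last exact: cvg_cst.
  by apply: cvgD; apply: cvgM => //; exact: cvg_cst.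
by rewrite mul1r mul0r addr0 -V1 in h.
Qed.

End binomial_kernel.

(** * Positive type of the fractional kernel rotated to the boundary of the sector *)

Section positivity.
Context {R : realType}.
Variable al : R.
Hypotheses (al0 : 0 < al) (al1 : al < 1).
Implicit Types (a b k kc ks : R -> R) (t T : R).

Lemma conv_sing1 k a : sing al k -> sing 1 a -> sing 1 (conv k a).
Proof. by move=> sk sa; apply: (sing_conv al0 (ltW al1)). Qed.

(** With y = a + i b and K = kc + i ks, this is the real part of conj(y) (K * y), the integrand of
    the quadratic form of [K]. *)
Definition qint kc ks a b t : R :=
  a t * conv kc a t + b t * conv kc b t + (b t * conv ks a t - a t * conv ks b t).

Lemma sing1N a : sing 1 a -> sing 1 (fun t => - a t).
Proof. by move=> /(singZ (-1)); apply: eq_sing => t _; rewrite mulN1r. Qed.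

Lemma sing1B a b : sing 1 a -> sing 1 b -> sing 1 (fun t => a t - b t).
Proof. by move=> sa sb; apply: singD => //; exact: sing1N. Qed.

Lemma sing_qint kc ks a b : sing al kc -> sing al ks -> sing 1 a -> sing 1 b ->
  sing 1 (qint kc ks a b).
Proof.
move=> skc sks sa sb; apply: singD.
  by apply: singD; apply: sing1M => //; exact: conv_sing1.
by apply: sing1B; apply: sing1M => //; exact: conv_sing1.
Qed.

Lemma conv_suml (n : nat) (d : nat -> R) (f_ : nat -> R -> R) a t :
  (forall i, sing al (f_ i)) -> sing 1 a -> 0 < t ->
  conv (fun s => \sum_(i < n) d i * f_ i s) a t = \sum_(i < n) d i * conv (f_ i) a t.
Proof.
move=> sf sa t0; rewrite /conv.
have h i : intble 0 t (fun s => d i * (f_ i (t - s) * a s)).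
  by apply: intbleZ; exact: (conv_intble al0 (ltW al1) ltr01 _ (sf i) sa t0).
have := (rint_sum (index_enum 'I_n) (fun i : 'I_n => h i)).2.
rewrite [X in _ = X -> _](eq_bigr (fun i : 'I_n => d i * rint 0 t (fun s => f_ i (t - s) * a s))).
  move=> <-; congr rint; apply/funext => s; rewrite mulr_suml.
  by apply: eq_bigr => i _; rewrite mulrA.
move=> i _; rewrite rintZ//.
exact: (conv_intble al0 (ltW al1) ltr01 _ (sf i) sa t0).
Qed.

Lemma qintZ (c : R) kc ks a b T : sing al kc -> sing al ks -> sing 1 a -> sing 1 b ->
  0 < T -> rint 0 T (qint (fun u => c * kc u) (fun u => c * ks u) a b) =
    c * rint 0 T (qint kc ks a b).
Proof.
move=> skc sks sa sb T0; have qi := sing_intble ltr01 (sing_qint skc sks sa sb) T0.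
rewrite -rintZ//; apply/esym; apply: eq_rint; first exact: intble_measurable_oo (intbleZ _ qi).
by move=> t t0 tT; rewrite /qint !(convZl _ al0 (ltW al1) ltr01 (lexx _))//; ring.
Qed.

Lemma rint_self_conv (y : R -> R) T : sing 1 y -> 0 < T ->
  intble 0 T (fun t => y t * rint 0 t y) /\
  rint 0 T (fun t => y t * rint 0 t y) = 2^-1 * (rint 0 T y) ^+ 2.
Proof.
move=> sy T0; have yi := sing_intble ltr01 sy T0.
have e1 : (fun t => rint 0 t y) = conv (fun=> 1) y.
  by apply/funext => t; rewrite /conv; congr rint; apply/funext => s; rewrite mul1r.
have sG : sing 1 (fun t => rint 0 t y).
  rewrite e1; apply: (sing_conv ltr01 _ ltr01) => //; exact: sing_cst.
have sp : sing 1 (fun t => y t * rint 0 t y) by exact: sing1M.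
have pi := sing_intble ltr01 sp T0.
split => //; rewrite -[RHS]subr0.
apply: (@FTC_open R 0 T _ (fun t => 2^-1 * (rint 0 t y) ^+ 2)) => //.
- by apply: contp_oo; exact: sp.1.
- move=> x x0 xT.
  have d := rint_derive x0 xT yi (sy.1 x x0).
  have d2 := @is_deriveX R R _ 2 x 1 _ d.
  have d3 := @is_deriveZ R R R _ 2^-1 x 1 _ d2.
  by apply: (is_derive_eq d3); rewrite /GRing.scale/= !mulrA mulVf ?mul1r ?pnatr_eq0// mulrC.
- have h := rint_cvg_right T0 yi.
  have : 2^-1 * (rint 0 t y) ^+ 2 @[t --> 0^'+] --> (2^-1 * (0 * 0) : R).
    by apply: cvgM; [exact: cvg_cst|apply: cvgM].
  by rewrite !mulr0.
- have h := rint_cvg_left T0 yi.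
  by apply: cvgM; [exact: cvg_cst|apply: cvgM].
Qed.

Lemma sing_trig (f : R -> R) (w : R) : continuous f -> (forall x, `|f x| <= 1) ->
  sing 1 (fun u => f (w * u)).
Proof.
move=> cf f1; split.
  move=> t t0; apply: (@cvg_comp _ _ _ (fun u => w * u) f _ (nbhs (w * t))).
    by apply: cvgM; [exact: cvg_cst|exact: cvg_id].
  exact: cf.
by move=> T T0; exists 1 => // t t0 tT; rewrite subrr powRr0 mulr1.
Qed.

Lemma sing1_al f : sing 1 f -> sing al f.
Proof. by apply: sing_mono; exact: ltW. Qed.

(** For the character e^(i w u), the factor e^(i w (t - s)) splits. With Y = y1 + i y2 = e^(-i w t)
    (a + i b), the integrand is the real part of conj(Y) times the integral of Y, the derivative of
    half a squared modulus. *)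
Lemma qint_trig_ge0 (w : R) a b T : sing 1 a -> sing 1 b -> 0 < T ->
  0 <= rint 0 T (qint (fun u => cos (w * u)) (fun u => sin (w * u)) a b).
Proof.
move=> sa sb T0.
have sc := sing_trig w (@continuous_cos R) (@cos_max R).
have ss := sing_trig w (@continuous_sin R) (@sin_max R).
pose y1 t := a t * cos (w * t) + b t * sin (w * t).
pose y2 t := b t * cos (w * t) - a t * sin (w * t).
have s1 : sing 1 y1 by apply: singD; exact: sing1M.
have s2 : sing 1 y2 by apply: sing1B; exact: sing1M.
have sq := sing_qint (sing1_al sc) (sing1_al ss) sa sb.
have qi := sing_intble ltr01 sq T0.
have e t : 0 < t -> t < T ->
    qint (fun u => cos (w * u)) (fun u => sin (w * u)) a b t =
    y1 t * rint 0 t y1 + y2 t * rint 0 t y2.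
  move=> t0 tT.
  have i11 := conv_intble ltr01 (lexx _) ltr01 (lexx _) sc sa t0.
  have i12 := conv_intble ltr01 (lexx _) ltr01 (lexx _) sc sb t0.
  have i21 := conv_intble ltr01 (lexx _) ltr01 (lexx _) ss sa t0.
  have i22 := conv_intble ltr01 (lexx _) ltr01 (lexx _) ss sb t0.
  have j1 := sing_intble ltr01 s1 t0; have j2 := sing_intble ltr01 s2 t0.
  rewrite /qint /conv -!rintZ// -?rintB -?rintD//; do ?[exact: intbleZ|apply: intbleB|apply: intbleD] => //.
  congr rint; apply/funext => s.
  rewrite /y1 /y2 mulrBr cosB sinB; ring.
rewrite (eq_rint (intble_measurable_oo qi) e).
have [i1 e1] := rint_self_conv s1 T0; have [i2 e2] := rint_self_conv s2 T0.
by rewrite rintD// e1 e2 addr_ge0// mulr_ge0// sqr_ge0.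
Qed.

Lemma qint_sum_ge0 (n : nat) (d : nat -> R) (w : nat -> R) a b T :
  (forall i, 0 <= d i) -> sing 1 a -> sing 1 b -> 0 < T ->
  0 <= rint 0 T (qint (fun u => \sum_(i < n) d i * cos (w i * u))
                   (fun u => \sum_(i < n) d i * sin (w i * u)) a b).
Proof.
move=> d0 sa sb T0.
have sc i := sing1_al (sing_trig (w i) (@continuous_cos R) (@cos_max R)).
have ss i := sing1_al (sing_trig (w i) (@continuous_sin R) (@sin_max R)).
have qi i := sing_intble ltr01 (sing_qint (sc i) (ss i) sa sb) T0.
have e t : 0 < t -> t < T ->
    \sum_(i < n) d i * qint (fun u => cos (w i * u)) (fun u => sin (w i * u)) a b t =
    qint (fun u => \sum_(i < n) d i * cos (w i * u))
                   (fun u => \sum_(i < n) d i * sin (w i * u)) a b t.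
  move=> t0 tT; rewrite /qint.
  rewrite (@conv_suml n d (fun i u => cos (w i * u)) a t sc sa t0).
  rewrite (@conv_suml n d (fun i u => cos (w i * u)) b t sc sb t0).
  rewrite (@conv_suml n d (fun i u => sin (w i * u)) a t ss sa t0).
  rewrite (@conv_suml n d (fun i u => sin (w i * u)) b t ss sb t0).
  rewrite !mulr_sumr -sumrB -!big_split/=.
  by apply: eq_bigr => i _; ring.
have h (i : 'I_n) := intbleZ (d i) (qi i).
have [si se] := rint_sum (index_enum 'I_n) h.
rewrite -(eq_rint (intble_measurable_oo si) e) se.
by apply: sumr_ge0 => i _; rewrite rintZ// mulr_ge0// qint_trig_ge0.
Qed.

(** Dominated convergence used twice: inside the convolutions with the majorant [ker al], then in
    the outer integral, where the convolutions are uniformly bounded on (0, T). *)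
Lemma qint_cvg (kc ks : nat -> R -> R) (lc ls : R -> R) (C : R) a b T :
  (forall n, sing al (kc n)) -> (forall n, sing al (ks n)) ->
  (forall n u, 0 < u -> u < T -> `|kc n u| <= C * ker al u) ->
  (forall n u, 0 < u -> u < T -> `|ks n u| <= C * ker al u) ->
  (forall u, 0 < u -> u < T -> kc n u @[n --> \oo] --> lc u) ->
  (forall u, 0 < u -> u < T -> ks n u @[n --> \oo] --> ls u) ->
  sing 1 a -> sing 1 b -> 0 < T ->
  rint 0 T (qint (kc n) (ks n) a b) @[n --> \oo] --> rint 0 T (qint lc ls a b).
Proof.
move=> skc sks kcC ksC kcl ksl sa sb T0.
have [A A0 aA] := sing1_bound sa T0; have [B B0 bB] := sing1_bound sb T0.
pose D := A + B.
have aD t : 0 < t -> t <= T -> `|a t| <= D.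
  by move=> t0 tT; rewrite (le_trans (aA t t0 tT))// lerDl.
have bD t : 0 < t -> t <= T -> `|b t| <= D.
  by move=> t0 tT; rewrite (le_trans (bB t t0 tT))// lerDr.
have D0 : 0 <= D by rewrite addr_ge0.
have C0 : 0 <= C.
  have := le_trans (normr_ge0 _) (kcC 0%N (T / 2) _ _).
  rewrite pmulr_lge0; last by rewrite /ker powR_gt0// divr_gt0.
  by apply; lra_.
have kpi t : 0 < t -> intble 0 t (fun s => C * D * ker al (t - s)) /\
    rint 0 t (fun s => C * D * ker al (t - s)) = C * D * (t `^ al / al).
  move=> t0; have [i e] := rint_pow al0 t0.
  have [i' e'] := rint_reflect t0 (contp_oo (@contp_pow R (al - 1))) i.
  by split; [exact: intbleZ|rewrite rintZ// e' e].
have dom (k : R -> R) (y : R -> R) t : (forall u, 0 < u -> u < T -> `|k u| <= C * ker al u) ->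
    (forall t, 0 < t -> t <= T -> `|y t| <= D) -> 0 < t -> t < T ->
    forall s, 0 < s -> s < t -> `|k (t - s) * y s| <= C * D * ker al (t - s).
  move=> kC yD t0 tT s s0 st; rewrite normrM mulrAC ler_pM//.
    by apply: kC; lra_.
  by apply: yD; lra_.
have cv (k : nat -> R -> R) (l y : R -> R) : (forall n, sing al (k n)) ->
    (forall n u, 0 < u -> u < T -> `|k n u| <= C * ker al u) ->
    (forall u, 0 < u -> u < T -> k n u @[n --> \oo] --> l u) -> sing 1 y ->
    (forall t, 0 < t -> t <= T -> `|y t| <= D) ->
    forall t, 0 < t -> t < T -> conv (k n) y t @[n --> \oo] --> conv l y t.
  move=> sk kC kl sy yD t t0 tT; rewrite /conv.
  apply: (@rint_dct R 0 t _ _ (fun s => C * D * ker al (t - s))).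
  - by move=> n; apply: contoo_measurable; apply: contoo_conv; [exact: (sk n).1|exact: sy.1].
  - move=> s s0 st; apply: cvgM; last exact: cvg_cst.
    by apply: kl; lra_.
  - by move=> n s s0 st; apply: dom => //; exact: kC.
  - by have [] := kpi t t0.
pose M := C * D * (T `^ al / al).
have cb (k : R -> R) (y : R -> R) : sing al k ->
    (forall u, 0 < u -> u < T -> `|k u| <= C * ker al u) -> sing 1 y ->
    (forall t, 0 < t -> t <= T -> `|y t| <= D) ->
    forall t, 0 < t -> t < T -> `|conv k y t| <= M.
  move=> sk kC sy yD t t0 tT; have [i e] := kpi t t0.
  have := norm_rint_le _ i (dom k y t kC yD t0 tT).
  rewrite e => /(_ _)h; apply: le_trans (h _) _.
    by apply: contoo_measurable; apply: contoo_conv; [exact: sk.1|exact: sy.1].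
  rewrite /M ler_wpM2l ?mulr_ge0// ler_wpM2r ?invr_ge0 ?(ltW al0)//.
  by apply: ge0_ler_powR; rewrite ?nnegrE ?(ltW al0) ?(ltW t0) ?(ltW T0) ?(ltW tT).
apply: (@rint_dct R 0 T _ _ (fun=> D * M + D * M + (D * M + D * M))).
- move=> n; apply: contoo_measurable; apply: contp_oo.
  exact: (sing_qint (skc n) (sks n) sa sb).1.
- move=> t t0 tT; rewrite /qint.
  apply: cvgD; [apply: cvgD|apply: cvgB]; apply: cvgM; do ?exact: cvg_cst; exact: cv.
- move=> n t t0 tT; rewrite /qint.
  have h (y z : R) : `|y| <= D -> `|z| <= M -> `|y * z| <= D * M.
    by move=> yD zM; rewrite normrM ler_pM.
  have at' := aD t t0 (ltW tT); have bt' := bD t t0 (ltW tT).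
  apply: (le_trans (ler_normD _ _)); apply: lerD.
    by apply: (le_trans (ler_normD _ _)); apply: lerD; apply: h => //; apply: cb => //; move=> *; [exact: kcC|exact: kcC].
  by apply: (le_trans (ler_normB _ _)); apply: lerD; apply: h => //; apply: cb => //; move=> *; [exact: ksC|exact: ksC].
- exact: intble_cst.
Qed.

Local Notation be := (1 - al).

Lemma cvg_cont_at (U : Type) (F : set_system U) {FF : Filter F} (f : R -> R)
    (g : U -> R) (l : R) : {for l, continuous f} -> g x @[x --> F] --> l ->
  f (g x) @[x --> F] --> f l.
Proof.
move=> cf gl; apply: (@cvg_comp _ _ _ g f _ (nbhs l)); first exact: gl.
exact: cf.
Qed.

Lemma cvg_cont (U : Type) (F : set_system U) {FF : Filter F} (f : R -> R)
    (g : U -> R) (l : R) : continuous f -> g x @[x --> F] --> l ->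
  f (g x) @[x --> F] --> f l.
Proof.
move=> cf gl; apply: (@cvg_comp _ _ _ g f _ (nbhs l)); first exact: gl.
exact: cf.
Qed.

Lemma sing_bker (q h : R) : 0 < q -> q < 1 ->
  sing 1 (fun u => bkerc be q (h * u)) /\ sing 1 (fun u => bkers be q (h * u)).
Proof.
move=> q0 q1.
have ch (t : R) : h * u @[u --> t] --> h * t by apply: cvgM; [exact: cvg_cst|exact: cvg_id].
have cc (t : R) : cos (h * u) @[u --> t] --> cos (h * t).
  exact: (cvg_cont (@continuous_cos R) (ch t)).
have cs (t : R) : sin (h * u) @[u --> t] --> sin (h * t).
  exact: (cvg_cont (@continuous_sin R) (ch t)).
have cre (t : R) : bre q (h * u) @[u --> t] --> bre q (h * t).
  by apply: cvgB; [exact: cvg_cst|apply: cvgM; [exact: cvg_cst|exact: cc]].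
have cim (t : R) : bim q (h * u) @[u --> t] --> bim q (h * t).
  by apply: cvgM; [exact: cvg_cst|exact: cs].
have cmod (t : R) : bmod q (h * u) @[u --> t] --> bmod q (h * t).
  by apply: cvgD; apply: cvgM; [exact: cre|exact: cre|exact: cim|exact: cim].
have cpow (t : R) : bmod q (h * u) `^ (- (be / 2)) @[u --> t] --> bmod q (h * t) `^ (- (be / 2)).
  apply: (cvg_cont_at (f := fun x => x `^ (- (be / 2))) _ (cmod t)).
  by apply: powR_contoo; apply: bmod_gt0 => //; exact: ltW.
have carg' (t : R) : be * barg q (h * u) @[u --> t] --> be * barg q (h * t).
  apply: cvgM; first exact: cvg_cst.
  apply: (cvg_cont (fun x => @continuous_atan R x)).
  apply: cvgM; first exact: cim.
  by apply: cvgV; [rewrite gt_eqF// bre_gt0// ltW|exact: cre].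
have bd u : bmod q (h * u) `^ (- (be / 2)) <= ((1 - q) ^+ 2) `^ (- (be / 2)).
  apply: powR_gtM; first by rewrite exprn_gt0// subr_gt0.
    by apply: bmod_ge => //; exact: ltW.
  by rewrite oppr_le0 divr_ge0// subr_ge0 ltW.
split; split.
- move=> t t0; apply: cvgM; first exact: cpow.
  exact: (cvg_cont (@continuous_cos R) (carg' t)).
- move=> T T0; exists (((1 - q) ^+ 2) `^ (- (be / 2))); first exact: powR_ge0.
  move=> t t0 tT; rewrite subrr powRr0 normrM (ger0_norm (powR_ge0 _ _)).
  by rewrite ler_pM ?powR_ge0 ?cos_max.
- move=> t t0; apply: cvgM; first exact: cpow.
  exact: (cvg_cont (@continuous_sin R) (carg' t)).
- move=> T T0; exists (((1 - q) ^+ 2) `^ (- (be / 2))); first exact: powR_ge0.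
  move=> t t0 tT; rewrite subrr powRr0 normrM (ger0_norm (powR_ge0 _ _)).
  by rewrite ler_pM ?powR_ge0 ?sin_max.
Qed.

Lemma qint_bker_ge0 (q h : R) a b T : 0 < q -> q < 1 ->
  sing 1 a -> sing 1 b -> 0 < T ->
  0 <= rint 0 T (qint (fun u => bkerc be q (h * u)) (fun u => bkers be q (h * u)) a b).
Proof.
move=> q0 q1 sa sb T0.
have be0 : 0 <= be by rewrite subr_ge0 ltW.
have be1 : be <= 1 by rewrite gerBl ltW.
pose kc N u := bsumc be (h * u) N q; pose ks N u := bsums be (h * u) N q.
pose d n := binc be n * q ^+ n.
have d0 n : 0 <= d n by rewrite mulr_ge0 ?binc_ge0 ?exprn_ge0// ltW.
have kcE N : kc N = fun u => \sum_(n < N.+1) d n * cos (n%:R * h * u).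
  by apply/funext => u; apply: eq_bigr => n _; rewrite mulrAC mulrA.
have ksE N : ks N = fun u => \sum_(n < N.+1) d n * sin (n%:R * h * u).
  by apply/funext => u; apply: eq_bigr => n _; rewrite mulrAC mulrA.
have sumd N : \sum_(n < N.+1) d n <= (1 - q)^-1.
  apply: (@le_trans _ _ (\sum_(n < N.+1) q ^+ n)).
    apply: ler_sum => n _; rewrite -[leRHS]mul1r ler_wpM2r ?binc_le1//.
    by rewrite exprn_ge0// ltW.
  rewrite -[leRHS]mul1r ler_pdivlMr ?subr_gt0// mulrC.
  by rewrite -opprB mulNr -subrX1 opprB gerBl exprn_ge0// ltW.
have tri (f : R -> R) N u : (forall x, `|f x| <= 1) ->
    `|\sum_(n < N.+1) d n * f (n%:R * h * u)| <= (1 - q)^-1.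
  move=> f1; apply: (le_trans (ler_norm_sum _ _ _)); apply: le_trans (sumd N).
  by apply: ler_sum => n _; rewrite normrM (ger0_norm (d0 n)) ler_piMr.
(* For fixed [q] the partial sums are bounded by 1 / (1 - q); on (0, T) the kernel is bounded below,
   so this constant has the form of majorant that [qint_cvg] asks for. *)
pose C := (1 - q)^-1 * T `^ (1 - al).
have domC u : 0 < u -> u < T -> (1 - q)^-1 <= C * ker al u.
  move=> u0 uT; rewrite /C /ker -mulrA -[leLHS]mulr1 ler_wpM2l ?invr_ge0 ?subr_ge0 ?(ltW q1)//.
  rewrite (_ : al - 1 = - (1 - al)); last by ring.
  rewrite powRN ler_pdivlMr ?powR_gt0// mul1r.
  by apply: ge0_ler_powR; rewrite ?nnegrE ?(ltW u0) ?(ltW T0) ?(ltW uT).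
have skc N : sing al (kc N).
  rewrite kcE; apply: sing1_al; apply: (sing_sum (b := 1)) => // i.
  by apply: singZ; exact: (sing_trig _ (@continuous_cos R) (@cos_max R)).
have sks N : sing al (ks N).
  rewrite ksE; apply: sing1_al; apply: (sing_sum (b := 1)) => // i.
  by apply: singZ; exact: (sing_trig _ (@continuous_sin R) (@sin_max R)).
have := @qint_cvg kc ks (fun u => bkerc be q (h * u)) (fun u => bkers be q (h * u)) C a b T.
move=> /(_ skc sks _ _ _ _ sa sb T0) hc.
have {hc}hc : rint 0 T (qint (kc n) (ks n) a b) @[n --> \oo] -->
   rint 0 T (qint (fun u => bkerc be q (h * u)) (fun u => bkers be q (h * u)) a b).
  apply: hc.
  - by move=> N u u0 uT; rewrite kcE (le_trans (tri _ _ _ (@cos_max R)))// domC.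
  - by move=> N u u0 uT; rewrite ksE (le_trans (tri _ _ _ (@sin_max R)))// domC.
  - by move=> u u0 uT; exact: (bsum_cvg (h * u) be0 be1 q0 q1).1.
  - by move=> u u0 uT; exact: (bsum_cvg (h * u) be0 be1 q0 q1).2.
apply: (closed_cvg (fun z : R => 0 <= z)) hc; first exact: closed_ge.
apply: nearW => N; rewrite kcE ksE.
exact: (@qint_sum_ge0 N.+1 d (fun n => n%:R * h)).
Qed.

Lemma derive_seq (f : R -> R) (df : R) (h : nat -> R) :
  is_derive (0 : R) 1 f df -> h n @[n --> \oo] --> 0 -> (forall n, h n != 0) ->
  (f (h n) - f 0) / h n @[n --> \oo] --> df.
Proof.
move=> [dfx <-] h0 hn0.
have hd : h n @[n --> \oo] --> (0 : R)^'.
  move=> P; rewrite /dnbhs /within/= => P0.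
  have h0' : \forall n \near \oo, h n != 0 -> P (h n) by exact: (h0 _ P0).
  suff: \forall n \near \oo, P (h n) by [].
  by apply: filterS h0' => n; apply; exact: hn0.
have := cvg_comp _ _ hd dfx.
rewrite /derive; apply: cvg_trans; apply: near_eq_cvg; apply: nearW => n /=.
by rewrite /GRing.scale/= mulr1 addr0 mulrC.
Qed.

Lemma sin_ge_half : exists2 e : R, 0 < e & forall x, 0 <= x -> x <= e -> x / 2 <= sin x.
Proof.
have hc : cos x @[x --> (0 : R)] --> cos 0 by exact: continuous_cos.
rewrite cos0 in hc.
have : \forall x \near (0 : R), 2^-1 < cos x.
  by apply: (cvgr_gt _ hc); lra.
move=> /nbhs_ballP[e /= e0 he]; exists (e / 2); first by rewrite divr_gt0.
move=> x x0 xe.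
have [|c /itvP cx] := @MVT_segment R (@sin R) (@cos R) 0 x x0.
  by apply: continuous_subspaceT; exact: continuous_sin.
rewrite sin0 !subr0 => ->; rewrite mulrC ler_wpM2r// ltW// he//.
rewrite /ball/= sub0r normrN ger0_norm ?cx//.
by rewrite (le_lt_trans (_ : _ <= x)) ?cx// (le_lt_trans xe)// ltr_pdivrMr// ltr_pMr// ltr1n.
Qed.

(* With [be = 1 - al] and [q = 1 - h ^ 2], the kernel [u ^ (al - 1) e^(i be pi / 2)] is
   the limit as [h -> 0] of [h ^ be (1 - q e^(i h u))^(- be)], a series of characters
   [e^(i n h u)] with nonnegative coefficients, each of which gives a square. *)
Lemma kernel_form_ge0 a b T : sing 1 a -> sing 1 b -> 0 < T ->
  0 <= rint 0 T (qint (fun u => cos (be * (pi / 2)) * ker al u)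
                      (fun u => sin (be * (pi / 2)) * ker al u) a b).
Proof.
move=> sa sb T0.
have be0 : 0 < be by rewrite subr_gt0.
have be1 : be <= 1 by rewrite gerBl ltW.
have [e e0 he] := sin_ge_half.
(* The bound 1/2 gives q >= 1/2; the bound e/T keeps h u in the range where sin x >= x/2 for every u
   < T. *)
pose h0 : R := Num.min 2^-1 (e / T).
have h00 : 0 < h0 by rewrite lt_min invr_gt0 ltr0n/= divr_gt0.
pose h (n : nat) : R := h0 / n.+1%:R.
have hp n : 0 < h n by rewrite divr_gt0.
have hh0 n : h n <= h0 by rewrite ler_pdivrMr// ler_pMr// ler1n.
have h2 n : h n <= 2^-1 by rewrite (le_trans (hh0 n))// ge_min lexx.
have hT n : h n * T <= e.
  by rewrite -ler_pdivlMr// (le_trans (hh0 n))// ge_min lexx orbT.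
have hcv : h n @[n --> \oo] --> (0 : R).
  rewrite -(mulr0 h0); apply: cvgM; first exact: cvg_cst.
  exact: cvg_harmonic.
pose q (n : nat) : R := 1 - (h n) ^+ 2.
have h4 n : h n ^+ 2 <= 2^-1.
  have := h2 n; have := hp n; rewrite expr2; move: (h n) => x *; nra.
have q0 n : 0 < q n by rewrite /q; have := h4 n; lra.
have q12 n : 2^-1 <= q n by rewrite /q; have := h4 n; lra.
have q1 n : q n < 1 by rewrite /q gtrBl exprn_gt0.
pose kc n u := h n `^ be * bkerc be (q n) (h n * u).
pose ks n u := h n `^ be * bkers be (q n) (h n * u).
have hbe n : h n `^ be = (h n ^+ 2) `^ (be / 2).
  by rewrite -powR_mulrn ?(ltW (hp n))// -powRrM mulrC divfK.
(* Thus 1 - z = h (X - i Y), with X tending to 0 and Y to u: after division by h, the limit is -i u,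
   whose power -be has modulus u^(al - 1) and argument be pi / 2. *)
pose X n u := bre (q n) (h n * u) / h n.
pose Y n u := bim (q n) (h n * u) / h n.
have mE n u : h n `^ be * bmod (q n) (h n * u) `^ (- (be / 2)) =
    (X n u ^+ 2 + Y n u ^+ 2) `^ (- (be / 2)).
  have -> : X n u ^+ 2 + Y n u ^+ 2 = bmod (q n) (h n * u) / h n ^+ 2.
    by rewrite /X /Y /bmod; field; rewrite gt_eqF.
  have m0 := bmod_gt0 (h n * u) (ltW (q0 n)) (q1 n).
  rewrite powRM ?invr_ge0 ?(ltW m0) ?sqr_ge0// hbe mulrC; congr (_ * _).
  by rewrite -[in RHS]powR_inv1 ?sqr_ge0// -powRrM mulN1r opprK.
have Yge n u : 0 < u -> u < T -> u / 4 <= Y n u.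
  move=> u0 uT.
  have hu : h n * u / 2 <= sin (h n * u).
    apply: he; first by rewrite mulr_ge0// ltW.
    by rewrite (le_trans _ (hT n))// ler_pM2l// ltW.
  rewrite /Y /bim ler_pdivlMr//.
  apply: (@le_trans _ _ (2^-1 * (h n * u / 2))); first by apply: eq_le_num; field.
  apply: ler_pM; [by rewrite invr_ge0| |exact: q12|exact: hu].
  by rewrite divr_ge0// mulr_ge0 ?(ltW u0) ?(ltW (hp n)).
have Xgt n u : 0 < X n u.
  by rewrite divr_gt0// bre_gt0// ltW.
(* From Y >= u/4, which combines q >= 1/2 and sin x >= x/2. *)
pose C := (4^-1 : R) `^ (- be).
have dom n u : 0 < u -> u < T ->
    (X n u ^+ 2 + Y n u ^+ 2) `^ (- (be / 2)) <= C * ker al u.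
  move=> u0 uT; have u4 : 0 < u / 4 by rewrite divr_gt0.
  apply: (@le_trans _ _ (((u / 4) ^+ 2) `^ (- (be / 2)))).
    apply: powR_gtM; [by rewrite exprn_gt0| |by rewrite oppr_le0 divr_ge0// ltW].
    rewrite -[leLHS]add0r lerD ?sqr_ge0// lerXn2r ?nnegrE ?Yge ?(ltW u4)//.
    by rewrite (le_trans (ltW u4))// Yge.
  rewrite -powR_mulrn ?(ltW u4)// -powRrM (_ : 2%:R * _ = - be); last by field.
  rewrite powRM ?(ltW u0)// /C /ker mulrC.
  by rewrite (_ : al - 1 = - be)// opprB.
have Xlim u : 0 < u -> X n u @[n --> \oo] --> (0 : R).
  move=> u0.
  have d : is_derive (0 : R) 1 (fun x => cos (x * u)) 0.
    have d1 := @is_deriveZ R R R id u (0 : R) 1 _ (is_derive_id _ _).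
    have d2 := @is_derive1_comp R (@cos R) (u \*: id) 0 _ _ (is_derive_cos _) d1.
    rewrite (_ : (fun x => _) = @cos R \o (u \*: id)).
      apply: (is_derive_eq d2); have -> : (u \*: id) (0 : R) = 0 by exact: mulr0.
      by rewrite sin0 oppr0 mul0r.
    by apply/funext => x; rewrite /= /GRing.scale/= mulrC.
  have l1 := derive_seq d hcv (fun n => lt0r_neq0 (hp n)).
  rewrite mul0r cos0 in l1.
  have -> : (fun n => X n u) = fun n => h n * cos (h n * u) - (cos (h n * u) - 1) / h n.
    by apply/funext => n; rewrite /X /bre /q; field; rewrite gt_eqF.
  have l2 : h n * cos (h n * u) - (cos (h n * u) - 1) / h n @[n --> \oo] --> 0 * cos (0 * u) - 0.
    apply: cvgB => //; apply: cvgM => //.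
    apply: (cvg_cont (@continuous_cos R)).
    by apply: cvgM => //; exact: cvg_cst.
  by rewrite mul0r subr0 in l2.
have Ylim u : 0 < u -> Y n u @[n --> \oo] --> u.
  move=> u0.
  have d : is_derive (0 : R) 1 (fun x => sin (x * u)) u.
    have d1 := @is_deriveZ R R R id u (0 : R) 1 _ (is_derive_id _ _).
    have d2 := @is_derive1_comp R (@sin R) (u \*: id) 0 _ _ (is_derive_sin _) d1.
    rewrite (_ : (fun x => _) = @sin R \o (u \*: id)).
      apply: (is_derive_eq d2); have -> : (u \*: id) (0 : R) = 0 by exact: mulr0.
      by rewrite cos0 mul1r; exact: mulr1.
    by apply/funext => x; rewrite /= /GRing.scale/= mulrC.
  have l1 := derive_seq d hcv (fun n => lt0r_neq0 (hp n)).
  rewrite mul0r sin0 in l1.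
  have -> : (fun n => Y n u) = fun n => q n * ((sin (h n * u) - 0) / h n).
    by apply/funext => n; rewrite /Y /bim subr0 mulrA.
  have l2 : q n * ((sin (h n * u) - 0) / h n) @[n --> \oo] --> (1 - 0 * 0) * u.
    apply: cvgM => //; apply: cvgB; first exact: cvg_cst.
    by apply: cvgM.
  by rewrite mulr0 subr0 mul1r in l2.
have Plim u : 0 < u -> (X n u ^+ 2 + Y n u ^+ 2) `^ (- (be / 2)) @[n --> \oo] --> ker al u.
  move=> u0.
  have l : X n u ^+ 2 + Y n u ^+ 2 @[n --> \oo] --> 0 * 0 + u * u.
    by apply: cvgD; apply: cvgM; [exact: Xlim|exact: Xlim|exact: Ylim|exact: Ylim].
  rewrite mul0r add0r in l.
  have -> : ker al u = (u * u) `^ (- (be / 2)).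
    rewrite -expr2 -powR_mulrn ?(ltW u0)// -powRrM (_ : 2%:R * _ = - be); last by field.
    by rewrite /ker (_ : al - 1 = - be)// opprB.
  apply: (cvg_cont_at (f := fun x => x `^ (- (be / 2))) _ l).
  by apply: powR_contoo; rewrite mulr_gt0.
have Alim u : 0 < u -> u < T -> be * barg (q n) (h n * u) @[n --> \oo] --> be * (pi / 2).
  move=> u0 uT; apply: cvgM; first exact: cvg_cst.
  have aE n : bim (q n) (h n * u) / bre (q n) (h n * u) = Y n u / X n u.
    by rewrite /X /Y; field; rewrite !gt_eqF// bre_gt0// ltW.
  apply: (@cvg_comp _ _ _ (fun n => bim (q n) (h n * u) / bre (q n) (h n * u)) (@atan R) _ (+oo%R)); last exact: cvgy_atan.
  apply/cvgryPge => A.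
  have [A0|A0] := leP A 0.
    apply: nearW => n; rewrite aE (le_trans A0)// divr_ge0 ?(ltW (Xgt n u))//.
    by rewrite (le_trans _ (Yge n u u0 uT))// divr_ge0// ltW.
  have e'0 : 0 < u / 4 / A by rewrite !divr_gt0.
  have [N _ hN] : \forall n \near \oo, X n u < u / 4 / A.
    by apply: (cvgr_lt _ (Xlim u u0)).
  exists N => // n /= /hN XA; rewrite aE ler_pdivlMr//.
  rewrite (le_trans _ (Yge n u u0 uT))//.
  by rewrite mulrC -ler_pdivlMr// ltW.
have skc n : sing al (kc n) by apply: sing1_al; apply: singZ; exact: (sing_bker _ (q0 n) (q1 n)).1.
have sks n : sing al (ks n) by apply: sing1_al; apply: singZ; exact: (sing_bker _ (q0 n) (q1 n)).2.
have := @qint_cvg kc ks (fun u => cos (be * (pi / 2)) * ker al u)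
                      (fun u => sin (be * (pi / 2)) * ker al u) C a b T.
move=> /(_ skc sks _ _ _ _ sa sb T0) hc.
have {hc}hc : rint 0 T (qint (kc n) (ks n) a b) @[n --> \oo] -->
   rint 0 T (qint (fun u => cos (be * (pi / 2)) * ker al u)
                      (fun u => sin (be * (pi / 2)) * ker al u) a b).
  apply: hc.
  - move=> n u u0 uT; rewrite /kc /bkerc mulrA mE normrM (ger0_norm (powR_ge0 _ _)).
    by rewrite (le_trans _ (dom n u u0 uT))// ler_piMr ?powR_ge0 ?cos_max.
  - move=> n u u0 uT; rewrite /ks /bkers mulrA mE normrM (ger0_norm (powR_ge0 _ _)).
    by rewrite (le_trans _ (dom n u u0 uT))// ler_piMr ?powR_ge0 ?sin_max.
  - move=> u u0 uT; under eq_fun do rewrite /kc /bkerc mulrA mE.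
    rewrite mulrC; apply: cvgM; first exact: Plim.
    by apply: (cvg_cont (@continuous_cos R)); exact: Alim.
  - move=> u u0 uT; under eq_fun do rewrite /ks /bkers mulrA mE.
    rewrite mulrC; apply: cvgM; first exact: Plim.
    by apply: (cvg_cont (@continuous_sin R)); exact: Alim.
apply: (closed_cvg (fun z : R => 0 <= z)) hc; first exact: closed_ge.
apply: nearW => n.
have [sc ss] := sing_bker (h n) (q0 n) (q1 n).
rewrite (qintZ _ (sing1_al sc) (sing1_al ss) sa sb T0).
by rewrite mulr_ge0 ?powR_ge0// qint_bker_ge0.
Qed.

End positivity.

(** * Square integral estimates for scalar and matrix Volterra equations *)

Section square_integral_estimates.
Context {R : realType}.
Variable al : R.
Hypotheses (al0 : 0 < al) (al1 : al < 1).
Implicit Types (t T : R).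
Local Notation k := (ker al).

Lemma sing1_conv (a : R -> R) : sing 1 a -> sing 1 (conv k a).
Proof. by move=> sa; apply: (sing_conv al0 (ltW al1)) => //; exact: sing_ker. Qed.

(** The rotation by (1 - al) pi / 2 exchanges sine and cosine of al pi / 2. The value -1 of [sg]
    comes from the conjugation b |-> -b and serves the other boundary ray of the sector. *)
Lemma kernel_form_sign (sg : R) (a b : R -> R) T : sg = 1 \/ sg = -1 ->
  sing 1 a -> sing 1 b -> 0 < T ->
  intble 0 T (fun t => sin (al * pi / 2) * (a t * conv k a t + b t * conv k b t) +
              sg * cos (al * pi / 2) * (b t * conv k a t - a t * conv k b t)) /\
  0 <= rint 0 T (fun t => sin (al * pi / 2) * (a t * conv k a t + b t * conv k b t) +
              sg * cos (al * pi / 2) * (b t * conv k a t - a t * conv k b t)).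
Proof.
move=> sg1 sa sb T0.
have ce : cos ((1 - al) * (pi / 2)) = sin (al * pi / 2).
  rewrite -cosBpihalf -cosN; congr cos; by field.
have se : sin ((1 - al) * (pi / 2)) = cos (al * pi / 2).
  rewrite -[RHS]opprK -sinBpihalf -sinN; congr sin; by field.
have sk c : sing al (fun u => c * k u) by apply: singZ; exact: sing_ker.
have key (y : R -> R) : sing 1 y ->
  let f := fun t => sin (al * pi / 2) * (a t * conv k a t + y t * conv k y t) +
              cos (al * pi / 2) * (y t * conv k a t - a t * conv k y t) in
  intble 0 T f /\ 0 <= rint 0 T f.
  move=> sy f.
  have q0 := kernel_form_ge0 al0 al1 sa sy T0.
  have qi := sing_intble ltr01 (sing_qint al0 al1 (sk _) (sk _) sa sy) T0.
  rewrite ce se in q0.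
  have e t : 0 < t -> t < T -> qint (fun u => sin (al * pi / 2) * k u)
     (fun u => cos (al * pi / 2) * k u) a y t = f t.
    move=> t0 tT; rewrite /qint /f !(convZl _ al0 (ltW al1) ltr01 (lexx _)) //; try exact: sing_ker.
    by ring.
  split; first exact: eq_intble e (qi _ _).
  by rewrite -(eq_rint (intble_measurable_oo (qi _ _)) e).
case: sg1 => ->.
  have [i p] := key b sb.
  by under eq_fun do rewrite mul1r; split.
have [i p] := key _ (sing1N sb).
have e t : 0 < t -> t < T ->
  sin (al * pi / 2) * (a t * conv k a t + - b t * conv k (fun t => - b t) t) +
              cos (al * pi / 2) * (- b t * conv k a t - a t * conv k (fun t => - b t) t) =
  sin (al * pi / 2) * (a t * conv k a t + b t * conv k b t) +
              -1 * cos (al * pi / 2) * (b t * conv k a t - a t * conv k b t).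
  move=> t0 tT.
  have -> : conv k (fun t => - b t) t = - conv k b t.
    under [X in conv k X]eq_fun do rewrite -mulN1r.
    by rewrite (convZr _ al0 (ltW al1) ltr01 (lexx _) (sing_ker _) sb t0) mulN1r.
  by ring.
split; first exact: eq_intble e i.
by rewrite -(eq_rint (intble_measurable_oo i) e).
Qed.

(** Complex equation y = g + l (k * y) with l = l1 + i l2, and v = k * y. Pairing y with v after
    rotation gives a nonnegative integral; the eigenvalue contributes -c |v|^2, where [c] is the
    distance of l to the line bounding the sector on its side, and completing the square bounds v by
    g with constant c^(-2). *)
Lemma scalar_square_estimate (l1 l2 : R) :
  sin (al * pi / 2) * l1 < cos (al * pi / 2) * `|l2| ->
  exists2 C : R, 0 <= C & forall (a b ga gb : R -> R) T,
    sing 1 a -> sing 1 b -> sing 1 ga -> sing 1 gb -> 0 < T ->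
    (forall t, 0 < t -> a t = ga t + l1 * conv k a t - l2 * conv k b t) ->
    (forall t, 0 < t -> b t = gb t + l2 * conv k a t + l1 * conv k b t) ->
    rint 0 T (fun t => conv k a t ^+ 2 + conv k b t ^+ 2) <=
    C * rint 0 T (fun t => ga t ^+ 2 + gb t ^+ 2).
Proof.
move=> hl; pose c := cos (al * pi / 2) * `|l2| - sin (al * pi / 2) * l1.
have c0 : 0 < c by rewrite subr_gt0.
(* The sign is chosen so that the coefficient of |v|^2 is exactly -c. *)
pose sg : R := if 0 <= l2 then -1 else 1.
have sgl : sg * l2 = - `|l2|.
  by rewrite /sg; case: (leP 0 l2) => h; rewrite ?(ger0_norm h) ?(ltr0_norm h); ring.
have sg1 : sg = 1 \/ sg = -1 by rewrite /sg; case: ifP; [right|left].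
have sgsq : sg ^+ 2 = 1 by case: sg1 => ->; ring.
exists (c^-1 ^+ 2); first exact: sqr_ge0.
move=> a b ga gb T sa sb sga sgb T0 ea eb.
have [qi q0] := kernel_form_sign sg1 sa sb T0.
have sva := sing1_conv sa; have svb := sing1_conv sb.
have sqr f : sing 1 f -> sing 1 (fun t : R => f t ^+ 2) by move=> sf; exact: sing1M.
have vi := sing_intble ltr01 (singD (sqr _ sva) (sqr _ svb)) T0.
have gi := sing_intble ltr01 (singD (sqr _ sga) (sqr _ sgb)) T0.
have le t : 0 < t -> t < T ->
  sin (al * pi / 2) * (a t * conv k a t + b t * conv k b t) +
     sg * cos (al * pi / 2) * (b t * conv k a t - a t * conv k b t) <=
  (2^-1 * c^-1) * (ga t ^+ 2 + gb t ^+ 2) - (2^-1 * c) * (conv k a t ^+ 2 + conv k b t ^+ 2).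
  move=> t0 tT; have := ea t t0; have := eb t t0.
  have cs : sin (al * pi / 2) ^+ 2 + cos (al * pi / 2) ^+ 2 = 1 by rewrite addrC cos2Dsin2.
  move: c0 sgl; rewrite /c.
  move: (conv k a t) (conv k b t) (a t) (b t) (ga t) (gb t) (sin (al * pi / 2)) (cos (al * pi / 2)) cs.
  move=> va vb a' b' x y s d cs c0' sgl' -> ->.
  set c' := d * `|l2| - s * l1 in c0' *.
  have cE : s * l1 + d * (sg * l2) = - c' by rewrite sgl' /c'; ring.
  have -> : s * ((x + l1 * va - l2 * vb) * va + (y + l2 * va + l1 * vb) * vb) +
     sg * d * ((y + l2 * va + l1 * vb) * va - (x + l1 * va - l2 * vb) * vb) =
     va * (s * x + sg * d * y) + vb * (s * y - sg * d * x) +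
     (s * l1 + d * (sg * l2)) * (va ^+ 2 + vb ^+ 2) by ring.
  rewrite cE.
  (* [X] and [Y] are the rotated parts of g; the rotation preserves the modulus, and the difference
     of the two sides becomes a sum of squares. *)
  set X := s * x + sg * d * y; set Y := s * y - sg * d * x.
  have XY : X ^+ 2 + Y ^+ 2 = x ^+ 2 + y ^+ 2.
    transitivity ((s ^+ 2 + sg ^+ 2 * d ^+ 2) * (x ^+ 2 + y ^+ 2)); first by rewrite /X /Y; ring.
    by rewrite sgsq mul1r cs mul1r.
  rewrite -XY -subr_ge0.
  have -> : 2^-1 * c'^-1 * (X ^+ 2 + Y ^+ 2) - 2^-1 * c' * (va ^+ 2 + vb ^+ 2) -
     (va * X + vb * Y + - c' * (va ^+ 2 + vb ^+ 2)) =
     2^-1 * c'^-1 * ((X - c' * va) ^+ 2 + (Y - c' * vb) ^+ 2).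
    by field; rewrite gt_eqF.
  by rewrite !mulr_ge0 ?invr_ge0 ?(ltW c0')// addr_ge0// sqr_ge0.
have := le_trans q0 (le_rint qi (intbleB (intbleZ _ gi) (intbleZ _ vi)) le).
rewrite rintB; [|exact: intbleZ..]; rewrite !rintZ// subr_ge0.
rewrite -!mulrA ler_pM2l ?invr_gt0// -ler_pdivlMl//.
Qed.

Section matrix_estimate.
Variable d : nat.
Implicit Types (A X Y : 'M[R]_d) (y g : R -> 'cV[R]_d).

Definition vsing b y := forall i : 'I_d, sing b (fun t => y t i ord0).
Definition vconv (f : R -> R) y t : 'cV[R]_d := \col_i conv f (fun s => y s i ord0) t.
Definition energy y T : R := rint 0 T (fun t => \sum_i (y t i ord0) ^+ 2).

Lemma vsing_mulmx X b y : 0 <= b -> b <= 1 -> vsing b y -> vsing b (fun t => X *m y t).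
Proof.
move=> b0 b1 sy i; under eq_fun do rewrite mxE.
by apply: sing_sum => // j; exact: singZ.
Qed.

Lemma vconv_mulmx a b (f : R -> R) y (M : 'M[R]_d) t : 0 < a -> a <= 1 -> 0 < b -> b <= 1 ->
  sing a f -> vsing b y -> 0 < t ->
  vconv f (fun s => M *m y s) t = M *m vconv f y t.
Proof.
move=> a0 a1 b0 b1 sf sy t0; apply/matrixP => i j; rewrite !mxE (ord1 j).
under [X in conv f X]eq_fun do rewrite mxE.
rewrite (conv_sumr _ a0 a1 b0 b1 sf _ t0); last by move=> l; exact: singZ.
apply: eq_bigr => l _; rewrite mxE.
by rewrite (convZr _ a0 a1 b0 b1 sf (sy l) t0).
Qed.

Lemma sing_sqr_sum y : vsing 1 y -> sing 1 (fun t => \sum_i (y t i ord0) ^+ 2).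
Proof. by move=> sy; apply: sing_sum => // i; exact: sing1M. Qed.

Lemma energy_ge0 y T : vsing 1 y -> 0 < T -> 0 <= energy y T.
Proof.
move=> sy T0; apply: rint_ge0; first exact: sing_intble ltr01 (sing_sqr_sum sy) T0.
by move=> t _ _; apply: sumr_ge0 => i _; exact: sqr_ge0.
Qed.

Lemma le_energy y (f : R -> R) T : vsing 1 y -> intble 0 T f -> 0 < T ->
  (forall t, 0 < t -> t < T -> \sum_i (y t i ord0) ^+ 2 <= f t) ->
  energy y T <= rint 0 T f.
Proof.
by move=> sy fi T0; apply: le_rint => //; exact: sing_intble ltr01 (sing_sqr_sum sy) T0.
Qed.

Lemma sqr_sum_le (n : nat) (x : 'I_n -> R) :
  (\sum_i x i) ^+ 2 <= 2 ^+ n * \sum_i x i ^+ 2.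
Proof.
elim: n x => [|n ih] x; first by rewrite !big_ord0 mulr0 expr0n.
rewrite !big_ord_recl [in leRHS]exprS.
have := ih (fun i => x (lift ord0 i)).
have : 1 <= (2 : R) ^+ n by rewrite exprn_ege1// ler1n.
have : 0 <= \sum_(i < n) x (lift ord0 i) ^+ 2 by apply: sumr_ge0 => i _; exact: sqr_ge0.
move: (2 ^+ n) (\sum_(i < n) x (lift ord0 i)) (\sum_(i < n) x (lift ord0 i) ^+ 2) (x ord0).
move=> p S Q z Q0 p1 h.
rewrite -subr_ge0.
have -> : 2 * p * (z ^+ 2 + Q) - (z + S) ^+ 2 =
    (z - S) ^+ 2 + 2 * ((p - 1) * z ^+ 2) + 2 * (p * Q - S ^+ 2) by ring.
have z0 := sqr_ge0 z; have zS := sqr_ge0 (z - S).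
apply: addr_ge0; last by rewrite mulr_ge0// subr_ge0.
by apply: addr_ge0 => //; rewrite mulr_ge0// mulr_ge0// subr_ge0.
Qed.

Lemma mulmx_sqr_le X : exists2 K : R, 0 <= K & forall u : 'cV[R]_d,
  \sum_i ((X *m u) i ord0) ^+ 2 <= K * \sum_i (u i ord0) ^+ 2.
Proof.
exists (2 ^+ d * \sum_i \sum_j X i j ^+ 2).
  rewrite mulr_ge0 ?exprn_ge0//; apply: sumr_ge0 => i _; apply: sumr_ge0 => j _.
  exact: sqr_ge0.
move=> u; rewrite -mulrA [X in _ <= _ * X]mulr_suml [leRHS]mulr_sumr.
apply: ler_sum => i _.
rewrite mxE (le_trans (sqr_sum_le _))// ler_wpM2l ?exprn_ge0//.
rewrite mulr_suml; apply: ler_sum => j _; rewrite exprMn ler_wpM2l ?sqr_ge0//.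
by rewrite (bigD1 j)//= lerDl sumr_ge0// => l _; exact: sqr_ge0.
Qed.

Lemma energy_mulmx X : exists2 K : R, 0 <= K & forall y T, vsing 1 y -> 0 < T ->
  energy (fun t => X *m y t) T <= K * energy y T.
Proof.
have [K K0 hK] := mulmx_sqr_le X; exists K => // y T sy T0.
have yi := sing_intble ltr01 (sing_sqr_sum sy) T0.
rewrite -rintZ//; apply: le_energy => //; first exact: vsing_mulmx.
exact: intbleZ.
Qed.

Lemma energyD y g T : vsing 1 y -> vsing 1 g -> 0 < T ->
  energy (fun t => y t + g t) T <= 2 * energy y T + 2 * energy g T.
Proof.
move=> sy sg T0.
have yi := sing_intble ltr01 (sing_sqr_sum sy) T0.
have gi := sing_intble ltr01 (sing_sqr_sum sg) T0.
rewrite -!rintZ// -rintD; [|exact: intbleZ..].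
apply: le_energy => //.
- by move=> i; under eq_fun do rewrite mxE; exact: singD.
- by apply: intbleD; exact: intbleZ.
move=> t t0 tT; rewrite !mulr_sumr -big_split/=; apply: ler_sum => i _; rewrite mxE.
have := sqr_ge0 (y t i ord0 - g t i ord0).
by move: (y t i ord0) (g t i ord0) => a b; nra.
Qed.

Definition volterra_sol A y g := vsing 1 y /\ vsing 1 g /\
  forall t, 0 < t -> y t = g t + A *m vconv k y t.

(* Estimates on [M (k * y)] for [M = X + i Y]. By Cayley-Hamilton the product of the factors
   [A - l] over the spectrum vanishes, and each factor can be removed at the cost of a
   scalar estimate, which ends with [M] the identity. *)
Definition l2bound A X Y := exists2 C : R, 0 <= C & forall y g T,
  volterra_sol A y g -> 0 < T ->
  energy (fun t => X *m vconv k y t) T + energy (fun t => Y *m vconv k y t) T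
    <= C * energy g T.

Lemma vsing_vconv y : vsing 1 y -> vsing 1 (vconv k y).
Proof. by move=> sy i; under eq_fun do rewrite mxE; exact: sing1_conv. Qed.

Lemma energyE y T : vsing 1 y -> 0 < T ->
  energy y T = \sum_i rint 0 T (fun t => (y t i ord0) ^+ 2).
Proof.
move=> sy T0; apply: (rint_sum (index_enum 'I_d) _).2 => i.
by apply: sing_intble ltr01 _ T0; exact: sing1M.
Qed.

(** Put M = X + i Y and M' = M (A - l). Then M y = M g + M' (k * y) + l (k * M y): each row is a
    scalar equation with coefficient l, whose forcing is controlled by the assumed bound for M'. *)
Lemma l2bound_step A X Y (l1 l2 : R) :
  sin (al * pi / 2) * l1 < cos (al * pi / 2) * `|l2| ->
  l2bound A (X *m A - l1 *: X + l2 *: Y) (Y *m A - l2 *: X - l1 *: Y) ->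
  l2bound A X Y.
Proof.
move=> /scalar_square_estimate[C C0 hC] [D D0 hD].
set X' := X *m A - l1 *: X + l2 *: Y in hD.
set Y' := Y *m A - l2 *: X - l1 *: Y in hD.
have [KX KX0 hX] := energy_mulmx X; have [KY KY0 hY] := energy_mulmx Y.
exists (C * (2 * (KX + KY) + 2 * D)).
  by rewrite mulr_ge0// addr_ge0 ?mulr_ge0 ?addr_ge0.
move=> y g T sol T0; have [sy [sg e]] := sol.
have sv := vsing_vconv sy.
have sm Z z : vsing 1 z -> vsing 1 (fun t => Z *m z t) by exact: vsing_mulmx.
have sa z1 z2 : vsing 1 z1 -> vsing 1 z2 -> vsing 1 (fun t => z1 t + z2 t).
  by move=> s1 s2 i; under eq_fun do rewrite mxE; exact: singD.
pose ga t := X *m g t + X' *m vconv k y t.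
pose gb t := Y *m g t + Y' *m vconv k y t.
have sga : vsing 1 ga by apply: sa; exact: sm.
have sgb : vsing 1 gb by apply: sa; exact: sm.
have cX i t : 0 < t -> conv k (fun s => (X *m y s) i ord0) t = (X *m vconv k y t) i ord0.
  by move=> t0; rewrite -(vconv_mulmx X al0 (ltW al1) ltr01 (lexx _) (sing_ker al) sy t0) mxE.
have cY i t : 0 < t -> conv k (fun s => (Y *m y s) i ord0) t = (Y *m vconv k y t) i ord0.
  by move=> t0; rewrite -(vconv_mulmx Y al0 (ltW al1) ltr01 (lexx _) (sing_ker al) sy t0) mxE.
have step i : rint 0 T (fun t => ((X *m vconv k y t) i ord0) ^+ 2) +
    rint 0 T (fun t => ((Y *m vconv k y t) i ord0) ^+ 2) <=
    C * (rint 0 T (fun t => (ga t i ord0) ^+ 2) + rint 0 T (fun t => (gb t i ord0) ^+ 2)).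
  have int1 z : vsing 1 z -> intble 0 T (fun t => (z t i ord0) ^+ 2).
    by move=> sz; apply: sing_intble ltr01 _ T0; apply: sing1M; exact: sz.
  rewrite -!rintD; [|by apply: int1; do ?exact: sm..].
  have := hC (fun t => (X *m y t) i ord0) (fun t => (Y *m y t) i ord0)
    (fun t => ga t i ord0) (fun t => gb t i ord0) T (sm _ _ sy i) (sm _ _ sy i) (sga i) (sgb i) T0.
  have -> : rint 0 T (fun t => conv k (fun s => (X *m y s) i ord0) t ^+ 2 +
      conv k (fun s => (Y *m y s) i ord0) t ^+ 2) =
     rint 0 T (fun t => ((X *m vconv k y t) i ord0) ^+ 2 + ((Y *m vconv k y t) i ord0) ^+ 2).
    apply/esym; apply: eq_rint.
      by apply: intble_measurable_oo; apply: intbleD; apply: int1; exact: sm.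
    by move=> t t0 tT; rewrite cX// cY.
  apply => t t0; rewrite (e t t0) cX// cY// /ga /gb /X' /Y' !mulmxDr !mulmxDl !mulNmx !mulmxA
     -!scalemxAl !mxE; ring.
rewrite (energyE (sm X _ sv) T0) (energyE (sm Y _ sv) T0).
rewrite -big_split/=.
apply: (@le_trans _ _ (\sum_i C * (rint 0 T (fun t => (ga t i ord0) ^+ 2) +
   rint 0 T (fun t => (gb t i ord0) ^+ 2)))).
  by apply: ler_sum => i _; exact: step.
rewrite -mulr_sumr big_split/= -(energyE sga T0) -(energyE sgb T0) -mulrA ler_wpM2l//.
have h1 := energyD (sm X _ sg) (sm X' _ sv) T0.
have h2 := energyD (sm Y _ sg) (sm Y' _ sv) T0.
have h3 := hX g T sg T0; have h4 := hY g T sg T0; have h5 := hD y g T sol T0.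
apply: (le_trans (lerD h1 h2)).
move: h3 h4 h5; rewrite /ga.
move: (energy (fun t => X *m g t) T) (energy (fun t => Y *m g t) T)
  (energy (fun t => X' *m vconv k y t) T) (energy (fun t => Y' *m vconv k y t) T) (energy g T).
by clear; move=> x1 x2 x3 x4 x5 *; lra.
Qed.

Lemma l2bound0 A : l2bound A 0 0.
Proof.
exists 0 => // y g T [sy [sg e]] T0.
have z : energy (fun t => 0 *m vconv k y t) T = 0.
  rewrite /energy; transitivity (rint 0 T (fun=> 0)).
    congr rint; apply/funext => t; apply: big1 => i _.
    by rewrite mul0mx mxE expr0n.
  by rewrite rint_cst ?mul0r// ltW.
by rewrite z addr0 mul0r.
Qed.

Local Notation C := (complex.complex R).
Local Notation toC := (fun r : R => complex.Complex r 0).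

Definition in_sector (l : C) :=
  sin (al * pi / 2) * complex.Re l < cos (al * pi / 2) * `|complex.Im l|.

Lemma l2bound_prod A (r : seq C) (M : 'M[C]_d) :
  (forall l, l \in r -> in_sector l) ->
  l2bound A (map_mx (@complex.Re R) (foldl (fun N l => N *m (map_mx toC A - l%:M)) M r))
    (map_mx (@complex.Im R) (foldl (fun N l => N *m (map_mx toC A - l%:M)) M r)) ->
  l2bound A (map_mx (@complex.Re R) M) (map_mx (@complex.Im R) M).
Proof.
elim: r M => [//|l r ih] M hr /=.
have hr' l' : l' \in r -> in_sector l' by move=> h; apply: hr; rewrite inE h orbT.
move=> /(ih _ hr') h.
have hl : in_sector l by apply: hr; rewrite mem_head.
apply: (l2bound_step hl).
have reS (f : 'I_d -> C) : complex.Re (\sum_i f i) = \sum_i complex.Re (f i).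
  by apply: (big_morph (@complex.Re R)) => // -[? ?] [? ?].
have imS (f : 'I_d -> C) : complex.Im (\sum_i f i) = \sum_i complex.Im (f i).
  by apply: (big_morph (@complex.Im R)) => // -[? ?] [? ?].
have reB (x y : C) : complex.Re (x - y) = complex.Re x - complex.Re y by case: x; case: y.
have imB (x y : C) : complex.Im (x - y) = complex.Im x - complex.Im y by case: x; case: y.
have reM (x y : C) : complex.Re (x * y) =
    complex.Re x * complex.Re y - complex.Im x * complex.Im y by case: x; case: y.
have imM (x y : C) : complex.Im (x * y) =
    complex.Re x * complex.Im y + complex.Im x * complex.Re y by case: x; case: y.
have -> : map_mx (@complex.Re R) M *m A - complex.Re l *: map_mx (@complex.Re R) M +
   complex.Im l *: map_mx (@complex.Im R) M =
   map_mx (@complex.Re R) (M *m (map_mx toC A - l%:M)).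
  apply/matrixP => i j; rewrite mulmxBr mul_mx_scalar !mxE reB reS reM.
  rewrite (eq_bigr (fun m => complex.Re (M i m * (map_mx toC A) m j))); last first.
    by move=> m _; rewrite reM !mxE/= mulr0 subr0.
  by ring.
have -> : map_mx (@complex.Im R) M *m A - complex.Im l *: map_mx (@complex.Re R) M -
   complex.Re l *: map_mx (@complex.Im R) M =
   map_mx (@complex.Im R) (M *m (map_mx toC A - l%:M)).
  apply/matrixP => i j; rewrite mulmxBr mul_mx_scalar !mxE imB imS imM.
  rewrite (eq_bigr (fun m => complex.Im (M i m * (map_mx toC A) m j))); last first.
    by move=> m _; rewrite imM !mxE/= mulr0 add0r.
  by ring.
exact: h.
Qed.

End matrix_estimate.

(** The characteristic polynomial splits over the complex numbers; the product of all factors A - l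
    is zero, where the bound is trivial, and [l2bound_prod] leads back to the identity matrix. *)
Lemma energy_estimate (d : nat) (A : 'M[R]_d) :
  (forall l, eigenvalue (map_mx (fun r : R => complex.Complex r 0) A) l -> in_sector l) ->
  exists2 K : R, 0 <= K & forall y g T, volterra_sol A y g -> 0 < T ->
    energy y T <= K * energy g T.
Proof.
(* Size zero is treated apart: Cayley-Hamilton is applied in the ring of matrices of positive
   size. *)
case: d A => [|d] A sec.
  exists 0 => // y g T [sy [sg e]] T0.
  have z : energy y T = 0.
    rewrite /energy; transitivity (rint 0 T (fun=> 0)).
      by congr rint; apply/funext => t; rewrite big_ord0.
    by rewrite rint_cst ?mul0r// ltW.
  by rewrite z mul0r.
pose AC := map_mx (fun r : R => complex.Complex r 0) A.
have [r hr] := closed_field_poly_normal (char_poly AC).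
rewrite (monicP (char_poly_monic AC)) scale1r in hr.
have sr l : l \in r -> in_sector l.
  move=> lr; apply: sec; rewrite eigenvalue_root_char hr.
  by rewrite root_prod_XsubC.
have fold0 : foldl (fun N l => N *m (AC - l%:M)) 1%:M r = 0.
  have := Cayley_Hamilton AC; rewrite hr rmorph_prod/= => e.
  rewrite -e.
  have h (N : 'M[complex.complex R]_d.+1) : foldl (fun N l => N *m (AC - l%:M)) N r =
     N * (\prod_(i <- r) horner_mx AC ('X - polyC i)).
    elim: (r) N => [|l r' ih] N /=; first by rewrite big_nil mulr1.
    by rewrite ih big_cons mulrA rmorphB/= horner_mx_X horner_mx_C.
  by rewrite h mul1r.
have := @l2bound_prod d.+1 A r 1%:M sr.
rewrite fold0.
have -> : map_mx (@complex.Re R) (0 : 'M[complex.complex R]_d.+1) = 0.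
  by apply/matrixP => i j; rewrite !mxE.
have -> : map_mx (@complex.Im R) (0 : 'M[complex.complex R]_d.+1) = 0.
  by apply/matrixP => i j; rewrite !mxE.
have -> : map_mx (@complex.Re R) (1%:M : 'M[complex.complex R]_d.+1) = 1%:M.
  by apply/matrixP => i j; rewrite !mxE; case: (i == j).
have -> : map_mx (@complex.Im R) (1%:M : 'M[complex.complex R]_d.+1) = 0.
  by apply/matrixP => i j; rewrite !mxE; case: (i == j).
move=> /(_ (l2bound0 A))[C C0 hC].
(* The bound so far concerns k * y; the equation y = g + A (k * y) passes it on to y. *)
have [K K0 hK] := energy_mulmx A.
exists (2 + 2 * (K * C)); first by rewrite addr_ge0 ?mulr_ge0.
move=> y g T sol T0; have [sy [sg e]] := sol.
have sv := vsing_vconv sy.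
have e1 : energy y T = energy (fun t => g t + A *m vconv (ker al) y t) T.
  rewrite /energy; apply: eq_rint.
    by apply: intble_measurable_oo; exact: sing_intble ltr01 (sing_sqr_sum sy) T0.
  by move=> t t0 tT; rewrite -e.
have h1 := energyD sg (vsing_mulmx A ler01 (lexx _) sv) T0.
have h2 := hK _ T sv T0.
have h3 : energy (vconv (ker al) y) T <= C * energy g T.
  have := hC y g T sol T0; apply: le_trans.
  rewrite (_ : energy (fun t => 1%:M *m vconv (ker al) y t) T = energy (vconv (ker al) y) T).
    rewrite lerDl; apply: energy_ge0 => //.
    exact: (vsing_mulmx _ ler01 (lexx _) sv).
  by rewrite /energy; congr rint; apply/funext => t; rewrite mul1mx.
rewrite e1; apply: (le_trans h1).
have h4 := le_trans h2 (ler_wpM2l K0 h3).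
move: h4; move: (energy _ T) (energy g T) => x z h4.
rewrite [leRHS]mulrDl lerD2l -[leRHS]mulrA ler_wpM2l//.
by rewrite -mulrA.
Qed.

End square_integral_estimates.

(** * Column-valued functions and global solutions by Picard iteration *)

Section vector_functions.
Context {R : realType} {d : nat}.
Implicit Types (x u v : 'cV[R]_d) (y g : R -> 'cV[R]_d) (t T : R).

Lemma mx_entry_le x i : `|x i ord0| <= `|x|.
Proof.
rewrite {2}/Num.norm/= mx_normrE.
exact: (le_bigmax 0 (fun ij : 'I_d * 'I_1 => `|x ij.1 ij.2|) (i, ord0)).
Qed.

Lemma mx_norm_le x (c : R) : 0 <= c -> (forall i, `|x i ord0| <= c) -> `|x| <= c.
Proof.
move=> c0 h; rewrite {1}/Num.norm/= mx_normrE; apply: bigmax_le => // -[i j] _ /=.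
by rewrite (ord1 j).
Qed.

Lemma cvg_vec (U : Type) (F : set_system U) {FF : Filter F} (y : U -> 'cV[R]_d) x :
  (forall i, y u i ord0 @[u --> F] --> x i ord0) -> y u @[u --> F] --> x.
Proof.
move=> h; apply/cvgrPdist_le => e e0.
have h' (i : 'I_d) : \forall u \near F, `|x i ord0 - y u i ord0| <= e.
  by have /cvgrPdist_le := h i; apply.
have := filter_forall FF h'; apply: filterS => u hu.
by apply: mx_norm_le; [exact: ltW|move=> i; rewrite !mxE; exact: hu].
Qed.

Lemma cvg_entry (U : Type) (F : set_system U) {FF : Filter F} (y : U -> 'cV[R]_d) x i :
  y u @[u --> F] --> x -> y u i ord0 @[u --> F] --> x i ord0.
Proof.
move=> h; apply/cvgrPdist_le => e e0.
have /cvgrPdist_le/(_ e e0) := h; apply: filterS => u; apply: le_trans.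
by have := mx_entry_le (x - y u) i; rewrite !mxE.
Qed.

Lemma vsing_cont b y t : vsing b y -> 0 < t -> {for t, continuous y}.
Proof. by move=> sy t0; apply: cvg_vec => i; exact: (sy i).1. Qed.

Lemma vsing_norm b y : vsing b y -> forall T, 0 < T ->
  exists2 C : R, 0 <= C & forall t, 0 < t -> t <= T -> `|y t| <= C * t `^ (b - 1).
Proof.
move=> sy T T0.
have /choice[C hC] : forall i, exists C : R, 0 <= C /\
    forall t, 0 < t -> t <= T -> `|y t i ord0| <= C * t `^ (b - 1).
  by move=> i; have [C C0 hC] := (sy i).2 T T0; exists C.
exists (\sum_i C i); first by apply: sumr_ge0 => i _; exact: (hC i).1.
have C0 : 0 <= \sum_i C i by apply: sumr_ge0 => i _; exact: (hC i).1.
move=> t t0 tT; apply: mx_norm_le; first by rewrite mulr_ge0 ?powR_ge0.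
move=> i; apply: (le_trans ((hC i).2 t t0 tT)); rewrite ler_wpM2r ?powR_ge0//.
by rewrite (bigD1 i)//= lerDl sumr_ge0// => j _; exact: (hC j).1.
Qed.

Lemma vsing_of_norm b y : (forall t, 0 < t -> {for t, continuous y}) ->
  (forall T, 0 < T -> exists2 C : R, 0 <= C &
     forall t, 0 < t -> t <= T -> `|y t| <= C * t `^ (b - 1)) -> vsing b y.
Proof.
move=> cy by_ i; split; first by move=> t t0; apply: cvg_entry; exact: cy.
move=> T /by_[C C0 hC]; exists C => // t t0 tT.
exact: le_trans (mx_entry_le _ _) (hC t t0 tT).
Qed.

Definition lipschitz_map (F : 'cV[R]_d -> 'cV[R]_d) (L : R) :=
  forall u v, `|F u - F v| <= L * `|u - v|.

Lemma lipschitz_cvg (U : Type) (H : set_system U) {FH : Filter H} F L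
    (y : U -> 'cV[R]_d) x : 0 <= L -> lipschitz_map F L ->
  y u @[u --> H] --> x -> F (y u) @[u --> H] --> F x.
Proof.
move=> L0 hF yx; apply/cvgrPdist_le => e e0.
have e1 : 0 < e / (L + 1) by rewrite divr_gt0// ltr_wpDl.
have /cvgrPdist_le/(_ _ e1) := yx.
apply: filterS => v h; apply: (le_trans (hF _ _)).
apply: (@le_trans _ _ ((L + 1) * `|x - y v|)); first by rewrite ler_wpM2r// lerDl.
by rewrite mulrC -ler_pdivlMr// ltr_wpDl.
Qed.

Lemma vsing_comp F L b y : 0 <= L -> lipschitz_map F L -> F 0 = 0 ->
  vsing b y -> vsing b (fun t => F (y t)).
Proof.
move=> L0 hF F0 sy; apply: vsing_of_norm.
  by move=> t t0; apply: (lipschitz_cvg L0 hF); exact: (vsing_cont sy).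
move=> T /(vsing_norm sy)[C C0 hC]; exists (L * C); first exact: mulr_ge0.
move=> t t0 tT; have := hF (y t) 0; rewrite F0 !subr0 => /le_trans; apply.
by rewrite -mulrA ler_wpM2l// hC.
Qed.

Lemma vsingD b y g : vsing b y -> vsing b g -> vsing b (fun t => y t + g t).
Proof. by move=> sy sg i; under eq_fun do rewrite mxE; exact: singD. Qed.

Lemma vsing_conv a b f y : 0 < a -> a <= 1 -> 0 < b -> b <= 1 ->
  sing a f -> vsing b y -> vsing b (vconv f y).
Proof.
move=> a0 a1 b0 b1 sf sy i; under eq_fun do rewrite mxE.
by apply: (sing_conv a0 a1 b0 b1 sf); exact: sy.
Qed.

(** In the sup norm weighted by [wgt b m] the map is a contraction of ratio 1/2 on the whole
    half-line once [m] is large, so the solution is global at once. Order b < 1 serves the singular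
    resolvent, b = 1 the nonlinear equation. *)
Lemma picard (a b L C0 : R) F g : 0 < a -> a <= 1 -> 0 < b -> b <= 1 ->
  0 <= L -> lipschitz_map F L -> F 0 = 0 ->
  (forall i, contp (fun t => g t i ord0)) ->
  (forall t, 0 < t -> `|g t| <= C0 * t `^ (b - 1)) ->
  exists y, vsing b y /\
    forall t, 0 < t -> y t = g t + vconv (ker a) (fun s => F (y s)) t.
Proof.
move=> a0 a1 b0 b1 L0 hF F0 cg bg.
have C00 : 0 <= C0.
  have := le_trans (normr_ge0 _) (bg 1 ltr01).
  by rewrite powR1 mulr1.
have c0 : 0 < a / 2 by rewrite divr_gt0.
pose B2 := beta_bound (a / 2) b.
have B20 : 0 <= B2 by exact: beta_bound_ge0.
(* The weight parameter [m] is defined by m^(-a/2) = 1/z, and L B2 / z <= 1/2; the added 1 keeps [z]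
   positive when L B2 vanishes. *)
pose z := 2 * (L * B2) + 1.
have z0 : 0 < z by rewrite ltr_wpDl// !mulr_ge0.
pose m := z `^ (2 / a).
have m0 : 0 < m by rewrite powR_gt0.
have mE : m `^ (- (a / 2)) = z^-1.
  rewrite powRN /m -powRrM (_ : 2 / a * (a / 2) = 1) ?powRr1 ?(ltW z0)//.
  by field; rewrite gt_eqF.
pose w := wgt b m.
have w0 t : 0 <= w t by exact: wgt_ge0.
have sw : sing b w by apply: sing_wgt; exact: ltW.
have kw t : 0 < t -> L * conv (ker a) w t <= 2^-1 * w t.
  move=> t0; have h := conv_wgt a0 a1 b0 b1 m0 t0.
  apply: (le_trans (ler_wpM2l L0 h)); rewrite mE mulrA ler_wpM2r//.
  rewrite mulrCA ler_pdivrMl// /z mulrDl mul1r -/B2.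
  rewrite (_ : 2 * (L * B2) / 2 = L * B2); last by field.
  by rewrite lerDl invr_ge0.
have gw t : 0 < t -> `|g t| <= C0 * w t.
  move=> t0; apply: (le_trans (bg t t0)); rewrite ler_wpM2l// /w /wgt ler_peMr ?powR_ge0//.
  by rewrite -expR0 ler_expR mulr_ge0 ?sqr_ge0 ?(ltW m0).
have sg : vsing b g.
  apply: vsing_of_norm; first by move=> t t0; apply: cvg_vec => i; exact: cg.
  by move=> T T0; exists C0 => // t t0 _; exact: bg.
pose Phi y t : 'cV[R]_d := g t + vconv (ker a) (fun s => F (y s)) t.
pose it n := iter n Phi g.
have sPhi y : vsing b y -> vsing b (Phi y).
  by move=> sy; apply: vsingD => //; apply: (vsing_conv a0 a1 b0 b1 (sing_ker a)); exact: vsing_comp hF F0 sy.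
have sit n : vsing b (it n) by elim: n => [//|n ih]; exact: sPhi.
have cdiff y1 y2 (M : R) t : 0 <= M -> vsing b y1 -> vsing b y2 ->
    (forall s : R, 0 < s -> `|y1 s - y2 s| <= M * w s) -> 0 < t ->
    `|vconv (ker a) (fun s => F (y1 s)) t - vconv (ker a) (fun s => F (y2 s)) t| <= M / 2 * w t.
  move=> M0 s1 s2 h t0; apply: mx_norm_le; first by rewrite mulr_ge0// divr_ge0.
  move=> i; rewrite !mxE.
  have sF1 := vsing_comp L0 hF F0 s1; have sF2 := vsing_comp L0 hF F0 s2.
  have i1 := conv_intble a0 a1 b0 b1 (sing_ker a) (sF1 i) t0.
  have i2 := conv_intble a0 a1 b0 b1 (sing_ker a) (sF2 i) t0.
  have i3 := conv_intble a0 a1 b0 b1 (sing_ker a) sw t0.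
  rewrite /conv -rintB//.
  apply: (@le_trans _ _ (rint 0 t (fun s => M * L * (ker a (t - s) * w s)))).
    apply: norm_rint_le; first exact: intble_measurable_oo (intbleB i1 i2).
      exact: intbleZ.
    move=> s s0 st; rewrite -mulrBr normrM (ger0_norm (powR_ge0 _ _)).
    rewrite (_ : M * L * _ = ker a (t - s) * (L * (M * w s))); last by ring.
    rewrite ler_wpM2l ?powR_ge0//.
    have := mx_entry_le (F (y1 s) - F (y2 s)) i; rewrite !mxE => /le_trans; apply.
    by apply: (le_trans (hF _ _)); rewrite ler_wpM2l// h.
  rewrite rintZ// -mulrA -[leRHS]mulrA ler_wpM2l//.
  exact: kw.
have F0conv t : 0 < t -> vconv (ker a) (fun=> F 0) t = 0.
  move=> t0; apply/matrixP => i j; rewrite !mxE F0 /conv.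
  under [X in rint _ _ X]eq_fun do rewrite mxE mulr0.
  by rewrite rint_cst ?mul0r ?(ltW t0).
have sing0 : vsing b (fun=> 0 : 'cV[R]_d).
  move=> i; apply: (@eq_sing _ b (fun=> 0)); first by move=> t _; rewrite mxE.
  by apply: sing_mono b1 _; exact: sing_cst.
have itd n t : 0 < t -> `|it n.+1 t - it n t| <= C0 * w t / 2 ^+ n.+1.
  elim: n t => [|n ih] t t0.
    rewrite /it/= /Phi addrC addKr.
    have := cdiff g (fun=> 0) C0 t C00 sg sing0.
    rewrite (F0conv t t0) subr0 => /(_ _ t0) h.
    rewrite expr1 mulrAC; apply: h => s s0; rewrite subr0; exact: gw.
  rewrite [it n.+2]/it [it n.+1 in X in _ - X]/it/= /Phi.
  rewrite -/(it n.+1) -/(it n) opprD addrACA subrr add0r.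
  have h := cdiff (it n.+1) (it n) (C0 / 2 ^+ n.+1) t _ (sit n.+1) (sit n) _ t0.
  rewrite [2 ^+ n.+2]exprSr invfM.
  rewrite (_ : C0 * w t * _ = C0 / 2 ^+ n.+1 / 2 * w t); last first.
    by move: ((2 ^+ n.+1)^-1) => p; ring.
  apply: h; first by rewrite divr_ge0// exprn_ge0.
  by move=> s s0; rewrite mulrAC; exact: ih.
have lim t : exists v, 0 < t -> forall n, `|v - it n t| <= C0 * w t / 2 ^+ n.
  have [t0|t0] := ltP 0 t; last by exists 0.
  have /choice[l hl] : forall i, exists l : R, forall n,
      `|l - it n t i ord0| <= C0 * w t / 2 ^+ n.
    move=> i; apply: geometric_cvg => n.
    have := mx_entry_le (it n.+1 t - it n t) i; rewrite !mxE => /le_trans; apply.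
    exact: itd.
  exists (\col_i l i) => _ n; apply: mx_norm_le.
    by rewrite divr_ge0 ?(mulr_ge0 C00 (w0 t)) ?exprn_ge0.
  by move=> i; rewrite !mxE; exact: hl.
have /choice[y hy] := lim.
(* The limit was taken pointwise, but near [t] the weight stays below w t + 1, so convergence is
   uniform there and continuity survives. *)
have cy t : 0 < t -> {for t, continuous y}.
  move=> t0; apply/cvgrPdist_le => e e0.
  have e3 : 0 < e / 3 by rewrite divr_gt0.
  have [n hn] := half_pow_small (C0 * (w t + 1)) e3.
  have hw : \forall x \near t, w x <= w t + 1.
    have := sw.1 t t0 => /cvgrPdist_le/(_ 1 ltr01); apply: filterS => x.
    by rewrite distrC ler_norml => /andP[_]; rewrite lerBlDl addrC.
  have hc : \forall x \near t, `|it n t - it n x| <= e / 3.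
    by have := vsing_cont (sit n) t0 => /cvgrPdist_le; apply.
  have hp : \forall x \near t, 0 < x by exact: lt_nbhsr.
  have q0 : 0 <= (2 ^+ n)^-1 :> R by rewrite invr_ge0 exprn_ge0.
  near=> x.
  have x0 : 0 < x by near: x.
  have wx : w x <= w t + 1 by near: x.
  have cx : `|it n t - it n x| <= e / 3 by near: x.
  have h1 := hy t t0 n; have h2 := hy x x0 n.
  have b1' : C0 * w t / 2 ^+ n <= e / 3.
    apply: le_trans (ltW hn); rewrite ler_wpM2r// ler_wpM2l// lerDl//.
  have b2' : C0 * w x / 2 ^+ n <= e / 3.
    by apply: le_trans (ltW hn); rewrite ler_wpM2r// ler_wpM2l.
  rewrite (_ : y t - y x = (y t - it n t) + (it n t - it n x) + (it n x - y x)); last first.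
    by rewrite !addrA !subrK.
  apply: (le_trans (ler_normD _ _)).
  rewrite (_ : e = e / 3 + e / 3 + e / 3); last by field.
  apply: lerD; last by rewrite distrC (le_trans h2).
  by apply: (le_trans (ler_normD _ _)); apply: lerD => //; exact: le_trans h1 b1'.
have sy : vsing b y.
  apply: vsing_of_norm => // T T0; have [W W0 hW] := sw.2 T T0.
  exists (2 * C0 * W); first by rewrite !mulr_ge0.
  move=> t t0 tT; have := hy t t0 0%N; rewrite expr0 divr1 => h.
  rewrite -(subrK (g t) (y t)).
  apply: (le_trans (ler_normD _ _)); apply: (le_trans (lerD h (gw t t0))).
  rewrite (_ : C0 * w t + C0 * w t = 2 * C0 * w t); last by ring.
  rewrite -[leRHS]mulrA ler_wpM2l ?mulr_ge0//.
  by have := hW t t0 tT; rewrite ger0_norm.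
exists y; split=> // t t0.
apply/eqP; rewrite -subr_eq0 -normr_le0; apply/ler_addgt0Pr => e e0; rewrite add0r.
have [n hn] := half_pow_small (C0 * w t) e0.
apply: le_trans (ltW hn).
rewrite (_ : y t - _ = (y t - it n.+1 t) +
   (vconv (ker a) (fun s => F (it n s)) t - vconv (ker a) (fun s => F (y s)) t)); last first.
  rewrite [it n.+1]/it/= /Phi -/(it n) !opprD !addrA; congr (_ - _).
  by rewrite subrK.
have h1 := hy t t0 n.+1.
have h2 := cdiff (it n) y (C0 / 2 ^+ n) t _ (sit n) sy _ t0.
apply: (le_trans (ler_normD _ _)).
apply: (@le_trans _ _ (C0 * w t / 2 ^+ n.+1 + C0 / 2 ^+ n / 2 * w t)).
  apply: lerD => //; apply: h2; first by rewrite divr_ge0// exprn_ge0.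
  by move=> s s0; rewrite distrC mulrAC; exact: hy.
apply: eq_le_num; rewrite exprSr invfM; move: ((2 ^+ n)^-1) => p; by field.
Unshelve. all: by end_near. Qed.

End vector_functions.

(** * Commutation rules for convolution, and the profile that cancels a constant forcing *)

Section convolution_identities.
Context {R : realType}.
Implicit Types (a b c t : R) (f g h : R -> R).

Lemma powR_le1 (x c : R) : 1 <= x -> c <= 0 -> x `^ c <= 1.
Proof.
move=> x1 c0; apply: (@le_trans _ _ (1 `^ c)); last by rewrite powR1.
exact: powR_gtM.
Qed.

Lemma powR_ge1 (x c : R) : 0 < x -> x <= 1 -> c <= 0 -> 1 <= x `^ c.
Proof.
move=> x0 x1 c0; apply: (@le_trans _ _ (1 `^ c)); first by rewrite powR1.
exact: powR_gtM.
Qed.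

Lemma sing1_mulid b f : 0 <= b -> sing b f -> sing 1 (fun s => s * f s).
Proof.
move=> b0 sf; split; first by move=> t t0; apply: cvgM; [exact: cvg_id|exact: sf.1].
move=> T T0; have [C C0 hC] := sf.2 T T0.
exists (C * T `^ b); first by rewrite mulr_ge0 ?powR_ge0.
move=> t t0 tT; rewrite subrr powRr0 mulr1 normrM (gtr0_norm t0).
apply: (@le_trans _ _ (t * (C * t `^ (b - 1)))); first by rewrite ler_pM2l// hC.
rewrite mulrCA ler_wpM2l//.
rewrite -{1}(powRr1 (ltW t0)) -powRDp// addrC subrK.
by rewrite ge0_ler_powR// nnegrE ltW.
Qed.

Lemma conv_swap a b c f g h t :
  0 < a -> a <= 1 -> 0 < b -> b <= 1 -> 0 < c -> c <= 1 ->
  sing a f -> sing b g -> sing c h -> 0 < t ->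
  conv f (conv g h) t = conv g (conv f h) t.
Proof.
move=> a0 a1 b0 b1 c0 c1 sf sg sh t0.
rewrite -(conv_assoc a0 a1 b0 b1 c0 c1 sf sg sh t0).
rewrite -(conv_assoc b0 b1 a0 a1 c0 c1 sg sf sh t0).
apply: eq_conv => //; [exact: conv_cont a0 a1 b0 b1 sf sg|exact: sh.1|].
move=> s s0; apply: convC => //; [exact: sf.1|exact: sg.1|].
exact: conv_intble a0 a1 b0 b1 sf sg s0.
Qed.

Lemma conv1_ker a t : 0 < a -> 0 < t -> a * conv (fun=> 1) (ker a) t = t * ker a t.
Proof.
move=> a0 t0; have [i e] := rint_pow a0 t0.
rewrite /conv; under [X in rint _ _ X]eq_fun do rewrite mul1r.
rewrite e /ker mulrCA divff ?gt_eqF// mulr1.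
by rewrite -{2}(powRr1 (ltW t0)) -powRDp// addrC subrK.
Qed.

Lemma conv_ker1 a t : 0 < a -> a <= 1 -> 0 < t ->
  conv (ker a) (fun=> 1) t = conv (fun=> 1) (ker a) t.
Proof.
move=> a0 a1 t0; apply: convC => //; [exact: contp_pow|by move=> s _; exact: cvg_cst|].
exact: conv_intble a0 a1 ltr01 (lexx _) (sing_ker a) (sing_cst 1) t0.
Qed.

(* [rho] is a truncation of the kernel [- t ^ (- al) / B], whose convolution
   with [ker al] is identically [-1]. *)
Lemma unit_profile (al : R) : 0 < al -> al < 1 ->
  exists (kap C : R) (rho e : R -> R), [/\ 0 < kap, 2 * kap < 1 & 0 <= C] /\
    [/\ sing 1 rho, sing 1 e, forall t, 0 < t -> e t = 1 + conv (ker al) rho t,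
        forall t, 0 < t -> `|rho t| <= C * t `^ (- kap) &
        forall t, 0 < t -> `|e t| <= C * t `^ (- kap)].
Proof.
move=> a0 a1; pose be : R := 1 - al.
have be0 : 0 < be by rewrite subr_gt0.
have be1 : be <= 1 by rewrite /be; lra.
pose B := betaf al be.
have B1 : 1 <= B by exact: betaf_ge1 a0 (ltW a1) be0 be1.
have B0 : 0 < B by exact: lt_le_trans B1.
have kb s : ker be s = s `^ (- al) :> R by rewrite /ker /be; congr (_ `^ _); ring.
(* Cutting at height 1 makes the profile bounded at the origin. The part removed, [dl], vanishes
   beyond 1, so its convolution with [ker al] decays like t^(al - 1). *)
pose m (s : R) : R := Num.min 1 (ker be s).
pose dl (s : R) : R := ker be s - m s.
have m0 s : 0 <= m s by rewrite /m le_min ler01 powR_ge0.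
have m1 s : m s <= 1 by rewrite /m ge_min lexx.
have mk s : m s <= ker be s by rewrite /m ge_min lexx orbT.
have dl0 s : 0 <= dl s by rewrite subr_ge0.
have dlk s : dl s <= ker be s by rewrite lerBlDr lerDl.
have dl1 s : 1 <= s -> dl s = 0.
  move=> s1; rewrite /dl /m min_r ?subrr// kb.
  by apply: powR_le1 => //; lra.
have sm : sing 1 m.
  split; first by move=> t t0; apply: continuous_min; [exact: cvg_cst|exact: powR_contoo].
  move=> T T0; exists 1 => // t t0 tT.
  by rewrite subrr powRr0 mulr1 ger0_norm.
have sdl : sing be dl.
  have sm' := singZ (-1) (sing_mono be1 sm).
  by apply: eq_sing (singD (sing_ker be) sm') => t t0; rewrite mulN1r.
have km t : 0 < t -> conv (ker al) m t = B - conv (ker al) dl t.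
  move=> t0; have h := convDr a0 (ltW a1) be0 be1 (sing_ker al) sdl (sing_mono be1 sm) t0.
  move: h; have -> : (fun s => dl s + m s) = ker be by apply/funext => s; rewrite subrK.
  rewrite (conv_ker a0 (ltW a1) be0 be1 t0) (_ : al + be - 1 = 0) ?powRr0 ?mulr1; last first.
    by rewrite /be; ring.
  by rewrite -/B => ->; rewrite addrC addKr.
have kd0 t : 0 < t -> 0 <= conv (ker al) dl t.
  move=> t0; apply: rint_ge0; first exact: conv_intble a0 (ltW a1) be0 be1 (sing_ker al) sdl t0.
  by move=> s _ _; rewrite mulr_ge0// powR_ge0.
have km0 t : 0 < t -> 0 <= conv (ker al) m t.
  move=> t0; apply: rint_ge0; first exact: conv_intble a0 (ltW a1) ltr01 (lexx _) (sing_ker al) sm t0.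
  by move=> s _ _; rewrite mulr_ge0// powR_ge0.
have kdB t : 0 < t -> conv (ker al) dl t <= B.
  by move=> t0; have := km0 t t0; rewrite km// subr_ge0.
have kd2 t : 2 <= t -> conv (ker al) dl t <= (2^-1 `^ (al - 1) / be) * t `^ (al - 1).
  move=> t2; have t0 : 0 < t by lra.
  have i := conv_intble a0 (ltW a1) be0 be1 (sing_ker al) sdl t0.
  rewrite /conv (@rint_chasles _ 0 1 t)//; last by lra.
  have -> : rint 1 t (fun s => ker al (t - s) * dl s) = 0.
    transitivity (rint 1 t (fun=> (0 : R))); last by rewrite rint_cst ?mul0r//; lra.
    apply: eq_rint; first exact: intble_measurable_oo (intbleS ler01 (lexx _) i).
    by move=> x x1 _; rewrite dl1 ?mulr0// ltW.
  rewrite addr0; have [i1 e1] := rint_pow be0 (@ltr01 R).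
  apply: (@le_trans _ _ (rint 0 1 (fun s => (2^-1 * t) `^ (al - 1) * s `^ (be - 1)))).
    apply: le_rint; [by apply: intbleS i; lra|exact: intbleZ|].
    move=> s s0 s1; apply: ler_pM; rewrite ?powR_ge0 ?dl0 ?dlk//.
    by apply: powR_gtM; lra.
  rewrite rintZ// e1 powR1 powRM ?invr_ge0 ?(ltW t0)//.
  by apply: eq_le_num; ring.
(* [rho] decays like t^(-al) and [e] like t^(al - 1); half of the smaller exponent is a common rate,
   and it keeps 2 kap < 1. *)
pose kap : R := Num.min al be / 2.
have ka : 2 * kap <= al by rewrite /kap mulrC divfK// ge_min lexx.
have kb' : 2 * kap <= be by rewrite /kap mulrC divfK// ge_min lexx orbT.
have k0 : 0 < kap by rewrite divr_gt0// lt_min a0.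
(* Explains the 2 in the constant [2 + C0]: up to t = 2 the bound on [e] is merely 1, and it must
   lie below a multiple of t^(-kap). *)
have two : 1 <= 2 * (2 : R) `^ (- kap).
  rewrite -{1}(powRr1 (ler0n R 2)) -powRDp//.
  by rewrite -[leLHS](powRr0 2) ler_powR ?ler1n//; lra.
pose C0 := 2^-1 `^ (al - 1) / be / B.
have C00 : 0 <= C0 by rewrite !divr_ge0 ?powR_ge0// ltW.
exists kap, (2 + C0), (fun t => - B^-1 * m t), (fun t => B^-1 * conv (ker al) dl t).
have C2 : 0 <= 2 + C0 by rewrite addr_ge0.
split; first by split => //; lra.
have Bi : 0 < B^-1 by rewrite invr_gt0.
have B1' : B^-1 <= 1 by rewrite invf_le1.
split.
- exact: singZ.
- apply: singZ; split; first exact: conv_cont a0 (ltW a1) be0 be1 (sing_ker al) sdl.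
  move=> T T0; exists B => [|t t0 tT]; first exact: ltW.
  by rewrite subrr powRr0 mulr1 ger0_norm ?kd0// kdB.
- move=> t t0; rewrite (convZr _ a0 (ltW a1) ltr01 (lexx _) (sing_ker al) sm t0) km//.
  by rewrite mulrBr mulNr mulVf ?gt_eqF//; ring.
- move=> t t0; rewrite normrM normrN (gtr0_norm Bi) (ger0_norm (m0 t)).
  apply: (@le_trans _ _ (1 * t `^ (- kap))); last by rewrite ler_wpM2r ?powR_ge0//; lra.
  apply: ler_pM => //; first exact: ltW.
  have [t1|t1] := leP t 1.
    apply: (le_trans (m1 t)); apply: powR_ge1 => //; lra.
  by apply: (le_trans (mk t)); rewrite kb ler_powR//; lra.
- move=> t t0; rewrite normrM (gtr0_norm Bi) (ger0_norm (kd0 t t0)).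
  have [t2|t2] := leP 2 t.
    apply: (@le_trans _ _ (C0 * t `^ (al - 1))).
      rewrite /C0 [leRHS]mulrAC [leRHS]mulrC ler_pM2l//.
      exact: kd2.
    apply: ler_pM => //; rewrite ?powR_ge0//; first by lra.
    by rewrite ler_powR//; rewrite -/be in kb' *; rewrite /be in kb'; lra.
  apply: (@le_trans _ _ 1); first by rewrite mulrC ler_pdivrMr// mul1r kdB.
  apply: (le_trans two); apply: ler_pM; rewrite ?powR_ge0//; first by lra.
  by apply: powR_gtM => //; [exact: ltW|lra].
Qed.

End convolution_identities.

(** * Resolvent of a matrix applied to a vector, its primitive and its first moment *)

Section vector_convolution.
Context {R : realType} {d : nat}.
Implicit Types (a b c t T : R) (f h : R -> R) (y g : R -> 'cV[R]_d) (M : 'M[R]_d) (u v : 'cV[R]_d).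

Lemma vconvE f y i : (fun s => vconv f y s i ord0) = conv f (fun s => y s i ord0).
Proof. by apply/funext => s; rewrite mxE. Qed.

Lemma mulmx_norm_le M : exists2 L : R, 0 <= L & forall u, `|M *m u| <= L * `|u|.
Proof.
exists (\sum_i \sum_j `|M i j|).
  by apply: sumr_ge0 => i _; apply: sumr_ge0.
move=> u; apply: mx_norm_le.
  by rewrite mulr_ge0//; apply: sumr_ge0 => i _; apply: sumr_ge0.
move=> i; rewrite mxE (le_trans (ler_norm_sum _ _ _))//.
rewrite [in leRHS](bigD1 i)//= mulrDl; apply: (@le_trans _ _ ((\sum_j `|M i j|) * `|u|)).
  rewrite mulr_suml; apply: ler_sum => j _; rewrite normrM ler_wpM2l//.
  exact: mx_entry_le.
rewrite lerDl mulr_ge0//; apply: sumr_ge0 => j _; exact: sumr_ge0.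
Qed.

Lemma lipschitz_mulmx M : exists2 L : R, 0 <= L & lipschitz_map (fun u => M *m u) L.
Proof.
have [L L0 hL] := mulmx_norm_le M; exists L => // u v.
by rewrite -mulmxBr.
Qed.

Lemma vconvD a b f y g t : 0 < a -> a <= 1 -> 0 < b -> b <= 1 ->
  sing a f -> vsing b y -> vsing b g -> 0 < t ->
  vconv f (fun s => y s + g s) t = vconv f y t + vconv f g t.
Proof.
move=> a0 a1 b0 b1 sf sy sg t0; apply/matrixP => i j; rewrite !mxE.
under [X in conv f X]eq_fun do rewrite mxE.
exact: convDr a0 a1 b0 b1 sf (sy i) (sg i) t0.
Qed.

Lemma vconv_scale a b f (h : R -> R) v t : 0 < a -> a <= 1 -> 0 < b -> b <= 1 ->
  sing a f -> sing b h -> 0 < t ->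
  vconv f (fun s => h s *: v) t = conv f h t *: v.
Proof.
move=> a0 a1 b0 b1 sf sh t0; apply/matrixP => i j; rewrite !mxE (ord1 j) mulrC.
under [X in conv f X]eq_fun do rewrite mxE mulrC.
exact: convZr a0 a1 b0 b1 sf sh t0.
Qed.

Lemma vconv_swap a b (c : R) f h y t :
  0 < a -> a <= 1 -> 0 < b -> b <= 1 -> 0 < c -> c <= 1 ->
  sing a f -> sing b h -> vsing c y -> 0 < t ->
  vconv f (vconv h y) t = vconv h (vconv f y) t.
Proof.
move=> a0 a1 b0 b1 c0 c1 sf sh sy t0; apply/matrixP => i j; rewrite !mxE.
rewrite !vconvE.
exact: conv_swap a0 a1 b0 b1 c0 c1 sf sh (sy i) t0.
Qed.

Lemma eq_vconv b f y g t : contp f -> vsing b y -> (forall s, 0 < s -> y s = g s) ->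
  vconv f y t = vconv f g t.
Proof.
move=> cf sy e; apply/matrixP => i j; rewrite !mxE; apply: eq_conv => //.
  exact: (sy i).1.
by move=> s s0; rewrite e.
Qed.

Lemma vsing_scale b (h : R -> R) v : sing b h -> vsing b (fun s => h s *: v).
Proof.
move=> sh i; under eq_fun do rewrite mxE mulrC.
exact: singZ.
Qed.

Lemma vsingZ b c y : vsing b y -> vsing b (fun s => c *: y s).
Proof. by move=> sy i; under eq_fun do rewrite mxE; exact: singZ. Qed.

Lemma vsing_conv1 b y : 0 < b -> b <= 1 -> vsing b y -> vsing 1 (vconv (fun=> 1) y).
Proof.
move=> b0 b1 sy i; split.
  rewrite vconvE => t t0.
  exact: conv_cont ltr01 (lexx _) b0 b1 (sing_cst 1) (sy i) t t0.
move=> T T0; have [C C0 hC] := conv_le_pow ltr01 (lexx _) b0 b1 (sing_cst 1) (sy i) T0.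
exists (C * T `^ b); first by rewrite mulr_ge0 ?powR_ge0.
move=> t t0 tT; rewrite mxE subrr powRr0 mulr1 (le_trans (hC t t0 tT))// ler_wpM2l//.
rewrite (_ : 1 + b - 1 = b); last by ring.
by rewrite ge0_ler_powR// ?nnegrE ?(ltW t0) ?(ltW T0) ?(ltW b0).
Qed.

Lemma resolvent_exists (al : R) M v : 0 < al -> al < 1 ->
  exists2 y, vsing al y & forall t, 0 < t ->
    y t = ker al t *: v + M *m vconv (ker al) y t.
Proof.
move=> a0 a1; have [L L0 hL] := lipschitz_mulmx M.
have [||y [sy e]] := @picard R d al al L `|v| _ (fun t => ker al t *: v) a0 (ltW a1) a0 (ltW a1) L0 hL (mulmx0 _ _).
- by move=> i; exact: (vsing_scale v (sing_ker al) i).1.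
- by move=> t t0; rewrite normrZ mulrC ger0_norm ?powR_ge0.
exists y => // t t0; rewrite {1}e//.
by rewrite (vconv_mulmx _ a0 (ltW a1) a0 (ltW a1) (sing_ker al) sy t0).
Qed.

Section resolvent_identities.
Variables (al : R) (M : 'M[R]_d) (v : 'cV[R]_d) (y : R -> 'cV[R]_d).
Hypotheses (a0 : 0 < al) (a1 : al < 1) (sy : vsing al y).
Hypothesis ey : forall t, 0 < t -> y t = ker al t *: v + M *m vconv (ker al) y t.

Let a1' : al <= 1. Proof. exact: ltW. Qed.
Let sk : sing al (ker al). Proof. exact: sing_ker. Qed.
Let s1 : sing 1 (fun=> 1 : R). Proof. exact: sing_cst. Qed.
Let sky : vsing al (vconv (ker al) y).
Proof. exact: vsing_conv a0 a1' a0 a1' sk sy. Qed.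

Let conv1_y t : 0 < t -> vconv (fun=> 1) y t =
  conv (fun=> 1) (ker al) t *: v + M *m vconv (fun=> 1) (vconv (ker al) y) t.
Proof.
move=> t0; rewrite (eq_vconv t s1.1 sy ey).
rewrite (vconvD ltr01 (lexx _) a0 a1' s1 _ _ t0); last 2 first.
- exact: vsing_scale.
- exact: (vsing_mulmx _ (ltW a0) a1').
rewrite (vconv_scale _ ltr01 (lexx _) a0 a1' s1 sk t0).
by rewrite (vconv_mulmx _ ltr01 (lexx _) a0 a1' s1 sky t0).
Qed.

(** The solution S of S = v + M (k * S), as [vconv_primitive] shows: the homogeneous solution with
    initial value [v], bounded near the origin where [y] is singular like the kernel. *)
Definition primitive t : 'cV[R]_d := v + M *m vconv (fun=> 1) y t.

Lemma vsing_primitive : vsing 1 primitive.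
Proof.
apply: vsingD; first by move=> i; exact: sing_cst.
apply: (vsing_mulmx _ ler01 (lexx _)); exact: vsing_conv1 a0 a1' sy.
Qed.

(** Convolving S with k and exchanging k with the constant 1 gives 1 * (k v + M (k * y)), that is 1
    * y by the equation of [y]. *)
Lemma vconv_primitive t : 0 < t ->
  vconv (ker al) primitive t = vconv (fun=> 1) y t.
Proof.
move=> t0; have s1y := vsing_conv1 a0 a1' sy.
rewrite (vconvD a0 a1' ltr01 (lexx _) sk _ _ t0); last 2 first.
- by move=> i; exact: sing_cst.
- exact: (vsing_mulmx _ ler01 (lexx _)).
rewrite (vconv_mulmx _ a0 a1' ltr01 (lexx _) sk s1y t0).
rewrite (vconv_swap a0 a1' ltr01 (lexx _) a0 a1' sk s1 sy t0) conv1_y//.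
congr (_ + _); rewrite -(conv_ker1 a0 a1' t0).
rewrite -(vconv_scale _ a0 a1' ltr01 (lexx _) sk s1 t0).
by under [X in _ = vconv _ X _]eq_fun do rewrite scale1r.
Qed.

Lemma vsing_moment : vsing 1 (fun s => s *: y s).
Proof.
move=> i; under eq_fun do rewrite mxE.
by apply: (sing1_mulid (ltW a0)); exact: sy.
Qed.

(** Multiplication by t is a derivation for convolution, and t k = al (1 * k). Hence t y(t) solves
    the same Volterra equation, with the primitive of [y] as forcing. *)
Lemma moment_eq t : 0 < t ->
  t *: y t = al *: vconv (fun=> 1) y t + M *m vconv (ker al) (fun s => s *: y s) t.
Proof.
move=> t0; have h : t *: vconv (ker al) y t =
    al *: vconv (fun=> 1) (vconv (ker al) y) t + vconv (ker al) (fun s => s *: y s) t.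
  apply/matrixP => i j; rewrite !mxE.
  rewrite (conv_mulid a0 a1' a0 a1' sk (sy i) (sing_mulid sk) (sing_mulid (sy i)) t0).
  congr (_ + _); last by congr conv; apply/funext => s; rewrite mxE.
  rewrite vconvE.
  rewrite -(conv_assoc ltr01 (lexx _) a0 a1' a0 a1' s1 sk (sy i) t0).
  have s1k := sing_conv ltr01 (lexx _) a0 a1' s1 sk.
  rewrite -(convZl _ a0 a1' a0 a1' s1k (sy i) t0).
  apply: eq_conv => //; [exact: (sing_mulid sk).1|exact: (sy i).1|].
  by move=> s s0; rewrite conv1_ker.
rewrite {1}ey// scalerDr scalemxAr h mulmxDr addrA; congr (_ + _).
by rewrite conv1_y// scalerDr !scalerA -!scalemxAr conv1_ker.
Qed.

End resolvent_identities.
End vector_convolution.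

(** * Decay of the resolvent in mean over dyadic intervals *)

Section resolvent_decay.
Context {R : realType}.
Implicit Types (t T : R).

Lemma conv1E f t : conv (fun=> 1) f t = rint 0 t f :> R.
Proof. by congr rint; apply/funext => s; rewrite mul1r. Qed.

Lemma rint_le_sub (a b c e : R) f : a <= b -> b <= c -> c <= e -> intble a e f ->
  (forall x, a < x -> x < e -> 0 <= f x) -> rint b c f <= rint a e f.
Proof.
move=> ab bc ce fi f0.
rewrite (rint_chasles ab (le_trans bc ce) fi) (rint_chasles bc ce (intbleS ab (lexx _) fi)).
have h1 : 0 <= rint a b f.
  apply: rint_ge0; first exact: intbleS (le_trans bc ce) fi.
  by move=> x ax xb; apply: f0 => //; exact: lt_le_trans xb (le_trans bc ce).
have h2 : 0 <= rint c e f.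
  apply: rint_ge0; first exact: intbleS (le_trans ab bc) (lexx _) fi.
  by move=> x cx xe; apply: f0 => //; exact: le_lt_trans (le_trans ab bc) cx.
by rewrite addrCA lerDl addr_ge0.
Qed.

(** The blocks [2^n, 2^(n+1)] contribute a geometric series of ratio q = 2^(-kap), which bounds the
    integral uniformly in [T]. *)
Lemma dyadic_integral_bound (al C kap : R) f : 0 < al -> al <= 1 -> 0 <= C -> 0 < kap ->
  sing al f -> (forall T, 1 <= T -> rint T (2 * T) (fun s => `|f s|) <= C * T `^ (- kap)) ->
  exists2 D : R, 0 <= D & forall T, 0 < T -> rint 0 T (fun s => `|f s|) <= D.
Proof.
move=> a0 a1 C0 k0 sf hf.
have fi T : 0 < T -> intble 0 T (fun s => `|f s|).
  by move=> T0; exact: sing_intble a0 (sing_norm sf) T0.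
pose q : R := 2 `^ (- kap).
have q0 : 0 < q by rewrite powR_gt0.
have q1 : q < 1.
  rewrite /q powRN invf_lt1 ?powR_gt0//.
  by rewrite /powR pnatr_eq0/= -[ltLHS]expR0 ltr_expR mulr_gt0// ln_gt0 ?ltr1n.
pose I := rint 0 1 (fun s => `|f s|).
have I0 : 0 <= I by apply: rint_ge0 => //; exact: fi.
have step (n : nat) : rint 0 (2 ^+ n) (fun s => `|f s|) <= I + C / (1 - q) * (1 - q ^+ n).
  elim: n => [|n ih]; first by rewrite !expr0 subrr mulr0 addr0.
  have p1 : 1 <= (2 : R) ^+ n by rewrite exprn_ege1// ler1n.
  have p0 : 0 < (2 : R) ^+ n by rewrite exprn_gt0.
  rewrite (@rint_chasles _ 0 (2 ^+ n)); last 3 first.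
  - exact: ltW.
  - by rewrite exprS ler_peMl ?(ltW p0)// ler1n.
  - by apply: fi; rewrite exprn_gt0.
  have := hf _ p1; rewrite -exprS => h.
  apply: (le_trans (lerD ih h)); rewrite -addrA lerD2l.
  have -> : ((2 : R) ^+ n) `^ (- kap) = q ^+ n.
    by rewrite -powR_mulrn// -powRrM mulrC powRrM powR_mulrn ?powR_ge0.
  rewrite exprS; apply: eq_le_num; field.
  by rewrite gt_eqF// subr_gt0.
exists (I + C / (1 - q)).
  by rewrite addr_ge0// divr_ge0// subr_ge0 ltW.
move=> T T0.
have [n hn] := half_pow_small T (@ltr01 R).
have n2 : 0 < (2 : R) ^+ n by rewrite exprn_gt0.
have Tn : T <= 2 ^+ n by rewrite ltr_pdivrMr// mul1r in hn; exact: ltW.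
apply: (le_trans (rint_le_sub (lexx _) (ltW T0) Tn (fi _ n2) _)) => //.
apply: (le_trans (step n)); rewrite lerD2l ler_piMr//.
  by rewrite divr_ge0// subr_ge0 ltW.
by rewrite gerBl exprn_ge0// ltW.
Qed.

Section energy_growth.
Context {d : nat} (kap : R).
Hypotheses (k0 : 0 < kap) (k1 : 2 * kap < 1).
Implicit Types (y g : R -> 'cV[R]_d) (M : 'M[R]_d) (v : 'cV[R]_d).

(** The quadratic mean over (0, T) is O(T^(-kap)). Unlike a pointwise bound, this passes through the
    Volterra equation by [energy_estimate]. *)
Definition energy_growth g := vsing 1 g /\ exists2 C : R, 0 <= C &
  forall T, 0 < T -> energy g T <= C * T `^ (1 - 2 * kap).

Lemma energy_growth_of_norm (C : R) g : 0 <= C -> vsing 1 g ->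
  (forall t, 0 < t -> `|g t| <= C * t `^ (- kap)) -> energy_growth g.
Proof.
move=> C0 sg hg; split=> //.
have c0 : 0 < 1 - 2 * kap by rewrite subr_gt0.
exists (d%:R * C ^+ 2 / (1 - 2 * kap)).
  by rewrite divr_ge0 ?mulr_ge0 ?sqr_ge0// ltW.
move=> T T0; have [i e] := rint_pow c0 T0.
have -> : d%:R * C ^+ 2 / (1 - 2 * kap) * T `^ (1 - 2 * kap) =
   rint 0 T (fun s => d%:R * C ^+ 2 * s `^ (1 - 2 * kap - 1)).
  by rewrite rintZ// e; ring.
apply: le_energy => //; first exact: intbleZ.
move=> t t0 tT; have -> : 1 - 2 * kap - 1 = - kap + - kap by ring.
rewrite powRDp//.
have h (i0 : 'I_d) : true -> g t i0 ord0 ^+ 2 <= C ^+ 2 * (t `^ (- kap) * t `^ (- kap)).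
  move=> _; rewrite -real_normK ?num_real// -expr2 -exprMn ler_sqr ?nnegrE//.
    exact: le_trans (mx_entry_le _ _) (hg t t0).
  by rewrite mulr_ge0 ?powR_ge0.
apply: (@le_trans _ _ (\sum_(i0 < d) C ^+ 2 * (t `^ (- kap) * t `^ (- kap)))).
  exact: ler_sum.
by rewrite sumr_const card_ord -mulrA mulr_natl.
Qed.

Lemma energy_growthD y g : energy_growth y -> energy_growth g ->
  energy_growth (fun t => y t + g t).
Proof.
move=> [sy [C C0 hC]] [sg [D D0 hD]]; split; first exact: vsingD.
exists (2 * C + 2 * D); first by rewrite addr_ge0 ?mulr_ge0.
move=> T T0; apply: (le_trans (energyD sy sg T0)).
by rewrite [leRHS]mulrDl -[X in _ <= X + _]mulrA -[X in _ <= _ + X]mulrA lerD// ler_pM2l ?hC ?hD.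
Qed.

Lemma energy_growth_mulmx M y : energy_growth y -> energy_growth (fun t => M *m y t).
Proof.
move=> [sy [C C0 hC]]; split; first exact: (vsing_mulmx _ ler01 (lexx _)).
have [K K0 hK] := energy_mulmx M.
exists (K * C); first exact: mulr_ge0.
by move=> T T0; rewrite (le_trans (hK _ _ sy T0))// -mulrA ler_wpM2l// hC.
Qed.

Lemma energy_growthZ c y : energy_growth y -> energy_growth (fun t => c *: y t).
Proof.
move=> /(energy_growth_mulmx c%:M).
by under eq_fun do rewrite mul_scalar_mx.
Qed.

Lemma energy_growth_volterra (al : R) M y g : 0 < al -> al < 1 ->
  (forall l, eigenvalue (map_mx (fun r : R => complex.Complex r 0) M) l -> in_sector al l) ->
  volterra_sol al M y g -> energy_growth g -> energy_growth y.
Proof.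
move=> a0 a1 sec sol [sg [C C0 hC]].
have [K K0 hK] := energy_estimate a0 a1 sec.
split; first by case: sol.
exists (K * C); first exact: mulr_ge0.
by move=> T T0; rewrite (le_trans (hK _ _ _ sol T0))// -mulrA ler_wpM2l// hC.
Qed.

Lemma energy_growth_mass g : energy_growth g -> exists2 C : R, 0 <= C &
  forall T j, 0 < T -> rint T (2 * T) (fun s => `|g s j ord0|) <= C * T `^ (1 - kap).
Proof.
move=> [sg [C C0 hC]]; exists (C + 1); first by rewrite addr_ge0.
move=> T j T0; have T20 : 0 < 2 * T by rewrite mulr_gt0.
have TT : T <= 2 * T by lra.
have gi : intble 0 (2 * T) (fun s => g s j ord0 ^+ 2).
  by apply: (sing_intble ltr01 _ T20); exact: sing1M.
have gi' : intble 0 (2 * T) (fun s => `|g s j ord0|).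
  by apply: (sing_intble ltr01 _ T20); exact: sing_norm (sg j).
have e1 : rint T (2 * T) (fun s => g s j ord0 ^+ 2) <= C * (2 * T) `^ (1 - 2 * kap).
  apply: le_trans (hC _ T20).
  apply: (le_trans (rint_le_sub (ltW T0) TT (lexx _) gi _)).
    by move=> x _ _; exact: sqr_ge0.
  apply: le_rint => //; first exact: sing_intble ltr01 (sing_sqr_sum sg) T20.
  move=> x _ _; rewrite (bigD1 j)//= lerDl; apply: sumr_ge0 => i _; exact: sqr_ge0.
have e2 : (2 * T) `^ (1 - 2 * kap) <= 2 * T `^ (1 - 2 * kap).
  rewrite powRM ?ler0n ?(ltW T0)// ler_wpM2r ?powR_ge0//.
  rewrite -[leRHS](powRr1 (ler0n R 2)) ler_powR ?ler1n//.
  by rewrite gerBl mulr_ge0// ltW.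
have e3 := le_trans e1 (ler_wpM2l C0 e2).
(* Cauchy-Schwarz in the form z <= l z^2 / 2 + 1 / (2 l); the value T^kap balances the two
   integrals. *)
set l := T `^ kap.
have l0 : 0 < l by rewrite powR_gt0.
apply: (@le_trans _ _ (rint T (2 * T) (fun s => (l / 2) * g s j ord0 ^+ 2 + (l^-1 / 2)))).
  apply: le_rint; [exact: intbleS (ltW T0) (lexx _) gi'| |].
    apply: intbleD; last exact: intble_cst.
    by apply: intbleZ; exact: intbleS (ltW T0) (lexx _) gi.
  move=> x _ _; rewrite -(real_normK (num_real (g x j ord0))).
  move: `|g x j ord0| => z; rewrite -subr_ge0.
  have -> : l / 2 * z ^+ 2 + l^-1 / 2 - z = l^-1 / 2 * (l * z - 1) ^+ 2.
    by field; rewrite gt_eqF.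
  by rewrite mulr_ge0 ?sqr_ge0// divr_ge0// invr_ge0 ltW.
have gT := intbleS (ltW T0) (lexx _) gi.
rewrite rintD; [|exact: intbleZ|exact: intble_cst].
rewrite rintZ// rint_cst// (_ : 2 * T - T = T); last by ring.
have E1 : l * T `^ (1 - 2 * kap) = T `^ (1 - kap).
  by rewrite /l -powRDp//; congr (_ `^ _); ring.
have E2 : l^-1 * T = T `^ (1 - kap).
  by rewrite /l -powRN -{2}(powRr1 (ltW T0)) -powRDp//; congr (_ `^ _); ring.
apply: (@le_trans _ _ (l / 2 * (C * (2 * T `^ (1 - 2 * kap))) + l^-1 / 2 * T)).
  by rewrite lerD2r ler_wpM2l// divr_ge0// ltW.
rewrite (_ : l / 2 * _ = C * (l * T `^ (1 - 2 * kap))); last by field.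
rewrite (_ : l^-1 / 2 * T = (l^-1 * T) / 2); last by field; rewrite gt_eqF.
rewrite E1 E2 [leRHS]mulrDl mul1r lerD2l ler_pdivrMr// ler_peMr ?powR_ge0// ler1n//.
Qed.

End energy_growth.

(** The strict inequality of [in_sector] excludes 0, and a null vector of a singular real matrix is
    a complex eigenvector for 0. *)
Lemma unitmx_of_sector (al : R) d (M : 'M[R]_d) :
  (forall l, eigenvalue (map_mx (fun r : R => complex.Complex r 0) M) l -> in_sector al l) ->
  M \in unitmx.
Proof.
move=> sec; apply: contraT; rewrite unitmxE unitfE negbK => /det0P[v v0 vM].
have /sec : eigenvalue (map_mx (fun r : R => complex.Complex r 0) M) 0.
  apply/eigenvalueP; exists (map_mx (real_complex R) v); last by rewrite map_mx_eq0.
  rewrite -[X in _ *m X]/(map_mx (real_complex R) M) -map_mxM vM scale0r.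
  by rewrite map_mx0.
by rewrite /in_sector/= mulr0 normr0 mulr0 ltxx.
Qed.

Lemma eigenvalue_trmx (F : fieldType) d (M : 'M[F]_d) l :
  eigenvalue M^T l = eigenvalue M l.
Proof.
rewrite !eigenvalue_root_char; congr (root _ _).
rewrite /char_poly -det_tr; congr (\det _); apply/matrixP => i j.
by rewrite !mxE eq_sym.
Qed.

(** Both S and M t y(t) satisfy the Volterra equation with a forcing that contains a multiple of the
    constant [v]. Adding a multiple of the profile [p], for which M (k * p) = q - v, replaces this
    constant by decaying terms; the energy estimate then applies, and [p] is removed afterwards. *)
Lemma resolvent_decay (al : R) d (M : 'M[R]_d) (v : 'cV[R]_d) : 0 < al -> al < 1 ->
  (forall l, eigenvalue (map_mx (fun r : R => complex.Complex r 0) M) l -> in_sector al l) ->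
  exists y, [/\ vsing al y,
    forall t, 0 < t -> y t = ker al t *: v + M *m vconv (ker al) y t &
    exists kap C : R, [/\ 0 < kap, 0 <= C,
      forall T j, 1 <= T -> rint T (2 * T) (fun s => `|y s j ord0|) <= C * T `^ (- kap) &
      forall T j, 1 <= T -> `|primitive M v y (2 * T) j ord0| <= C * T `^ (- kap)]].
Proof.
move=> a0 a1 sec; have a1' := ltW a1.
have [y sy ey] := resolvent_exists M v a0 a1; exists y; split=> //.
have uM := unitmx_of_sector sec.
have [kap [C [rho [e [[k0 k1 C0] [srho se eE hrho he]]]]]] := unit_profile a0 a1.
have sk := sing_ker al.
(* The profile points along [b] so that M (k * p) is a multiple of [v]. *)
pose b := invmx M *m v.
have Mb : M *m b = v by rewrite /b mulmxA mulmxV// mul1mx.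
pose S := primitive M v y.
have sS : vsing 1 S by exact: vsing_primitive a0 a1 sy.
have kS t : 0 < t -> vconv (ker al) S t = vconv (fun=> 1) y t by exact: vconv_primitive.
pose p t : 'cV[R]_d := rho t *: b.
have sp : vsing 1 p by exact: vsing_scale.
have gp : energy_growth kap p.
  apply: (@energy_growth_of_norm _ _ k1 (C * `|b|)) => //; first by rewrite mulr_ge0.
  by move=> t t0; rewrite normrZ mulrAC ler_wpM2r// hrho.
pose q t : 'cV[R]_d := e t *: v.
have sq : vsing 1 q by exact: vsing_scale.
have gq : energy_growth kap q.
  apply: (@energy_growth_of_norm _ _ k1 (C * `|v|)) => //; first by rewrite mulr_ge0.
  by move=> t t0; rewrite normrZ mulrAC ler_wpM2r// he.
have kp t : 0 < t -> M *m vconv (ker al) p t = q t - v.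
  move=> t0; rewrite (vconv_scale _ a0 a1' ltr01 (lexx _) sk srho t0) -scalemxAr Mb.
  by rewrite /q eE// scalerDl scale1r addrC addKr.
have kN c g t : vsing 1 g -> 0 < t ->
    M *m vconv (ker al) (fun s => g s + c *: p s) t =
    M *m vconv (ker al) g t + c *: (q t - v).
  move=> sg t0; rewrite (vconvD a0 a1' ltr01 (lexx _) sk sg (vsingZ c sp) t0) mulmxDr.
  congr (_ + _); rewrite -kp// scalemxAr; congr (_ *m _).
  apply/matrixP => i j; rewrite !mxE; under [X in conv _ X]eq_fun do rewrite mxE.
  exact: convZr a0 a1' ltr01 (lexx _) sk (sp i) t0.
have gS : energy_growth kap S.
  have gSp : energy_growth kap (fun t => S t + -1 *: p t).
    apply: (energy_growth_volterra a0 a1 sec (g := fun t => q t + -1 *: p t)).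
      split; first by apply: vsingD => //; exact: vsingZ.
      split; first by apply: vsingD => //; exact: vsingZ.
      move=> t t0; rewrite kN// kS// [S t]/S /primitive.
      move: (M *m _) (p t) (q t) => x p' z; apply/matrixP => i j.
      by rewrite !mxE; ring.
    by apply: energy_growthD => //; exact: energy_growthZ.
  have := energy_growthD gSp gp.
  by under eq_fun do rewrite scaleN1r subrK.
pose P t : 'cV[R]_d := t *: y t.
have sP : vsing 1 P by exact: vsing_moment a0 sy.
(* Multiplication by [M] turns the forcing al (1 * y) of [moment_eq] into al (S - v), which is
   already understood; [M] is inverted at the end. *)
pose N t : 'cV[R]_d := M *m P t.
have sN : vsing 1 N by exact: (vsing_mulmx _ ler01 (lexx _)).
have eN t : 0 < t -> N t = al *: (S t - v) + M *m vconv (ker al) N t.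
  move=> t0; rewrite {1}/N [P t](moment_eq a0 a1 sy ey t0) mulmxDr -scalemxAr.
  rewrite /S /primitive [v + _ - v]addrAC subrr add0r; congr (_ + _); congr (_ *m _).
  by rewrite (vconv_mulmx _ a0 a1' ltr01 (lexx _) sk sP t0).
have gN : energy_growth kap N.
  have gSp : energy_growth kap (fun t => N t + al *: p t).
    apply: (energy_growth_volterra a0 a1 sec
        (g := fun t => al *: S t + (al *: p t + (- al) *: q t))).
      split; first by apply: vsingD => //; exact: vsingZ.
      split; first by apply: vsingD; [|apply: vsingD]; exact: vsingZ.
      move=> t t0; rewrite kN// {1}eN//.
      move: (M *m _) (S t) (p t) (q t) => x s p' z; apply/matrixP => i j.
      by rewrite !mxE; ring.
    by apply: energy_growthD; [|apply: energy_growthD]; exact: energy_growthZ.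
  have := energy_growthD gSp (energy_growthZ (- al) gp).
  by under eq_fun do rewrite scaleNr addrK.
have gP : energy_growth kap P.
  have := energy_growth_mulmx (invmx M) gN.
  by under eq_fun do rewrite mulmxA mulVmx// mul1mx.
have [D1 D10 hP] := energy_growth_mass k0 gP.
have [D2 D20 hS] := energy_growth_mass k0 gS.
have yi j T : 0 < T -> intble 0 T (fun s => `|y s j ord0|).
  by move=> T0; exact: sing_intble a0 (sing_norm (sy j)) T0.
have Tk T : 0 < T -> T `^ (1 - kap) = T * T `^ (- kap).
  by move=> T0; rewrite powRDp// powRr1 ?(ltW T0).
have hy T j : 1 <= T -> rint T (2 * T) (fun s => `|y s j ord0|) <= D1 * T `^ (- kap).
  move=> T1; have T0 : 0 < T by exact: lt_le_trans T1.
  have T20 : 0 < 2 * T by rewrite mulr_gt0.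
  have Pi : intble T (2 * T) (fun s => `|P s j ord0|).
    apply: (intbleS (ltW T0) (lexx _)); exact: sing_intble ltr01 (sing_norm (sP j)) T20.
  apply: (@le_trans _ _ (rint T (2 * T) (fun s => T^-1 * `|P s j ord0|))).
    apply: le_rint; [exact: intbleS (ltW T0) (lexx _) (yi j _ T20)|exact: intbleZ|].
    move=> x Tx _; rewrite mxE normrM ler_pdivlMl// ler_wpM2r//.
    by rewrite gtr0_norm ?(lt_trans T0 Tx)// ltW.
  rewrite rintZ// ler_pdivrMl// mulrCA -Tk//; exact: hP.
pose m := \sum_i \sum_j `|M i j|.
have m0 : 0 <= m by apply: sumr_ge0 => i _; exact: sumr_ge0.
exists kap, (D1 + (D2 + m * D1)); split=> //.
- by rewrite !addr_ge0// mulr_ge0.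
- move=> T j T1; apply: (le_trans (hy T j T1)); rewrite ler_wpM2r ?powR_ge0// lerDl.
  by rewrite addr_ge0// mulr_ge0.
move=> T j T1; have T0 : 0 < T by exact: lt_le_trans T1.
have T20 : 0 < 2 * T by rewrite mulr_gt0.
have TT : T <= 2 * T by lra.
pose E := m * (D1 * T `^ (- kap)).
(* Over (s, 2T) the function S changes by at most [E], so its value at 2T is at most its mean over
   (T, 2T) plus [E]. *)
have dS s : T < s -> s < 2 * T -> `|S (2 * T) j ord0| <= `|S s j ord0| + E.
  move=> Ts s2; have s0 := lt_trans T0 Ts.
  rewrite -lerBlDl; apply: (le_trans (lerB_dist _ _)).
  have -> : S (2 * T) j ord0 - S s j ord0 =
      \sum_l M j l * rint s (2 * T) (fun u => y u l ord0).
    rewrite !mxE opprD addrACA subrr add0r -sumrB; apply: eq_bigr => l _.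
    rewrite !mxE !conv1E -mulrBr; congr (_ * _).
    rewrite (rint_chasles (ltW s0) (ltW s2)); last exact: sing_intble a0 (sy l) T20.
    by rewrite addrC addKr.
  apply: (@le_trans _ _ (\sum_l `|M j l| * (D1 * T `^ (- kap)))).
    apply: (le_trans (ler_norm_sum _ _ _)); apply: ler_sum => l _.
    rewrite normrM ler_wpM2l//.
    apply: (le_trans (le_norm_rint _)).
      exact: intbleS (ltW s0) (lexx _) (sing_intble a0 (sy l) T20).
    apply: le_trans (hy T l T1).
    apply: (rint_le_sub (ltW Ts) (ltW s2) (lexx _)) => //.
    exact: intbleS (ltW T0) (lexx _) (yi l _ T20).
  rewrite -mulr_suml /E ler_wpM2r ?mulr_ge0 ?powR_ge0//.
  by rewrite /m [leRHS](bigD1 j)//= lerDl; apply: sumr_ge0 => i _; exact: sumr_ge0.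
have Si : intble T (2 * T) (fun s => `|S s j ord0|).
  apply: (intbleS (ltW T0) (lexx _)); exact: sing_intble ltr01 (sing_norm (sS j)) T20.
have := @le_rint R T (2 * T) (fun=> `|S (2 * T) j ord0|) _ (intble_cst _ _ _)
   (intbleD Si (intble_cst _ _ E)) dS.
rewrite rintD//; last exact: intble_cst.
rewrite !rint_cst// (_ : 2 * T - T = T); last by ring.
move=> h; have {}h := le_trans h (lerD (hS T j T0) (lexx _)).
have {}h : `|S (2 * T) j ord0| <= D2 * T `^ (- kap) + E.
  rewrite -(ler_pM2r T0); apply: (le_trans h); rewrite Tk//; apply: eq_le_num; ring.
apply: (le_trans h); rewrite /E mulrA -mulrDl ler_wpM2r ?powR_ge0//.
by rewrite lerDr.
Qed.

End resolvent_decay.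

Lemma powR_decay {R : realType} (C kap e : R) : 0 < kap -> 0 < e ->
  exists2 T : R, 1 <= T & forall t, T <= t -> C * t `^ (- kap) <= e.
Proof.
move=> k0 e0; pose x := `|C| / e + 1.
have x1 : 1 <= x by rewrite lerDr divr_ge0// ltW.
have x0 : 0 < x by exact: lt_le_trans x1.
have ki : 0 <= kap^-1 by rewrite invr_ge0 ltW.
have X1 : 1 <= x `^ kap^-1 by rewrite -[leLHS](powRr0 x) ler_powR.
exists (x `^ kap^-1) => // t xt.
have t0 : 0 < t by exact: lt_le_trans (lt_le_trans ltr01 X1) xt.
have h : x <= t `^ kap.
  rewrite -[leLHS](powRr1 (ltW x0)) -(mulVf (lt0r_neq0 k0)) powRrM.
  by rewrite ge0_ler_powR// ?nnegrE ?(ltW k0) ?powR_ge0 ?(ltW t0).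
rewrite powRN ler_pdivrMr ?powR_gt0//.
apply: (le_trans (ler_norm C)); rewrite mulrC -ler_pdivrMr//.
by apply: le_trans h; rewrite /x lerDl.
Qed.

(** * Bounds for the forced linear system by variation of constants *)

Section linear_system.
Context {R : realType} {d : nat}.
Variables (al : R) (A : 'M[R]_d).
Hypotheses (a0 : 0 < al) (a1 : al < 1).
Hypothesis sec : forall l,
  eigenvalue (map_mx (fun r : R => complex.Complex r 0) A) l -> in_sector al l.
Implicit Types (z h : R -> 'cV[R]_d) (t T : R).
Local Notation k := (ker al).

Definition forced_solution (z0 : 'cV[R]_d) h z := [/\ vsing 1 z, vsing 1 h &
  forall t, 0 < t -> z t = z0 + A *m vconv k z t + vconv k h t].

(* Convolving the equation with [y] and the equation of [y] with [z] gives two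
   expressions of the same convolution; what remains is [k] convolved with the formula. *)
Lemma variation_of_constants (i : 'I_d) y (z0 : 'cV[R]_d) h z : vsing al y ->
  (forall t, 0 < t -> y t = k t *: delta_mx i ord0 + A^T *m vconv k y t) ->
  forced_solution z0 h z -> forall t : R, 0 < t ->
  z t i ord0 = \sum_j primitive A^T (delta_mx i ord0) y t j ord0 * z0 j ord0 +
    \sum_j conv (fun s => y s j ord0) (fun s => h s j ord0) t.
Proof.
move=> sy ey [sz sh ez]; have a1' := ltW a1; have l1 := lexx (1 : R).
set S := primitive _ _ _.
have sS : vsing 1 S by exact: vsing_primitive a0 a1 sy.
have sk := sing_ker al.
have syh j : sing 1 (conv (fun s => y s j ord0) (fun s => h s j ord0)).
  exact: (sing_conv a0 a1' ltr01 l1 (sy j) (sh j)).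
have syz l j : sing 1 (conv (fun s => y s l ord0) (fun s => z s j ord0)).
  exact: (sing_conv a0 a1' ltr01 l1 (sy l) (sz j)).
have skz j : sing 1 (conv k (fun s => z s j ord0)).
  exact: (sing_conv a0 a1' ltr01 l1 sk (sz j)).
have skh j : sing 1 (conv k (fun s => h s j ord0)).
  exact: (sing_conv a0 a1' ltr01 l1 sk (sh j)).
have sky j : sing al (conv k (fun s => y s j ord0)).
  exact: (sing_conv a0 a1' a0 a1' sk (sy j)).
have sSz : sing 1 (fun t => \sum_j S t j ord0 * z0 j ord0).
  apply: sing_sum => // j; apply: (@eq_sing _ 1 (fun t => z0 j ord0 * S t j ord0)).
    by move=> t t0; rewrite mulrC.
  by apply: singZ; exact: sS.
have sH : sing 1 (fun t => \sum_j conv (fun s => y s j ord0) (fun s => h s j ord0) t).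
  exact: sing_sum.
apply: (conv_ker_inj a0 a1 ltr01 l1 (sz i)); first exact: singD.
move=> t t0.
(* The coupling term common to both expansions of the sum of y_j * z_j. The transpose in the
   equation of [y] is what makes the two occurrences of [A] carry the same indices. *)
pose W : R := \sum_l \sum_j
  A l j * conv k (conv (fun s => y s l ord0) (fun s => z s j ord0)) t.
have E1 : \sum_j conv (fun s => y s j ord0) (fun s => z s j ord0) t =
   conv k (fun s => z s i ord0) t + W.
  have e j : conv (fun s => y s j ord0) (fun s => z s j ord0) t =
     (j == i)%:R * conv k (fun s => z s j ord0) t +
     \sum_l A l j * conv k (conv (fun s => y s l ord0) (fun s => z s j ord0)) t.
    have cz := (sz j).1.
    rewrite (convC (sy j).1 cz t0); last exact: (conv_intble a0 a1' ltr01 l1 (sy j) (sz j) t0).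
    rewrite (@eq_conv _ _ (fun s => z s j ord0) _ (fun s => (j == i)%:R * k s +
       \sum_l A l j * conv k (fun s => y s l ord0) s)) //; last 2 first.
    - exact: (sy j).1.
    - move=> s s0; rewrite {1}ey// !mxE eqxx andbT mulrC; congr (_ + _).
      by apply: eq_bigr => l _; rewrite !mxE.
    rewrite (convDr ltr01 l1 a0 a1' (sz j) _ _ t0); last 2 first.
    - exact: singZ.
    - by apply: sing_sum => [l||]; [exact: singZ|exact: ltW|].
    rewrite (convZr _ ltr01 l1 a0 a1' (sz j) sk t0).
    rewrite (convC cz sk.1 t0); last exact: (conv_intble ltr01 l1 a0 a1' (sz j) sk t0).
    congr (_ + _); rewrite (conv_sumr _ ltr01 l1 a0 a1' (sz j) _ t0); last by move=> l; exact: singZ.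
    apply: eq_bigr => l _; rewrite (convZr _ ltr01 l1 a0 a1' (sz j) (sky l) t0).
    congr (_ * _); rewrite (convC cz (sky l).1 t0); last first.
      exact: (conv_intble ltr01 l1 a0 a1' (sz j) (sky l) t0).
    exact: (conv_assoc a0 a1' a0 a1' ltr01 l1 sk (sy l) (sz j) t0).
  rewrite (eq_bigr _ (fun j _ => e j)) big_split/= /W exchange_big/=; apply: congr2 => //.
  rewrite (bigD1 i)//= eqxx mul1r big1 ?addr0// => j /negbTE ->.
  by rewrite mul0r.
have E2 : \sum_j conv (fun s => y s j ord0) (fun s => z s j ord0) t =
   \sum_j z0 j ord0 * conv k (fun s => S s j ord0) t +
   \sum_j conv k (conv (fun s => y s j ord0) (fun s => h s j ord0)) t + W.
  rewrite /W -!big_split/=; apply: eq_bigr => l _.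
  have cy := (sy l).1.
  rewrite (@eq_conv _ _ (fun s => y s l ord0) _ (fun s => (z0 l ord0 * 1 +
     conv k (fun s => h s l ord0) s) +
     \sum_j A l j * conv k (fun s => z s j ord0) s)) //; last 2 first.
  - exact: (sz l).1.
  - move=> s s0; rewrite {1}ez// !mxE mulr1 addrAC; congr (_ + _).
    by apply: eq_bigr => j _; rewrite !mxE.
  have sc : sing 1 (fun=> z0 l ord0 * 1) by exact: sing_cst.
  rewrite (convDr a0 a1' ltr01 l1 (sy l) _ _ t0); last 2 first.
  - exact: singD.
  - by apply: sing_sum => // j; exact: singZ.
  rewrite (convDr a0 a1' ltr01 l1 (sy l) sc (skh l) t0).
  rewrite (convZr _ a0 a1' ltr01 l1 (sy l) (sing_cst 1) t0).
  have add3 (p q r p' q' r' : R) : p = p' -> q = q' -> r = r' -> p + q + r = p' + q' + r'.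
    by move=> -> -> ->.
  apply: add3.
  - congr (_ * _).
    have := vconv_primitive a0 a1 sy ey t0; rewrite -/S => /matrixP/(_ l ord0).
    rewrite !mxE => ->; apply: convC => //; first exact: (sing_cst 1).1.
    exact: (conv_intble a0 a1' ltr01 l1 (sy l) (sing_cst 1) t0).
  - exact: (conv_swap a0 a1' a0 a1' ltr01 l1 (sy l) sk (sh l) t0).
  - rewrite (conv_sumr _ a0 a1' ltr01 l1 (sy l) _ t0); last by move=> j; exact: singZ.
    apply: eq_bigr => j _; rewrite (convZr _ a0 a1' ltr01 l1 (sy l) (skz j) t0).
    by congr (_ * _); exact: (conv_swap a0 a1' a0 a1' ltr01 l1 (sy l) sk (sz j) t0).
have /addIr -> := etrans (esym E1) E2.
rewrite (convDr a0 a1' ltr01 l1 sk sSz sH t0); congr (_ + _).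
  rewrite (conv_sumr _ a0 a1' ltr01 l1 sk _ t0).
    apply: eq_bigr => j _; rewrite -(convZr _ a0 a1' ltr01 l1 sk (sS j) t0).
    by congr conv; apply/funext => s; rewrite mulrC.
  move=> j; apply: (@eq_sing _ 1 (fun t => z0 j ord0 * S t j ord0)).
    by move=> s s0; rewrite mulrC.
  by apply: singZ; exact: sS.
by rewrite (conv_sumr _ a0 a1' ltr01 l1 sk _ t0).
Qed.

(** The late half of [f] meets the early values of [g], and the early half of [f] the recent ones. A
    small mass of [f] on (t/2, t) therefore makes the distant past of [g] negligible. *)
Lemma conv_split_bound (f g : R -> R) (C D H1 H2 t : R) : 0 < t -> 0 <= H1 -> 0 <= H2 ->
  sing al f -> sing 1 g -> rint 0 t (fun s => `|f s|) <= D ->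
  rint (t / 2) t (fun s => `|f s|) <= C ->
  (forall s, 0 < s -> s < t -> `|g s| <= H1) ->
  (forall s, t / 2 < s -> s < t -> `|g s| <= H2) ->
  `|conv f g t| <= C * H1 + D * H2.
Proof.
move=> t0 H10 H20 sf sg hD hC g1 g2; have a1' := ltW a1.
have i := conv_intble a0 a1' ltr01 (lexx _) sf sg t0.
have fi : intble 0 t (fun s => `|f s|) by exact: sing_intble a0 (sing_norm sf) t0.
have j := conv_intble ltr01 (lexx _) a0 a1' sg sf t0.
rewrite (convC sf.1 sg.1 t0 i) /conv.
have th : 0 < t / 2 /\ t / 2 < t by split; lra.
rewrite (rint_chasles (ltW th.1) (ltW th.2) j).
apply: (le_trans (ler_normD _ _)); rewrite addrC; apply: lerD.
  apply: (@le_trans _ _ (rint (t / 2) t (fun s => H1 * `|f s|))).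
    apply: norm_rint_le; first exact: intble_measurable_oo (intbleS (ltW th.1) (lexx _) j).
      by apply: intbleZ; exact: intbleS (ltW th.1) (lexx _) fi.
    move=> s s1 s2; rewrite normrM ler_wpM2r//; apply: g1; first by rewrite subr_gt0.
    by rewrite gtrBl (lt_trans th.1).
  rewrite rintZ; last exact: intbleS (ltW th.1) (lexx _) fi.
  by rewrite mulrC ler_wpM2r.
apply: (@le_trans _ _ (rint 0 (t / 2) (fun s => H2 * `|f s|))).
  apply: norm_rint_le; first exact: intble_measurable_oo (intbleS (lexx _) (ltW th.2) j).
    by apply: intbleZ; exact: intbleS (lexx _) (ltW th.2) fi.
  move=> s s1 s2; rewrite normrM ler_wpM2r//; apply: g2; last by rewrite gtrBl.
  by lra.
rewrite rintZ; last exact: intbleS (lexx _) (ltW th.2) fi.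
rewrite mulrC ler_wpM2r//; apply: le_trans hD.
by apply: rint_le_sub (lexx _) (ltW th.1) (ltW th.2) fi _.
Qed.

(** The first estimate gives boundedness. The second expresses fading memory: after [T0] the initial
    value and the bound on the whole forcing count only with the small factor [e], while the gain
    [D] bears on the forcing over (t/2, t) alone. *)
Lemma forced_solution_bound : exists CS D : R, [/\ 0 <= CS, 0 <= D,
  forall (z0 : 'cV[R]_d) h z (H t : R), forced_solution z0 h z -> 0 < t -> 0 <= H ->
    (forall s : R, 0 < s -> s < t -> `|h s| <= H) -> `|z t| <= CS * `|z0| + D * H &
  forall e : R, 0 < e -> exists2 T0 : R, 0 < T0 & forall (z0 : 'cV[R]_d) h z (H1 H2 t : R),
    forced_solution z0 h z -> T0 <= t -> 0 <= H1 -> 0 <= H2 ->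
    (forall s : R, 0 < s -> s < t -> `|h s| <= H1) ->
    (forall s, t / 2 < s -> s < t -> `|h s| <= H2) ->
    `|z t| <= e * `|z0| + e * H1 + D * H2].
Proof.
have a1' := ltW a1.
have secT l : eigenvalue (map_mx (fun r : R => complex.Complex r 0) A^T) l -> in_sector al l.
  by rewrite -map_trmx eigenvalue_trmx; exact: sec.
have /choice[y hy] : forall i : 'I_d, exists y : R -> 'cV[R]_d, vsing al y /\
   (forall t, 0 < t -> y t = k t *: delta_mx i ord0 + A^T *m vconv k y t) /\
   exists kap C D E : R, [/\ 0 < kap, 0 <= C, 0 <= D, 0 <= E &
    [/\ forall T j, 0 < T -> rint 0 T (fun s => `|y s j ord0|) <= D,
      forall T j, 0 < T -> `|primitive A^T (delta_mx i ord0) y T j ord0| <= E,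
      forall T j, 1 <= T -> rint T (2 * T) (fun s => `|y s j ord0|) <= C * T `^ (- kap) &
      forall T j, 1 <= T -> `|primitive A^T (delta_mx i ord0) y (2 * T) j ord0| <=
        C * T `^ (- kap)]].
  move=> i; have [y [sy ey [kap [C [k0 C0 h1 h2]]]]] := resolvent_decay (delta_mx i ord0) a0 a1 secT.
  exists y; split=> //; split=> //.
  have /choice[D hD] : forall j : 'I_d, exists D : R, 0 <= D /\
      forall T, 0 < T -> rint 0 T (fun s => `|y s j ord0|) <= D.
    move=> j; have [D D0 hD] := dyadic_integral_bound a0 a1' C0 k0 (sy j) (fun T => h1 T j).
    by exists D.
  have [E E0 hE] := vsing_norm (vsing_primitive A^T (delta_mx i ord0) a0 a1 sy) (ltr0n R 2).
  exists kap, C, (\sum_j D j), (E + C); split=> //.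
  - by apply: sumr_ge0 => j _; exact: (hD j).1.
  - exact: addr_ge0.
  split=> //.
    move=> T j T0; apply: (le_trans ((hD j).2 T T0)); rewrite (bigD1 j)//= lerDl.
    by apply: sumr_ge0 => l _; exact: (hD l).1.
  move=> T j T0; have [T2|T2] := leP T 2.
    apply: (le_trans (mx_entry_le _ _)); apply: (le_trans (hE T T0 T2)).
    by rewrite subrr powRr0 mulr1 lerDl.
  have T1 : 1 <= T / 2 by lra.
  have := h2 (T / 2) j T1; rewrite (_ : 2 * (T / 2) = T); last by field.
  move/le_trans; apply; apply: (@le_trans _ _ C); last by rewrite lerDr.
  by rewrite ler_piMr// powR_le1//; lra.
have sy i : vsing al (y i) by have [] := hy i.
have ey i t : 0 < t -> y i t = k t *: delta_mx i ord0 + A^T *m vconv k (y i) t.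
  by have [_ [h _]] := hy i; exact: h.
have /choice[kap] : forall i, exists kap : R, exists C D E : R, [/\ 0 < kap, 0 <= C, 0 <= D, 0 <= E &
    [/\ forall T j, 0 < T -> rint 0 T (fun s => `|y i s j ord0|) <= D,
      forall T j, 0 < T -> `|primitive A^T (delta_mx i ord0) (y i) T j ord0| <= E,
      forall T j, 1 <= T -> rint T (2 * T) (fun s => `|y i s j ord0|) <= C * T `^ (- kap) &
      forall T j, 1 <= T -> `|primitive A^T (delta_mx i ord0) (y i) (2 * T) j ord0| <=
        C * T `^ (- kap)]].
  by move=> i; have [_ []] := hy i.
move=> /choice[C] /choice[D] /choice[E] {}hy.
have C0 i : 0 <= C i by have [] := hy i.
have D0 i : 0 <= D i by have [] := hy i.
have E0 i : 0 <= E i by have [] := hy i.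
(* The factor 2 in [Ds] serves the first estimate, where both halves of the convolution are bounded
   by the full mass of the resolvent. *)
pose Es := d%:R * \sum_i E i; pose Ds := 2 * (d%:R * \sum_i D i).
have Es0 : 0 <= Es by rewrite mulr_ge0// sumr_ge0.
have Ds0 : 0 <= Ds by rewrite !mulr_ge0// sumr_ge0.
have leS (F : 'I_d -> R) i : (forall i, 0 <= F i) -> d%:R * F i <= d%:R * \sum_i F i.
  by move=> F0; rewrite ler_wpM2l// (bigD1 i)//= lerDl sumr_ge0.
have zb (z0 : 'cV[R]_d) h z (t : R) i (e c D' H1 H2 : R) : forced_solution z0 h z -> 0 < t -> 0 <= e ->
    0 <= H1 -> 0 <= H2 ->
    (forall j, `|primitive A^T (delta_mx i ord0) (y i) t j ord0| <= e) ->
    (forall j, rint 0 t (fun s => `|y i s j ord0|) <= D') ->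
    (forall j, rint (t / 2) t (fun s => `|y i s j ord0|) <= c) ->
    (forall s : R, 0 < s -> s < t -> `|h s| <= H1) ->
    (forall s, t / 2 < s -> s < t -> `|h s| <= H2) ->
    `|z t i ord0| <= d%:R * e * `|z0| + (d%:R * c * H1 + d%:R * D' * H2).
  move=> sol t0 e0 H10 H20 hS hD hc hh1 hh2; have [_ sh _] := sol.
  rewrite (variation_of_constants (sy i) (ey i) sol t0).
  apply: (le_trans (ler_normD _ _)); apply: lerD.
    apply: (le_trans (ler_norm_sum _ _ _)).
    apply: (@le_trans _ _ (\sum_(j < d) e * `|z0|)).
      apply: ler_sum => j _; rewrite normrM; apply: ler_pM => //.
      exact: mx_entry_le.
    by rewrite sumr_const card_ord -mulrA mulr_natl.
  apply: (le_trans (ler_norm_sum _ _ _)).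
  apply: (@le_trans _ _ (\sum_(j < d) (c * H1 + D' * H2))).
    apply: ler_sum => j _; apply: (conv_split_bound t0 H10 H20 (sy i j) (sh j) (hD j) (hc j)).
      by move=> s s0 st; apply: le_trans (mx_entry_le _ _) (hh1 s s0 st).
    by move=> s s0 st; apply: le_trans (mx_entry_le _ _) (hh2 s s0 st).
  by rewrite sumr_const card_ord -!mulrA -mulrDr mulr_natl.
exists Es, Ds; split=> //.
  move=> z0 h z H t sol t0 H0 hh; apply: mx_norm_le.
    by rewrite addr_ge0// mulr_ge0.
  move=> i; have [_ _ _ _ [h1 h2 _ _]] := hy i.
  have hc j : rint (t / 2) t (fun s => `|y i s j ord0|) <= D i.
    apply: le_trans (h1 t j t0).
    apply: (rint_le_sub _ _ (lexx t)) => //; [lra|lra|].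
    exact: sing_intble a0 (sing_norm (sy i j)) t0.
  have hh' s : t / 2 < s -> s < t -> `|h s| <= H by move=> s1 s2; apply: hh => //; lra.
  have := zb z0 h z t i _ _ _ _ _ sol t0 (E0 i) H0 H0 (fun j => h2 t j t0) (fun j => h1 t j t0) hc hh hh'.
  move/le_trans; apply; apply: lerD; first by rewrite ler_wpM2r// leS.
  rewrite (_ : _ + _ = 2 * (d%:R * D i) * H); last by ring.
  by rewrite ler_wpM2r// /Ds ler_pM2l//; exact: leS.
move=> e e0.
have /choice[T hT] : forall i : 'I_d, exists T : R, 1 <= T /\ forall t : R, T <= t -> d%:R * (C i * t `^ (- kap i)) <= e.
  move=> i; have [k0 _ _ _ _] := hy i.
  have [T T1 hT] := powR_decay (d%:R * C i) k0 e0.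
  by exists T; split => // t Tt; rewrite mulrA; exact: hT.
have T1 i : 1 <= T i by exact: (hT i).1.
have T0 i : 0 <= T i by exact: le_trans (T1 i).
pose Ts := 1 + \sum_i T i.
have Ts1 : 1 <= Ts by rewrite lerDl sumr_ge0.
have leT i : T i <= Ts by rewrite /Ts (bigD1 i)//= addrCA lerDl addr_ge0// sumr_ge0.
(* The decay estimates are used on (t/2, t), hence with t/2 beyond all the thresholds. *)
exists (2 * Ts); first by rewrite mulr_gt0// (lt_le_trans ltr01).
move=> z0 h z H1 H2 t sol Tt H10 H20 hh1 hh2.
have th : Ts <= t / 2 by lra.
have t0 : 0 < t by lra.
apply: mx_norm_le; first by rewrite !addr_ge0// mulr_ge0// ltW.
move=> i; have [_ _ _ _ [h1 _ h3 h4]] := hy i.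
have t1 : 1 <= t / 2 by exact: le_trans th.
have t2 : 2 * (t / 2) = t by field.
have hS j := h4 (t / 2) j t1; have hc j := h3 (t / 2) j t1; rewrite t2 in hS hc.
have c0 : 0 <= C i * (t / 2) `^ (- kap i) by rewrite mulr_ge0 ?powR_ge0.
have := zb z0 h z t i _ _ _ _ _ sol t0 c0 H10 H20 hS (fun j => h1 t j t0) hc hh1 hh2.
have he := (hT i).2 (t / 2) (le_trans (leT i) th).
move/le_trans; apply; rewrite addrA; apply: lerD.
  by apply: lerD; rewrite ler_wpM2r.
rewrite ler_wpM2r// /Ds (le_trans (leS D i D0))// ler_peMl ?ler1n//.
by rewrite mulr_ge0// sumr_ge0.
Qed.

End linear_system.

(** * A Lipschitz retraction onto a ball *)

Section truncation.
Context {R : realType}.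

Definition clamp1 (r a : R) : R := Num.max (- r) (Num.min r a).

Lemma clamp1_le (r a : R) : 0 <= r -> `|clamp1 r a| <= r.
Proof.
move=> r0; rewrite ler_norml /clamp1 le_max lexx/= ge_max ge_min lexx/= andbT.
lra.
Qed.

Lemma clamp1_id (r a : R) : `|a| <= r -> clamp1 r a = a.
Proof. by rewrite ler_norml /clamp1 => /andP[h1 h2]; rewrite min_r// max_r. Qed.

Lemma clamp1_lip (r a b : R) : 0 <= r -> `|clamp1 r a - clamp1 r b| <= `|a - b|.
Proof.
move=> r0; wlog ab : a b / a <= b => [h|].
  by have [/h//|/ltW/h] := leP a b; rewrite distrC [leRHS]distrC.
rewrite distrC [leRHS]distrC (ger0_norm (_ : 0 <= b - a)) ?subr_ge0//.
rewrite /clamp1; case: (leP r a) => h1; case: (leP r b) => h2;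
  rewrite ?(min_l h1) ?(min_l h2) ?(min_r (ltW h1)) ?(min_r (ltW h2)).
- by rewrite subrr normr0 subr_ge0.
- lra.
- rewrite (max_r (_ : - r <= r)); last by lra.
  case: (leP (- r) a) => h3; rewrite ger0_norm; lra.
- case: (leP (- r) a) => h3; case: (leP (- r) b) => h4; rewrite ger0_norm; lra.
Qed.

(** Columns carry the sup norm, so clamping each entry is a retraction onto the ball of radius [r]
    with Lipschitz constant 1. *)
Definition clamp {d : nat} (r : R) (x : 'cV[R]_d) : 'cV[R]_d := \col_i clamp1 r (x i ord0).

Lemma clamp_le d (r : R) (x : 'cV[R]_d) : 0 <= r -> `|clamp r x| <= r.
Proof. by move=> r0; apply: mx_norm_le => // i; rewrite mxE clamp1_le. Qed.

Lemma clamp_id d (r : R) (x : 'cV[R]_d) : `|x| <= r -> clamp r x = x.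
Proof.
move=> xr; apply/matrixP => i j; rewrite !mxE (ord1 j) clamp1_id//.
exact: le_trans (mx_entry_le _ _) xr.
Qed.

Lemma clamp_lip d (r : R) (x y : 'cV[R]_d) : 0 <= r ->
  `|clamp r x - clamp r y| <= `|x - y|.
Proof.
move=> r0; apply: mx_norm_le => // i; rewrite !mxE (le_trans (clamp1_lip _ _ r0))//.
by have := mx_entry_le (x - y) i; rewrite !mxE.
Qed.

End truncation.

(** * Stability and attractivity for the nonlinear Volterra equation *)

Section volterra_stability.
Context {R : realType} {d : nat}.
Variables (al : R) (A : 'M[R]_d) (f : 'cV[R]_d -> 'cV[R]_d).
Hypotheses (a0 : 0 < al) (a1 : al < 1).
Hypothesis sec : forall l,
  eigenvalue (map_mx (fun r : R => complex.Complex r 0) A) l -> in_sector al l.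
Hypothesis f0 : f 0 = 0.
Hypothesis flat : forall L : R, 0 < L -> exists2 r : R, 0 < r & forall x y : 'cV[R]_d,
  `|x| <= r -> `|y| <= r -> `|f x - f y| <= L * `|x - y|.

(** All conditions bear on positive times; the value of [z] at 0 is free, and the initial condition
    is a right limit. *)
Definition volterra_solution (z0 : 'cV[R]_d) (z : R -> 'cV[R]_d) :=
  [/\ vsing 1 z, vsing 1 (fun t => f (z t)), z t @[t --> 0^'+] --> z0 &
   forall t : R, 0 < t -> z t = z0 + vconv (ker al) (fun s => A *m z s + f (z s)) t].

Lemma forced_of_volterra (h : R -> 'cV[R]_d) z0 z : vsing 1 z -> vsing 1 h ->
  (forall t, 0 < t -> z t = z0 + vconv (ker al) (fun s => A *m z s + h s) t) ->
  forced_solution al A z0 h z.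
Proof.
move=> sz sh ez; split=> // t t0; rewrite {1}ez// -addrA; congr (_ + _).
have sk := sing_ker al.
rewrite (vconvD a0 (ltW a1) ltr01 (lexx _) sk _ sh t0); last exact: vsing_mulmx.
by rewrite (vconv_mulmx _ a0 (ltW a1) ltr01 (lexx _) sk sz t0).
Qed.

Lemma volterra_initial (z0 : 'cV[R]_d) (g z : R -> 'cV[R]_d) : vsing 1 g ->
  (forall t : R, 0 < t -> z t = z0 + vconv (ker al) g t) ->
  z t @[t --> 0^'+] --> z0.
Proof.
move=> sg ez; apply: cvg_vec => i.
have [C C0 hC] := conv_le_pow a0 (ltW a1) ltr01 (lexx _) (sing_ker al) (sg i) (@ltr01 R).
apply/cvgrPdist_le => e e0.
have lim : C * x `^ al @[x --> 0^'+] --> (0 : R).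
  by rewrite -[X in _ --> X](mulr0 C); apply: cvgM; [exact: cvg_cst|exact: powR_cvg0].
have h1 : \forall x \near 0^'+, C * x `^ al < e by apply: (cvgr_lt _ lim).
near=> x.
have x0 : 0 < x by near: x; exact: nbhs_right_gt.
have x1 : x <= 1 by near: x; apply: nbhs_right_le.
rewrite ez// !mxE opprD addrA subrr sub0r normrN.
apply: (le_trans (hC x x0 x1)); rewrite addrK ltW//.
by near: x.
Unshelve. all: by end_near. Qed.

(** Near the origin the gain of the linear system times the Lipschitz constant of [f] is at most
    1/4. A solution below [eps] is then below eps/2, which closes the bootstrap, and the same margin
    halves any later bound. *)
Lemma volterra_stability : exists2 r : R, 0 < r & forall eps : R, 0 < eps -> eps <= r ->
  exists2 dl : R, 0 < dl & forall z0 : 'cV[R]_d, `|z0| <= dl ->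
    (exists z, volterra_solution z0 z) /\
    (forall z, volterra_solution z0 z ->
      (forall t : R, 0 < t -> `|z t| <= eps) /\ z t @[t --> +oo] --> (0 : 'cV[R]_d)).
Proof.
have [CS [D [CS0 D0 hbound hdecay]]] := forced_solution_bound a0 a1 sec.
(* Chosen so that D l <= 1/4; the added 1 covers D = 0. *)
pose l : R := (4 * (D + 1))^-1.
have D1 : 0 < 4 * (D + 1) by rewrite mulr_gt0// ltr_wpDl.
have l0 : 0 < l by rewrite invr_gt0.
have Dl : D * l <= 4^-1.
  rewrite /l ler_pdivrMr// mulrA mulVf ?mul1r; last by rewrite pnatr_eq0.
  by rewrite lerDl.
have [r r0 hr] := flat l0.
exists r => // eps e0 er.
have fb (x : 'cV[R]_d) : `|x| <= r -> `|f x| <= l * `|x|.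
  by move=> xr; have := hr x 0 xr; rewrite f0 !subr0 normr0 => /(_ (ltW r0)).
have Dlb (b : R) : 0 <= b -> D * (l * b) <= b / 4.
  by move=> b0; rewrite mulrA mulrC ler_wpM2l.
(* Makes the contribution CS |z0| of the initial value, and |z0| itself, at most eps/4. *)
pose dl : R := eps / (4 * (CS + 1)).
have CS1 : 0 < 4 * (CS + 1) by rewrite mulr_gt0// ltr_wpDl.
have dl0 : 0 < dl by rewrite divr_gt0.
have CSd : CS * dl <= eps / 4.
  rewrite /dl mulrCA ler_pM2l// ler_pdivrMr// mulrA mulVf ?mul1r; last by rewrite pnatr_eq0.
  by rewrite lerDl.
have dle : dl <= eps / 4.
  rewrite /dl ler_pM2l// lef_pV2 ?posrE// ler_peMr//.
  by rewrite lerDr.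
exists dl => // z0 z0d.
have CSz : CS * `|z0| <= eps / 4 by apply: le_trans CSd; rewrite ler_wpM2l.
have half : eps / 4 + eps / 4 = eps / 2 by field.
split.
  (* The truncated field is globally Lipschitz, so [picard] applies; the a priori bound then shows
     that the truncation never acts. *)
  pose F (x : 'cV[R]_d) : 'cV[R]_d := A *m x + f (clamp eps x).
  have [LA LA0 hLA] := lipschitz_mulmx A.
  have clr (x : 'cV[R]_d) : `|clamp eps x| <= r by exact: le_trans (clamp_le _ (ltW e0)) er.
  have hF : lipschitz_map F (LA + l).
    move=> u v; rewrite /F opprD addrACA mulrDl.
    apply: (le_trans (ler_normD _ _)); apply: lerD; first exact: hLA.
    apply: (le_trans (hr _ _ (clr u) (clr v))); rewrite ler_pM2l//.
    exact: clamp_lip (ltW e0).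
  have lipfc : lipschitz_map (fun x => f (clamp eps x)) l.
    move=> u v; apply: (le_trans (hr _ _ (clr u) (clr v))); rewrite ler_pM2l//.
    exact: clamp_lip (ltW e0).
  have c0 : clamp eps (0 : 'cV[R]_d) = 0 by rewrite clamp_id// normr0 ltW.
  have F0 : F 0 = 0 by rewrite /F mulmx0 add0r c0.
  have [||z [sz ez]] := @picard R d al 1 (LA + l) `|z0| F (fun=> z0) a0 (ltW a1) ltr01 (lexx _)
     (addr_ge0 LA0 (ltW l0)) hF F0.
  - by move=> i t _; exact: cvg_cst.
  - by move=> t t0; rewrite subrr powRr0 mulr1.
  have sfc : vsing 1 (fun t => f (clamp eps (z t))).
    by apply: (vsing_comp (ltW l0) lipfc) => //; rewrite c0.
  have sol := forced_of_volterra sz sfc ez.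
  have zb (t : R) : 0 < t -> `|z t| <= eps.
    move=> t0; have := hbound z0 _ z (l * eps) t sol t0.
    move=> /(_ (mulr_ge0 (ltW l0) (ltW e0))) h.
    apply: le_trans (h _) _.
      move=> s s0 st; apply: (le_trans (fb _ (clr _))); rewrite ler_pM2l//.
      exact: clamp_le (ltW e0).
    have := Dlb eps (ltW e0); lra.
  have fE (t : R) : 0 < t -> f (clamp eps (z t)) = f (z t) by move=> t0; rewrite clamp_id// zb.
  have sfz : vsing 1 (fun t => f (z t)).
    by move=> i; apply: eq_sing (sfc i) => t t0; rewrite fE.
  have eG (t : R) : 0 < t -> z t = z0 + vconv (ker al) (fun s => A *m z s + f (z s)) t.
    move=> t0; rewrite {1}ez//; apply: congr1.
    apply: (@eq_vconv _ _ 1); first exact: (sing_ker al).1.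
      by apply: vsingD => //; exact: vsing_mulmx.
    by move=> s s0; rewrite /F fE.
  exists z; split=> //.
  have sG : vsing 1 (fun s => A *m z s + f (z s)) by apply: vsingD => //; exact: vsing_mulmx.
  exact: volterra_initial sG eG.
move=> z [sz sfz z0z ez].
have sol := forced_of_volterra sz sfz ez.
have zb (t1 : R) : 0 < t1 -> `|z t1| <= eps.
  move=> t10; rewrite leNgt; apply/negP => zt1.
  (* First exit: up to the supremum of [E] the bound holds, so at that time the solution is below
     eps/2, and continuity extends the bound further, a contradiction. *)
  pose E : set R := [set T | 0 < T /\ forall s, 0 < s -> s < T -> `|z s| <= eps].
  have [e [e1 he]] : exists e, E e.
    have : \forall t \near 0^'+, `|z0 - z t| <= eps / 4.
      by move/cvgrPdist_le : z0z; apply; rewrite divr_gt0.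
    move=> [e /= e1 he]; exists e; split=> // s s0 se.
    have := he s; rewrite /ball/= sub0r normrN (gtr0_norm s0) => /(_ se s0) h.
    rewrite -(subrK z0 (z s)); apply: (le_trans (ler_normD _ _)).
    rewrite distrC; lra.
  have Eub : ubound E t1.
    move=> T [T0 hT]; rewrite leNgt; apply/negP => /(hT _ t10).
    by rewrite leNgt zt1.
  have hs : has_sup E by split; [exists e|exists t1].
  set Ts := sup E.
  have Ts0 : 0 < Ts.
    by apply: (lt_le_trans e1); apply: ub_le_sup => //; exists t1.
  have below s : 0 < s -> s < Ts -> `|z s| <= eps.
    by move=> s0 /(sup_gt hs.1)[T [T0 hT] sT]; exact: hT.
  have zTs : `|z Ts| <= eps / 2.
    have := hbound z0 _ z (l * eps) Ts sol Ts0 (mulr_ge0 (ltW l0) (ltW e0)).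
    move=> h; apply: le_trans (h _) _.
      move=> s s0 st; have b := below s s0 st.
      by apply: (le_trans (fb _ (le_trans b er))); rewrite ler_pM2l.
    have := Dlb eps (ltW e0); lra.
  have : \forall x \near Ts, `|z Ts - z x| <= eps / 2.
    have := vsing_cont sz Ts0 => /cvgrPdist_le; apply; by rewrite divr_gt0.
  move=> [eta /= eta0 heta].
  have : E (Ts + eta / 2).
    split; first by rewrite addr_gt0// divr_gt0.
    move=> s s0 se; have [/(below s s0)//|Tss] := ltP s Ts.
    have := heta s; rewrite /ball/= distrC ger0_norm ?subr_ge0// => h.
    rewrite -(subrK (z Ts) (z s)); apply: (le_trans (ler_normD _ _)).
    have {}h := h (_ : s - Ts < eta).
    rewrite distrC; apply: (le_trans (lerD (h _) zTs)); lra.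
  move=> /(ub_le_sup (ex_intro _ t1 Eub)); rewrite -/Ts; lra.
split=> //.
have zr (t : R) : 0 < t -> `|z t| <= r by move=> t0; exact: le_trans (zb t t0) er.
(* If |z| <= b from time [T] on, then after 2T the interval (t/2, t) lies in that range: the recent
   forcing contributes at most b/4, the past another b/4, and the bound is halved. *)
have small (n : nat) : exists2 T : R, 0 < T & forall t, T <= t -> `|z t| <= r / 2 ^+ n.
  elim: n => [|n [T T0 hT]].
    by exists 1 => // t t1; rewrite expr0 divr1 zr// (lt_le_trans ltr01).
  pose b : R := r / 2 ^+ n.
  have b0 : 0 < b by rewrite divr_gt0// exprn_gt0.
  (* Makes e (|z0| + l r) <= b/4; the added 1 keeps the denominator positive. *)
  pose e : R := b / 4 / (`|z0| + l * r + 1).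
  have s0 : 0 < `|z0| + l * r + 1 by rewrite ltr_wpDl// addr_ge0// mulr_ge0// ltW.
  have ee : 0 < e by rewrite !divr_gt0.
  have [T1 T10 hT1] := hdecay e ee.
  exists (Num.max (2 * T) T1); first by rewrite lt_max T10 orbT.
  move=> t; rewrite ge_max => /andP[Tt T1t].
  have t0 : 0 < t by exact: lt_le_trans T1t.
  have := hT1 z0 _ z (l * r) (l * b) t sol T1t (mulr_ge0 (ltW l0) (ltW r0)) (mulr_ge0 (ltW l0) (ltW b0)).
  move=> h; apply: le_trans (h _ _) _.
  - by move=> s s1 _; apply: (le_trans (fb _ (zr s s1))); rewrite ler_pM2l// zr.
  - move=> s s1 _; have Ts : T <= s by lra.
    by apply: (le_trans (fb _ (zr s (lt_le_trans T0 Ts)))); rewrite ler_pM2l// hT.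
  have h1 : e * `|z0| + e * (l * r) <= b / 4.
    rewrite -mulrDr /e mulrAC ler_pdivrMr// ler_pM2l ?divr_gt0//.
    by rewrite lerDl.
  have h2 := Dlb b (ltW b0).
  have -> : r / 2 ^+ n.+1 = b / 2 by rewrite /b exprSr invfM mulrA.
  lra.
apply/cvgr0Pnorm_le => e ee.
have [n hn] := half_pow_small r ee.
have [T T0 hT] := small n.
near=> t; apply: le_trans (ltW hn); apply: hT.
near: t; exact: nbhs_pinfty_ge (num_real T).
Unshelve. all: by end_near. Qed.

End volterra_stability.

(** * Positivity of the Gamma integral *)

Section gamma_positivity.
Context {R : realType}.

(** A divergent integral would have real value 0, so finiteness must be proved: the power dominates
    on (0, 1], the exponential beyond 1. Positivity comes from the lower bound e^(-1) on (0, 1]. *)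
Lemma Gamma_gt0 (z : R) : 0 < z -> z <= 1 -> 0 < Gamma z.
Proof.
move=> z0 z1; pose F (s : R) : R := s `^ (z - 1) * expR (- s).
pose mu := @lebesgue_measure R.
have F0 s : 0 <= F s by rewrite mulr_ge0 ?powR_ge0 ?expR_ge0.
have cF (s : R) : 0 < s -> {for s, continuous F}.
  move=> s0; apply: cvgM; first exact: powR_contoo.
  by apply: (@cvg_cont R R _ _ (@expR R)); [exact: continuous_expR|apply: cvgN; exact: cvg_id].
have mF : measurable_fun `](0 : R), +oo[ F.
  apply: open_continuous_measurable_fun; first exact: interval_open.
  by move=> s; rewrite inE/= in_itv/= andbT; exact: cF.
have mFE (D : set (measurableTypeR R)) : measurable D -> D `<=` `](0 : R), +oo[ -> measurable_fun D (EFin \o F).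
  by move=> mD sD; apply/measurable_EFinP; exact: measurable_funS sD mF.
have s1 : `](0 : R)%R, (1 : R)%R] `<=` `](0 : R)%R, +oo[.
  by move=> s /=; rewrite !in_itv/= andbT => /andP[].
have s2 : `](1 : R)%R, +oo[ `<=` `](0 : R)%R, +oo[.
  by move=> s /=; rewrite !in_itv/= !andbT; exact: lt_trans.
have dom (s : R) : 0 < s -> s <= 1 -> expR (- 1) <= F s.
  move=> s0 s1'; rewrite -[leLHS]mul1r; apply: ler_pM; rewrite ?expR_ge0//.
    by apply: powR_ge1 => //; rewrite subr_le0.
  by rewrite ler_expR lerN2.
have E : (\int[mu]_(s in `](0 : R)%R, +oo[) (F s)%:E)%E =
  (\int[mu]_(s in `](0 : R)%R, (1 : R)%R]) (F s)%:E + \int[mu]_(s in `](1 : R)%R, +oo[) (F s)%:E)%E.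
  have U : [set` `](0 : R), +oo[] = [set` `](0 : R), (1 : R)]] `|` [set` `](1 : R), +oo[].
    by rewrite -itv_bndbnd_setU ?bnd_simp.
  rewrite U ge0_integral_setU//=.
  - by rewrite -U; exact: mFE.
  - by move=> s _; rewrite lee_fin.
  - rewrite disj_set2E; apply/eqP/seteqP; split => // s /=.
    by rewrite !in_itv/= => -[/andP[_ h1]]; rewrite andbT ltNge h1.
have fin1 : (\int[mu]_(s in `](0 : R)%R, (1 : R)%R]) (F s)%:E < +oo)%E.
  apply: integrable_lty => //.
  have i : intble 0 1 F.
    apply: (@le_intble _ 0 1 _ (fun s => s `^ (z - 1))); last exact: (rint_pow z0 ltr01).1.
      by apply: contoo_measurable => s s0 _; exact: cF.
    move=> s s0 _; rewrite ger0_norm// ler_piMr ?powR_ge0//.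
    by rewrite -[leRHS]expR0 ler_expR oppr_le0 ltW.
  apply: integrableS i => //.
  by move=> s /=; rewrite !in_itv/= => /andP[/ltW -> ->].
have dexp (s : R) : is_derive s 1 (fun x : R => - expR (- x)) (expR (- s)).
  have d1 := @is_derive1_comp R (@expR R) -%R s _ _ (is_derive_expR (- s))
    (is_deriveN (is_derive_id s (1 : R))).
  by apply: (is_derive_eq (is_deriveN d1)); rewrite mulrN1 opprK.
have e1 : (\int[mu]_(s in `[(1 : R)%R, +oo[) (expR (- s))%:E = (0%R)%:E - (- expR (- 1))%:E)%E.
  apply: (@ge0_continuous_FTC2y R (fun s => expR (- s)) (fun s => - expR (- s))).
  - by move=> s _; exact: expR_ge0.
  - apply: continuous_subspaceT => s.
    by apply: (@cvg_cont R R _ _ (@expR R)); [exact: continuous_expR|apply: cvgN; exact: cvg_id].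
  - by rewrite -[X in _ --> X]oppr0; apply: cvgN; exact: cvgr_expR.
  - by move=> s _; exact: (@ex_derive _ _ _ _ _ _ _ (dexp s)).
  - apply: cvg_at_right_filter; apply: cvgN.
    by apply: (@cvg_cont R R _ _ (@expR R)); [exact: continuous_expR|apply: cvgN; exact: cvg_id].
  - by move=> s _; rewrite derive1E (@derive_val _ _ _ _ _ _ _ (dexp s)).
have fin2 : (\int[mu]_(s in `](1 : R)%R, +oo[) (F s)%:E < +oo)%E.
  apply: (@le_lt_trans _ _ (\int[mu]_(s in `[(1 : R)%R, +oo[) (expR (- s))%:E)%E); last first.
    by rewrite e1 -EFinB ltry.
  apply: (@le_trans _ _ (\int[mu]_(s in `](1 : R)%R, +oo[) (expR (- s))%:E)%E).
    apply: ge0_le_integral => //.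
    - by move=> s _; rewrite lee_fin.
    - exact: mFE.
    - apply/measurable_EFinP; apply: measurable_funTS.
      by apply: measurableT_comp => //; exact: measurable_oppr.
    - move=> s /=; rewrite in_itv/= andbT => s1'; rewrite lee_fin ler_piMl ?expR_ge0//.
      by apply: powR_le1; [exact: ltW|rewrite subr_le0].
  apply: ge0_subset_integral => //.
  - apply/measurable_EFinP; apply: measurable_funTS.
    by apply: measurableT_comp => //; exact: measurable_oppr.
  - by move=> s /=; rewrite !in_itv/= !andbT; exact: ltW.
have fin : (\int[mu]_(s in `](0 : R)%R, +oo[) (F s)%:E < +oo)%E by rewrite E lte_add_pinfty.
rewrite /Gamma /Rintegral fine_gt0//; apply/andP; split=> //.
rewrite -[X in (_ < X)%E]/(\int[mu]_(s in `](0 : R)%R, +oo[) (F s)%:E)%E.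
apply: (@lt_le_trans _ _ (\int[mu]_(s in `](0 : R)%R, (1 : R)%R]) (expR (- 1))%:E)%E).
  rewrite integral_cst//= -/mu.
  have -> : mu (`](0 : R), (1 : R)]%classic) = 1%E.
    by rewrite /mu lebesgue_measure_itv/= lte_fin ltr01 -EFinB subr0.
  by rewrite mule1 lte_fin expR_gt0.
apply: (@le_trans _ _ (\int[mu]_(s in `](0 : R)%R, (1 : R)%R]) (F s)%:E)%E).
  apply: ge0_le_integral => //.
  - exact: mFE.
  - by move=> s /=; rewrite in_itv/= => /andP[a b]; rewrite lee_fin dom.
apply: ge0_subset_integral => //; first exact: mFE.
by move=> s _; rewrite lee_fin.
Qed.

End gamma_positivity.

(** * The change of time and its inverse *)

Section time_change.
Context {R : realType}.
Variables (rho t0 : R).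
Hypotheses (rho0 : 0 < rho) (t00 : 0 < t0).
Implicit Types (s t : R).

Lemma cvg_comp_at_right (T : Type) (H : set_system T) {FH : Filter H} (phi : T -> R) (c : R) :
  (\forall x \near H, c < phi x) -> phi x @[x --> H] --> c ->
  phi x @[x --> H] --> c^'+.
Proof.
move=> hlt hc P; rewrite /at_right /within/= => hP.
have := hc _ hP; rewrite /nbhs/= => h.
by apply: filterS2 hlt h => x h1; apply.
Qed.

(** Extended by its limit, the function is continuous on the compact [0, T], and its absolute value
    has a maximum there. *)
Lemma sing1_of_cvg (g : R -> R) (l : R) : contp g -> g t @[t --> 0^'+] --> l -> sing 1 g.
Proof.
move=> cg gl; split=> // T T0.
pose h (t : R) : R := `|if t <= 0 then l else g t|.
have ch : {within `[0, T], continuous h}.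
  have hg t : 0 < t -> {for t, continuous h}.
    move=> t0'; apply: (@near_eq_continuous_at _ _ (fun t => `|g t|)); last first.
      by apply: cvg_norm; exact: cg.
    have : \forall x \near t, 0 < x by exact: lt_nbhsr.
    by apply: filterS => x x0; rewrite /h leNgt x0.
  apply/continuous_within_itvP => //; split.
  - by move=> t; rewrite in_itv/= => /andP[? _]; exact: hg.
  - rewrite {2}/h lexx; apply: (@cvg_trans _ ((fun t => `|g t|) @ 0^'+)).
      apply: near_eq_cvg; near=> x; rewrite /h leNgt.
      by have -> : 0 < x by near: x; exact: nbhs_right_gt.
    exact: cvg_norm.
  - by apply: cvg_at_left_filter; exact: hg.
have [c _ hc] := EVT_max (ltW T0) ch.
exists (h c); first exact: normr_ge0.
move=> t t0' tT; rewrite subrr powRr0 mulr1.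
have := hc t; rewrite in_itv/= (ltW t0') tT => /(_ isT).
by rewrite {1}/h (leNgt t 0) t0'.
Unshelve. all: by end_near. Qed.

Definition ktime t : R := t `^ rho - t0 `^ rho.
Definition ktime_inv s : R := (s + t0 `^ rho) `^ rho^-1.
Local Notation tau := ktime.
Local Notation tinv := ktime_inv.

Let p0 : 0 < t0 `^ rho. Proof. exact: powR_gt0. Qed.

Lemma tau_lt s t : 0 < s -> s < t -> tau s < tau t.
Proof.
move=> s0 st; rewrite ltrD2r gt0_ltr_powR// nnegrE ltW//.
exact: lt_trans st.
Qed.

Lemma tau_t0 : tau t0 = 0. Proof. exact: subrr. Qed.

Lemma tau_gt0 t : t0 < t -> 0 < tau t.
Proof. by move=> h; rewrite -tau_t0; exact: tau_lt. Qed.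

Lemma tauK t : 0 < t -> tinv (tau t) = t.
Proof.
by move=> h; rewrite /ktime_inv /ktime subrK -powRrM mulfV ?powRr1 ?(ltW h)// gt_eqF.
Qed.

Lemma tinvK s : 0 < s -> tau (tinv s) = s.
Proof.
move=> h; rewrite /ktime_inv /ktime -powRrM mulVf ?gt_eqF// powRr1 ?addrK//.
by rewrite addr_ge0// ltW.
Qed.

Lemma tinv_gt s : 0 < s -> t0 < tinv s.
Proof.
move=> h; rewrite -{1}(tauK t00) tau_t0 /ktime_inv gt0_ltr_powR ?invr_gt0// ?nnegrE ?ltrD2r//.
- by rewrite add0r ltW.
- by rewrite addr_ge0// ltW.
Qed.

Lemma tau_derive t : 0 < t -> is_derive t 1 tau (rho * t `^ (rho - 1)).
Proof.
move=> h; have d := is_derive1_powR rho h.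
have e := @is_deriveB R R R _ _ t 1 _ _ d (is_derive_cst (t0 `^ rho) t 1).
by apply: (is_derive_eq e); rewrite subr0.
Qed.

Lemma tinv_derive s : 0 < s -> is_derive s 1 tinv (rho^-1 * tinv s `^ (1 - rho)).
Proof.
move=> h; have q0 : 0 < s + t0 `^ rho by rewrite addr_gt0.
have d1 := is_derive1_powR rho^-1 q0.
have d2 := @is_deriveD R R R _ _ s 1 _ _ (is_derive_id s 1) (is_derive_cst (t0 `^ rho) s 1).
have e := @is_derive1_comp R (fun y => y `^ rho^-1) (id + cst (t0 `^ rho)) s _ _ d1 d2.
apply: (is_derive_eq e); rewrite addr0 mulr1 /ktime_inv -powRrM; congr (_ * _ `^ _).
by field; rewrite gt_eqF.
Qed.

Lemma tau_cont t : 0 < t -> {for t, continuous tau}.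
Proof. by move=> h; apply: cvgB; [exact: powR_contoo|exact: cvg_cst]. Qed.

Lemma tinv_cont s : 0 <= s -> {for s, continuous tinv}.
Proof.
move=> h; apply: (@cvg_cont_at R _ _ _ (fun x => x `^ rho^-1)).
  by apply: powR_contoo; rewrite ltr_wpDl.
by apply: cvgD; [exact: cvg_id|exact: cvg_cst].
Qed.

Lemma tau_right : tau t @[t --> t0^'+] --> 0^'+.
Proof.
apply: cvg_comp_at_right.
  near=> x; apply: tau_gt0; near: x; exact: nbhs_right_gt.
by rewrite -tau_t0; apply: cvg_at_right_filter; exact: tau_cont.
Unshelve. all: by end_near. Qed.

Lemma tinv_right : tinv s @[s --> 0^'+] --> t0^'+.
Proof.
apply: cvg_comp_at_right.
  near=> x; apply: tinv_gt; near: x; exact: nbhs_right_gt.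
rewrite -[X in _ --> X](tauK t00) tau_t0; apply: cvg_at_right_filter; exact: tinv_cont.
Unshelve. all: by end_near. Qed.

Lemma tau_pinfty : tau t @[t --> +oo] --> +oo.
Proof.
apply/cvgryPge => M; pose M' := Num.max M 1.
have M0 : 0 < M' by rewrite lt_max ltr01 orbT.
near=> t; apply: (@le_trans _ _ M'); first by rewrite le_max lexx.
rewrite -(tinvK M0) ltW//; apply: tau_lt; first exact: lt_trans (tinv_gt M0).
near: t; exact: nbhs_pinfty_gt (num_real _).
Unshelve. all: by end_near. Qed.

End time_change.

(** * Equivalence of the Caputo-Katugampola equation with a Volterra equation *)

Section caputo_katugampola.
Context {R : realType}.
Variables (al rho t0 : R).
Hypotheses (a0 : 0 < al) (a1 : al < 1) (rho0 : 0 < rho) (t00 : 0 < t0).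
Local Notation tau := (ktime rho t0).
Local Notation tinv := (ktime_inv rho t0).
Implicit Types (s t : R) (u v g : R -> R).

Definition ck_scale : R := rho `^ al / Gamma (1 - al).
(** Equal to rho^(-al) / Gamma(al), because B(1 - al, al) = Gamma(1 - al) Gamma(al); keeping the
    beta constant makes [conv_volterra_scale] immediate. *)
Definition volterra_scale : R := (ck_scale * betaf (1 - al) al)^-1.

Let be0 : 0 < 1 - al. Proof. by rewrite subr_gt0. Qed.
Let be1 : 1 - al <= 1. Proof. by rewrite gerBl ltW. Qed.

Lemma ck_scale_gt0 : 0 < ck_scale.
Proof. by rewrite divr_gt0 ?powR_gt0//; exact: Gamma_gt0. Qed.

Lemma betaf_gt0 : 0 < betaf (1 - al) al.
Proof. exact: lt_le_trans ltr01 (betaf_ge1 be0 be1 a0 (ltW a1)). Qed.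

Lemma volterra_scale_gt0 : 0 < volterra_scale.
Proof. by rewrite invr_gt0 mulr_gt0 ?ck_scale_gt0 ?betaf_gt0. Qed.

(** Since d tau = rho s^(rho - 1) ds and t^rho - s^rho = tau t - tau s, the integral becomes a
    convolution with the kernel of order 1 - al, up to the factor 1 / rho. *)
Lemma CK_integral_tau u v t : t0 < t -> sing 1 v ->
  (forall s, t0 < s -> u s - u t0 = v (tau s)) ->
  lebesgue_measure.-integrable `[t0, t] (EFin \o CK_kernel al rho t0 u t) /\
  CK_integral al rho t0 u t = rho^-1 * conv (ker (1 - al)) v (tau t).
Proof.
move=> tt sv hu; have tau0 := tau_gt0 rho0 t00 tt.
have ci := conv_intble be0 be1 ltr01 (lexx _) (sing_ker (1 - al)) sv tau0.
have cc := @contoo_conv _ (tau t) _ _ (sing_ker (1 - al)).1 sv.1.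
have tau_r : tau s @[s --> t0^'+] --> (0 : R).
  rewrite -[X in _ --> X](tau_t0 rho t0).
  by apply: cvg_at_right_filter; exact: tau_cont.
have [||||||||i e] := @subst_inc R t0 t 0 (tau t) tau (fun s => rho * s `^ (rho - 1))
    (fun s => rho^-1 * (ker (1 - al) (tau t - s) * v s)) tt tau0.
- by move=> s h _; exact: tau_derive (lt_trans t00 h).
- move=> s h _; apply: cvgM; first exact: cvg_cst.
  exact: powR_contoo (lt_trans t00 h).
- by move=> s _ _; rewrite mulr_ge0 ?powR_ge0// ltW.
- by move=> s h1 h2; split; [exact: tau_gt0|exact: (tau_lt _ rho0 (lt_trans t00 h1))].
- exact: tau_r.
- by apply: cvg_at_left_filter; exact: tau_cont (lt_trans t00 tt).
- by move=> s h1 h2; apply: cvgM; [exact: cvg_cst|exact: cc].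
- exact: intbleZ.
have k s : t0 < s -> s < t ->
    rho^-1 * (ker (1 - al) (tau t - tau s) * v (tau s)) * (rho * s `^ (rho - 1)) =
    CK_kernel al rho t0 u t s.
  move=> h1 h2; rewrite /CK_kernel hu// /ker.
  have -> : 1 - al - 1 = - al by ring.
  have -> : tau t - tau s = t `^ rho - s `^ rho by rewrite /ktime; ring.
  rewrite powRN; move: ((_ `^ al)^-1) (v _) (s `^ (rho - 1)) => x y w.
  by field; rewrite gt_eqF.
split; first exact: eq_intble k i.
have -> : CK_integral al rho t0 u t = rint t0 t (CK_kernel al rho t0 u t) by [].
by rewrite -(eq_rint (intble_measurable_oo i) k) e rintZ.
Qed.

Lemma conv_right0 (a b : R) f g : 0 < a -> a <= 1 -> 0 < b -> b <= 1 -> 1 < a + b ->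
  sing a f -> sing b g -> conv f g s @[s --> 0^'+] --> (0 : R).
Proof.
move=> a0' a1' b0 b1 ab sf sg.
have [C C0 hC] := conv_le_pow a0' a1' b0 b1 sf sg (@ltr01 R).
apply/cvgr0Pnorm_le => e e0.
have ab0 : 0 < a + b - 1 by rewrite subr_gt0.
have lim : C * x `^ (a + b - 1) @[x --> 0^'+] --> (0 : R).
  by rewrite -[X in _ --> X](mulr0 C); apply: cvgM; [exact: cvg_cst|exact: powR_cvg0].
have h1 : \forall x \near 0^'+, C * x `^ (a + b - 1) < e by apply: (cvgr_lt _ lim).
near=> x.
have x0 : 0 < x by near: x; exact: nbhs_right_gt.
have x1 : x <= 1 by near: x; apply: nbhs_right_le.
apply: (le_trans (hC x x0 x1)); rewrite ltW//.
by near: x.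
Unshelve. all: by end_near. Qed.

Lemma conv_volterra_scale g s : sing 1 g -> 0 < s ->
  conv (ker (1 - al)) (fun s => volterra_scale * conv (ker al) g s) s =
  ck_scale^-1 * conv (fun=> 1) g s.
Proof.
move=> sg s0; have sk := sing_conv a0 (ltW a1) ltr01 (lexx _) (sing_ker al) sg.
rewrite (convZr _ be0 be1 ltr01 (lexx _) (sing_ker (1 - al)) sk s0).
rewrite (conv_compl a0 a1 ltr01 (lexx _) sg s0) mulrA; congr (_ * _).
by rewrite /volterra_scale invfM mulfVK// gt_eqF// betaf_gt0.
Qed.

(** The factor t^(1 - rho) of the derivative is, up to rho, the Jacobian of the inverse time change,
    so the derivative of ker (1 - al) * v with respect to tau is a multiple of [g]. Integration from
    0 and uniqueness for Abel's equation of order 1 - al give the Volterra form. *)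
Lemma CK_volterra u v g : sing 1 v -> sing 1 g ->
  (forall s, t0 < s -> u s - u t0 = v (tau s)) ->
  (forall t, t0 < t -> CK_exists al rho t0 u t /\ CK_deriv al rho t0 u t = g (tau t)) ->
  forall s, 0 < s -> v s = volterra_scale * conv (ker al) g s.
Proof.
move=> sv sg hu hck.
have sk := sing_ker (1 - al).
have c0 := ck_scale_gt0.
apply: (conv_ker_inj be0 _ ltr01 (lexx _) sv); first by rewrite gtrBl.
  by apply: singZ; exact: sing_conv a0 (ltW a1) ltr01 (lexx _) (sing_ker al) sg.
move=> s s0; rewrite conv_volterra_scale//.
have dW (y : R) : 0 < y -> is_derive y 1 (conv (ker (1 - al)) v) (ck_scale^-1 * g y).
  move=> y0; have tt := tinv_gt rho0 t00 y0.
  have [[_ /derivableP dI]] := hck _ tt.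
  rewrite tinvK// /CK_deriv -/ck_scale derive1E => eI.
  have dc := is_derive1_comp dI (tinv_derive rho0 t00 y0).
  have dr := @is_deriveZ R R R _ rho y 1 _ dc.
  have {dr}dr := is_derive_eq dr (_ : _ = ck_scale^-1 * g y).
  have hE : \forall x \near y, rho * CK_integral al rho t0 u (tinv x) =
      conv (ker (1 - al)) v x.
    have : \forall x \near y, 0 < x by exact: lt_nbhsr.
    apply: filterS => x x0.
    have [_ e] := CK_integral_tau (tinv_gt rho0 t00 x0) sv hu.
    rewrite e tinvK// mulrA mulfV ?mul1r// gt_eqF//.
  apply: (near_eq_is_derive hE); apply: dr.
  rewrite -eI /GRing.scale/=; field.
  by rewrite !gt_eqF.
have gi := sing_intble ltr01 sg s0.
have e : rint 0 s (fun y => ck_scale^-1 * g y) = conv (ker (1 - al)) v s - 0.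
  apply: (@FTC_open R 0 s _ (conv (ker (1 - al)) v)) => //.
  - exact: intbleZ.
  - by move=> x x0 _; apply: cvgM; [exact: cvg_cst|exact: sg.1].
  - by move=> x x0 _; exact: dW.
  - by apply: (conv_right0 be0 be1 ltr01 (lexx _) _ sk sv); rewrite ltrDr.
  - apply: cvg_at_left_filter; exact: (conv_cont be0 be1 ltr01 (lexx _) sk sv s0).
by rewrite subr0 in e; rewrite -e rintZ// conv1E.
Qed.

(** Near [t] the integral is a multiple of the primitive of [g] taken at tau, and [g] is continuous:
    existence of the derivative and its value follow together from the chain rule. *)
Lemma volterra_CK u v g : sing 1 v -> sing 1 g ->
  (forall s, t0 < s -> u s - u t0 = v (tau s)) ->
  (forall s, 0 < s -> v s = volterra_scale * conv (ker al) g s) ->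
  forall t, t0 < t -> CK_exists al rho t0 u t /\ CK_deriv al rho t0 u t = g (tau t).
Proof.
move=> sv sg hu hv t tt; have c0 := ck_scale_gt0.
have near_t : \forall x \near t, t0 < x by exact: lt_nbhsr.
have ttau := tau_gt0 rho0 t00 tt; have t_gt0 := lt_trans t00 tt.
have sk := sing_ker (1 - al).
have dI : is_derive t 1 (CK_integral al rho t0 u)
    (rho^-1 * (ck_scale^-1 * (g (tau t) * (rho * t `^ (rho - 1))))).
  have dc := is_derive1_comp (conv1_derive ltr01 sg ttau) (tau_derive rho t0 t_gt0).
  have dr := @is_deriveZ R R R _ (rho^-1 * ck_scale^-1) t 1 _ dc.
  have {}dr := is_derive_eq dr (_ : _ = rho^-1 * (ck_scale^-1 * (g (tau t) * (rho * t `^ (rho - 1))))).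
  have hE : \forall x \near t, (rho^-1 * ck_scale^-1) * conv (fun=> 1) g (tau x) =
      CK_integral al rho t0 u x.
    apply: filterS near_t => x x0.
    have [_ ->] := CK_integral_tau x0 sv hu.
    have x1 := tau_gt0 rho0 t00 x0.
    rewrite -mulrA -conv_volterra_scale//; congr (_ * _).
    apply: eq_conv; [exact: sk.1| |by []|].
      exact: (singZ _ (sing_conv a0 (ltW a1) ltr01 (lexx _) (sing_ker al) sg)).1.
    by move=> y y0; rewrite hv.
  apply: (near_eq_is_derive hE); apply: dr.
  by rewrite /GRing.scale/= !mulrA.
split.
  split; last exact: (@ex_derive _ _ _ _ _ _ _ dI).
  by apply: filterS near_t => x x0; exact: (CK_integral_tau x0 sv hu).1.
rewrite /CK_deriv -/ck_scale derive1E (@derive_val _ _ _ _ _ _ _ dI).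
rewrite (_ : 1 - rho = - (rho - 1)); last by ring.
rewrite powRN; have := powR_gt0 (rho - 1) t_gt0.
move: (t `^ (rho - 1)) ck_scale c0 => x c c0 x0; field.
by rewrite !gt_eqF.
Qed.

End caputo_katugampola.

(** * Translation of the spectral and Lipschitz hypotheses *)

Section hypotheses_transfer.
Context {R : realType}.

(** The absolute argument phi is an arccosine with sine |b| / m, and th < phi <= pi gives sin (phi -
    th) > 0; expanding the sine and multiplying by the modulus yields [in_sector]. *)
Lemma in_sector_carg (al : R) (l : Cplx R) : 0 < al -> al < 1 ->
  al * pi / 2 < `|carg l| -> in_sector al l.
Proof.
move=> a0 a1; set th : R := al * pi / 2.
have th0 : 0 < th by rewrite divr_gt0// mulr_gt0// pi_gt0.
case: l => a b; rewrite /carg /in_sector/= -/th.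
case: ifPn => [_|ab]; first by rewrite normr0 ltNge (ltW th0).
have m2 : 0 < a ^+ 2 + b ^+ 2.
  rewrite lt_neqAle addr_ge0 ?sqr_ge0// andbT eq_sym.
  by rewrite paddr_eq0 ?sqr_ge0// !sqrf_eq0.
set m := Num.sqrt (a ^+ 2 + b ^+ 2).
have m0 : 0 < m by rewrite sqrtr_gt0.
have mE : m ^+ 2 = a ^+ 2 + b ^+ 2 by rewrite sqr_sqrtr// ltW.
have am : -1 <= a / m <= 1.
  rewrite -ler_norml normrM normfV (gtr0_norm m0) ler_pdivrMr// mul1r.
  rewrite -ler_sqr ?nnegrE ?(ltW m0)// real_normK ?num_real// mE lerDl sqr_ge0//.
have [/andP[phi0 phipi] cphi] := acos_def am.
move=> h; have {}h : th < acos (a / m).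
  by move: h; case: ifP => _; rewrite ?normrN ger0_norm.
have sphi : sin (acos (a / m)) = `|b| / m.
  rewrite sin_acos// (_ : 1 - (a / m) ^+ 2 = (`|b| / m) ^+ 2); last first.
    rewrite !expr_div_n real_normK ?num_real// mE; field.
    by rewrite gt_eqF.
  by rewrite sqrtr_sqr ger0_norm// divr_ge0// ltW.
have : 0 < sin (acos (a / m) - th).
  apply: sin_gt0_pi; rewrite subr_gt0 h/= ltrBlDr (le_lt_trans phipi)// ltrDl//.
rewrite sinB cphi sphi subr_gt0 -(ltr_pM2r m0).
rewrite (_ : a / m * sin th * m = sin th * a); last by field; rewrite gt_eqF.
by rewrite (_ : `|b| / m * cos th * m = cos th * `|b|); last by field; rewrite gt_eqF.
Qed.

(** The Volterra equation has the matrix c A instead of A; positive scaling of the spectrum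
    preserves the sector, which is a cone. *)
Lemma in_sector_scale d (al c : R) (A : 'M[R]_d) : 0 < c ->
  (forall l, spectrum A l -> in_sector al l) ->
  forall l, eigenvalue (map_mx (fun r : R => complex.Complex r 0) (c *: A)) l ->
    in_sector al l.
Proof.
move=> c0 sec l /eigenvalueP[v].
have -> : map_mx (fun r : R => complex.Complex r 0) (c *: A) =
    (real_complex R c) *: map_mx (real_complex R) A.
  by rewrite -map_mxZ.
move=> vA vn0.
have cn : real_complex R c != 0 by rewrite fmorph_eq0 gt_eqF.
have /sec : spectrum A ((real_complex R c^-1) * l).
  apply/eigenvalueP; exists v => //; rewrite -scalerA -vA -scalemxAr scalerA.
  by rewrite -rmorphM/= mulVf ?gt_eqF// scale1r.
case: l {vA} => a b; rewrite /in_sector/= !mul0r subr0 addr0.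
rewrite normrM (gtr0_norm (_ : 0 < c^-1)) ?invr_gt0//.
by rewrite mulrCA [X in _ < X]mulrCA ltr_pM2l// invr_gt0.
Qed.

Lemma lip_const_flat d (f : 'cV[R]_d -> 'cV[R]_d) :
  (lip_const f r @[r --> 0^'+] --> 0%E) ->
  forall L : R, 0 < L -> exists2 r : R, 0 < r & forall x y : 'cV[R]_d,
    `|x| <= r -> `|y| <= r -> `|f x - f y| <= L * `|x - y|.
Proof.
move=> /fine_cvgP[hfin hlim] L L0.
have hlt : \forall r \near 0^'+, (fine \o lip_const f) r < L by apply: (cvgr_lt _ hlim).
have [r [r0 [fr lr]]] : exists r : R, 0 < r /\ lip_const f r \is a fin_num /\
    fine (lip_const f r) < L.
  near (0 : R)^'+ => r; exists r; split; first by near: r; exact: nbhs_right_gt.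
  by split; near: r.
(* The closed ball of radius r/2 lies inside the open ball used by [lip_const]. *)
exists (r / 2); first by rewrite divr_gt0.
move=> x y xr yr; have [->|xy] := eqVneq x y; first by rewrite !subrr !normr0 mulr0.
have xy0 : 0 < `|x - y| by rewrite normr_gt0 subr_eq0.
have inb (w : 'cV[R]_d) : `|w| <= r / 2 -> ball 0 r w.
  by move=> wr; rewrite -ball_normE/= sub0r normrN (le_lt_trans wr)//; lra.
rewrite -ler_pdivrMr// -lee_fin.
apply: (@le_trans _ _ (lip_const f r)).
  apply: ereal_sup_ubound; exists (x, y) => //=.
  by split; [exact: inb|split; [exact: inb|]].
by rewrite -(fineK fr) lee_fin ltW.
Unshelve. all: by end_near. Qed.

Lemma locally_lipschitz_continuous d (f : 'cV[R]_d -> 'cV[R]_d) :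
  locally_lipschitz f -> continuous f.
Proof.
move=> hf; suff key (x : 'cV[R]_d) : f y @[y --> x] --> f x by move=> x; exact: key.
have [r r0 [L hL]] := hf x.
have FF : Filter (nbhs x) by exact: nbhs_filter.
apply/cvgrPdist_le => e e0.
have L1 : 0 < `|L| + 1 by rewrite ltr_wpDl.
have h1 : \forall y \near x, ball x r y by exact: nbhsx_ballx.
have h2 : \forall y \near x, `|x - y| <= e / (`|L| + 1).
  have := @cvg_id _ (nbhs x) => /cvgrPdist_le; apply; exact: divr_gt0.
near=> y.
have yb : ball x r y by near: y.
have yd : `|x - y| <= e / (`|L| + 1) by near: y.
apply: (le_trans (hL x y (ballxx x r0) yb)).
apply: (@le_trans _ _ ((`|L| + 1) * `|x - y|)).
  by rewrite ler_wpM2r// (le_trans (ler_norm L))// lerDl.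
by rewrite mulrC -ler_pdivlMr.
Unshelve. all: by end_near. Qed.

End hypotheses_transfer.

(** * Correspondence between the solutions of the two equations *)

Section solutions_transfer.
Context {R : realType} {d : nat}.
Variables (al rho t0 : R) (A : 'M[R]_d) (f : 'cV[R]_d -> 'cV[R]_d).
Hypotheses (a0 : 0 < al) (a1 : al < 1) (rho0 : 0 < rho) (t00 : 0 < t0).
Hypothesis cf : continuous f.
Local Notation tau := (ktime rho t0).
Local Notation tinv := (ktime_inv rho t0).
Local Notation c := (volterra_scale al rho).
Implicit Types (s t : R).

Lemma mulmx_cvg (U : Type) (F : set_system U) {FF : Filter F} (y : U -> 'cV[R]_d)
    (x : 'cV[R]_d) : y u @[u --> F] --> x -> (A *m y u : 'cV[R]_d) @[u --> F] --> A *m x.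
Proof.
have [L L0 hL] := lipschitz_mulmx A.
exact: (lipschitz_cvg L0 hL).
Qed.

Lemma field_cvg (U : Type) (F : set_system U) {FF : Filter F} (y : U -> 'cV[R]_d)
    (x : 'cV[R]_d) i : y u @[u --> F] --> x ->
  (A *m y u + f (y u)) i ord0 @[u --> F] --> (A *m x + f x) i ord0.
Proof.
move=> yx; apply: (@cvg_entry _ _ _ _ _ (fun u => A *m y u + f (y u))).
apply: cvgD; first exact: mulmx_cvg.
by apply: cvg_comp yx _; exact: cf.
Qed.

Section transfer.
Variables (z0 : 'cV[R]_d) (z : R -> 'cV[R]_d).
Hypothesis cz : forall s, 0 < s -> {for s, continuous z}.
Hypothesis rz : z s @[s --> 0^'+] --> z0.

Lemma vsing_of_cvg : vsing 1 z.
Proof.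
move=> i; apply: (@sing1_of_cvg _ _ (z0 i ord0)).
  by move=> s s0; apply: cvg_entry; exact: cz.
exact: cvg_entry.
Qed.

Lemma sing_field i : sing 1 (fun s => (A *m z s + f (z s)) i ord0).
Proof.
apply: (@sing1_of_cvg _ _ ((A *m z0 + f z0) i ord0)).
  by move=> s s0; apply: field_cvg; exact: cz.
exact: field_cvg.
Qed.

Lemma vsing_nonlinearity : vsing 1 (fun s => c *: f (z s)).
Proof.
have fcvg (U : Type) (F : set_system U) (FF : Filter F) (y : U -> 'cV[R]_d) (x : 'cV[R]_d) i :
    y u @[u --> F] --> x -> (c *: f (y u)) i ord0 @[u --> F] --> (c *: f x) i ord0.
  move=> yx; have -> : (fun u => (c *: f (y u)) i ord0) = (fun u => c * f (y u) i ord0).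
    by apply/funext => u; rewrite mxE.
  rewrite mxE; apply: cvgM; first exact: cvg_cst.
  apply: (@cvg_entry _ _ _ _ _ (fun u => f (y u))).
  by apply: cvg_comp yx _; exact: cf.
move=> i; apply: (@sing1_of_cvg _ _ ((c *: f z0) i ord0)).
  by move=> s s0; apply: fcvg; exact: cz.
exact: fcvg.
Qed.

Lemma volterra_componentwise :
  (forall s, 0 < s -> z s = z0 + vconv (ker al) (fun s => (c *: A) *m z s + c *: f (z s)) s) <->
  (forall i s, 0 < s -> z s i ord0 - z0 i ord0 =
     c * conv (ker al) (fun s => (A *m z s + f (z s)) i ord0) s).
Proof.
have e i s : 0 < s -> vconv (ker al) (fun s => (c *: A) *m z s + c *: f (z s)) s i ord0 =
    c * conv (ker al) (fun s => (A *m z s + f (z s)) i ord0) s.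
  move=> s0.
  rewrite mxE -(convZr c a0 (ltW a1) ltr01 (lexx _) (sing_ker al) (sing_field i) s0).
  by congr conv; apply/funext => x; rewrite -scalemxAl -scalerDr mxE.
split=> h.
  move=> i s s0; have /matrixP/(_ i ord0) := h s s0; rewrite [X in _ = X]mxE e// => ->.
  by rewrite addrAC subrr add0r.
move=> s s0; apply/matrixP => i j; rewrite (ord1 j) mxE e// -h//.
by rewrite addrC subrK.
Qed.

(** Stated for a pair [x], [z] related by the time change, with [z] continuous and convergent at 0:
    this regularity is available from either equation, so one equivalence serves both directions. *)
Lemma ck_iff_volterra (x : R -> 'cV[R]_d) : x t0 = z0 ->
  (forall t, t0 < t -> x t = z (tau t)) ->
  (forall t, t0 < t -> forall i : 'I_d,
    CK_exists al rho t0 (fun s => x s i ord0) t /\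
    CK_deriv al rho t0 (fun s => x s i ord0) t = (A *m x t + f (x t)) i ord0) <->
  (forall s, 0 < s -> z s = z0 + vconv (ker al) (fun s => (c *: A) *m z s + c *: f (z s)) s).
Proof.
move=> x0 xz; apply: (iff_trans _ (iff_sym volterra_componentwise)).
have sv i : sing 1 (fun s => z s i ord0 - z0 i ord0).
  by apply: sing1B; [exact: vsing_of_cvg|exact: sing_cst].
have hu i s : t0 < s -> x s i ord0 - x t0 i ord0 = z (tau s) i ord0 - z0 i ord0.
  by move=> ts; rewrite x0 xz.
split=> [h i|h t tt i].
  apply: (CK_volterra a0 a1 rho0 t00 (sv i) (sing_field i) (hu i)) => t tt.
  by have [h1 h2] := h t tt i; split => //; rewrite h2 xz.
have := volterra_CK a0 a1 rho0 t00 (sv i) (sing_field i) (hu i) (h i) tt.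
by rewrite xz.
Qed.

End transfer.

Lemma volterra_of_solution (x0 : 'cV[R]_d) x : is_global_solution al rho t0 A f x0 x ->
  volterra_solution al (c *: A) (fun y => c *: f y) x0 (fun s => x (tinv s)).
Proof.
move=> [xt0 [/continuous_within_itvcyP[cx rx] hx]].
have cz s : 0 < s -> {for s, continuous (fun s => x (tinv s))}.
  move=> s0; apply: (@cvg_comp _ _ _ tinv x _ (nbhs (tinv s))).
    exact: tinv_cont (ltW s0).
  by apply: cx; rewrite in_itv/= andbT; exact: tinv_gt.
have rz : x (tinv s) @[s --> 0^'+] --> x0.
  by rewrite -xt0; apply: cvg_comp (tinv_right rho0 t00) rx.
split=> //; [exact: (vsing_of_cvg cz rz)|exact: (vsing_nonlinearity cz rz)|].
apply/(ck_iff_volterra cz rz xt0) => // t tt.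
by rewrite tauK// (lt_trans t00).
Qed.

(** The value of [z] at 0 is arbitrary, so the initial value has to be prescribed separately at
    [t0]; the right limit of [z] then ensures continuity. *)
Lemma solution_of_volterra (x0 : 'cV[R]_d) z :
  volterra_solution al (c *: A) (fun y => c *: f y) x0 z ->
  is_global_solution al rho t0 A f x0 (fun t => if t <= t0 then x0 else z (tau t)).
Proof.
move=> [sz _ rz ez]; set x := (fun t => _).
have cz s : 0 < s -> {for s, continuous z} by exact: vsing_cont sz.
have xt0 : x t0 = x0 by rewrite /x lexx.
have xz t : t0 < t -> x t = z (tau t) by move=> tt; rewrite /x leNgt tt.
split=> //; split; last exact/(ck_iff_volterra cz rz xt0 xz).
apply/continuous_within_itvcyP; split.
  move=> t; rewrite in_itv/= andbT => tt.
  apply: (@near_eq_continuous_at _ _ (fun t => z (tau t))).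
    have : \forall y \near t, t0 < y by exact: lt_nbhsr.
    by apply: filterS => y yt; rewrite xz.
  apply: (@cvg_comp _ _ _ tau z _ (nbhs (tau t))).
    exact: tau_cont (lt_trans t00 tt).
  by apply: cz; exact: tau_gt0.
rewrite xt0; apply: (@cvg_trans _ ((fun t => z (tau t)) @ t0^'+)).
  by apply: near_eq_cvg; near=> t; rewrite xz.
exact: cvg_comp (tau_right rho0 t00) rz.
Unshelve. all: by end_near. Qed.

End solutions_transfer.

Theorem theorem3p1 (R : realType) (d : nat) (alpha rho t0 : R)
    (A : 'M[R]_d) (f : 'cV[R]_d -> 'cV[R]_d) :
  0 < alpha -> alpha < 1 -> 0 < rho -> 0 < t0 ->
  (forall l, spectrum A l -> alpha * pi / 2 < `|carg l|) ->
  locally_lipschitz f ->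
  f 0 = 0 ->
  (lip_const f r @[r --> 0^'+] --> 0%E) ->
  zero_asymptotically_stable alpha rho t0 A f.
Proof.
move=> a0 a1 rho0 t00 spec lipf f0 flatf.
pose c := volterra_scale alpha rho.
have c0 : 0 < c by exact: volterra_scale_gt0.
have cf := locally_lipschitz_continuous lipf.
have sec := in_sector_scale c0 (fun l h => in_sector_carg a0 a1 (spec l h)).
have flat (L : R) : 0 < L -> exists2 r : R, 0 < r & forall x y : 'cV[R]_d,
    `|x| <= r -> `|y| <= r -> `|c *: f x - c *: f y| <= L * `|x - y|.
  move=> L0; have [r r0 hr] := lip_const_flat flatf (divr_gt0 L0 c0).
  exists r => // x y xr yr; rewrite -scalerBr normrZ (gtr0_norm c0).
  rewrite -ler_pdivlMl//; apply: (le_trans (hr x y xr yr)).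
  by apply: eq_le_num; ring.
have g0 : c *: f 0 = 0 by rewrite f0 scaler0.
have [r r0 stab] := volterra_stability a0 a1 sec g0 flat.
have main (eps : R) : 0 < eps -> eps <= r -> exists2 dl : R, 0 < dl &
    forall x0 : 'cV[R]_d, `|x0| <= dl ->
    (exists x, is_global_solution alpha rho t0 A f x0 x) /\
    (forall x, is_global_solution alpha rho t0 A f x0 x ->
      (forall t, t0 <= t -> `|x t| <= eps) /\ x t @[t --> +oo] --> (0 : 'cV[R]_d)).
  move=> e0 er; have [dl dl0 hdl] := stab eps e0 er.
  (* The minimum with [eps] covers the initial time, where the solution equals x0 and the Volterra
     bound says nothing. *)
  exists (Num.min dl eps); first by rewrite lt_min dl0.
  move=> x0; rewrite le_min => /andP[x0d x0e]; have [[z hz] hall] := hdl x0 x0d.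
  split; first by eexists; exact: (solution_of_volterra a0 a1 rho0 t00 cf hz).
  move=> x hx; have [xt0 _] := hx.
  have [bz lz] := hall _ (volterra_of_solution a0 a1 rho0 t00 cf hx).
  have xE t : t0 < t -> x (ktime_inv rho t0 (ktime rho t0 t)) = x t.
    by move=> tt; rewrite tauK// (lt_trans t00).
  split.
    move=> t; rewrite le_eqVlt => /predU1P[<-|tt]; first by rewrite xt0.
    by rewrite -xE// bz// tau_gt0.
  apply: (@cvg_trans _ ((fun t => x (ktime_inv rho t0 (ktime rho t0 t))) @ +oo)).
    apply: near_eq_cvg; near=> t; rewrite xE//.
    by near: t; exact: nbhs_pinfty_gt (num_real t0).
  apply: (@cvg_comp _ _ _ (ktime rho t0) (fun s => x (ktime_inv rho t0 s)) _ _ _ _ lz).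
  exact: tau_pinfty.
split.
  (* The local result holds for radii up to [r] only; a larger [eps] is replaced by [r]. *)
  move=> eps e0; have m0 : 0 < Num.min eps r by rewrite lt_min e0.
  have mr : Num.min eps r <= r by rewrite ge_min lexx orbT.
  have me : Num.min eps r <= eps by rewrite ge_min lexx.
  have [dl dl0 h] := main _ m0 mr; exists dl => // x0 /h[ex bd]; split=> // x /bd[b _] t tt.
  exact: le_trans (b t tt) me.
have [dl dl0 h] := main _ r0 (lexx r); exists dl => // x0 /h[ex bd].
by split=> // x /bd[].
Unshelve. all: by end_near. Qed.
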